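(* There is an algorithm that solves WVC* in $O^*(1.443^t)$ time and polynomial space. On graphs of maximum degree at most $3$, it solves WVC* in $O^*(1.415^t)$ time and polynomial space.
   Context: WVC*: given an undirected graph $G=(V,E)$, a weight function $w:V\to\mathbb{R}$ with all weights at least $1$, a real $W\ge1$, and a minimum-cardinality vertex cover $U$ of $G$, return a vertex cover of $G$ of total weight at most $W$ if one exists (and otherwise report that none exists). Here $t=|U|$ is the minimum size of a vertex cover of $G$. $O^*(f)$ denotes $f\cdot n^{O(1)}$ with $n$ the input size. *)

(* Defs.v *)
From HB Require Import structures.
From mathcomp Require Import all_boot all_order all_algebra.
From mathcomp Require Import reals.

Set Implicit Arguments.
Unset Strict Implicit.
Unset Printing Implicit Defensive.

Import Order.TTheory GRing.Theory Num.Theory.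

Local Open Scope ring_scope.

(** * Programs

  The model of computation is a unit-cost random access machine with two
  memories, one of natural numbers and one of real numbers, both indexed by
  natural numbers. Programs are finite pieces of syntax in which no real constant
  occurs, so that one program serves all graphs and all weights. Real numbers
  can be added, subtracted, compared and moved, and nothing else: in
  particular there is no rounding and no conversion to natural numbers. *)

Inductive nexp : Type :=
  | NConst of nat
  | NRead of nexp                 (* contents of the natural cell at an address *)
  | NAdd of nexp & nexp
  | NSub of nexp & nexp           (* truncated subtraction *)
  | NMul of nexp & nexp.

Inductive rexp : Type :=
  | RZero
  | RRead of nexp                 (* contents of the real cell at an address *)
  | RAdd of rexp & rexp
  | RSub of rexp & rexp.

Inductive bexp : Type :=
  | NLe of nexp & nexp
  | RLe of rexp & rexp
  | BNot of bexp
  | BAnd of bexp & bexp.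

Inductive cmd : Type :=
  | Skip
  | NWrite of nexp & nexp         (* address, value *)
  | RWrite of nexp & rexp         (* address, value *)
  | Seq of cmd & cmd
  | If of bexp & cmd & cmd
  | While of bexp & cmd.

Section Semantics.
Variable R : realType.

Record state : Type := State { nats : nat -> nat; reals : nat -> R }.

Fixpoint neval (s : state) (e : nexp) : nat :=
  match e with
  | NConst k => k
  | NRead a => nats s (neval s a)
  | NAdd e1 e2 => (neval s e1 + neval s e2)%N
  | NSub e1 e2 => (neval s e1 - neval s e2)%N
  | NMul e1 e2 => (neval s e1 * neval s e2)%N
  end.

Fixpoint reval (s : state) (e : rexp) : R :=
  match e with
  | RZero => 0
  | RRead a => reals s (neval s a)
  | RAdd e1 e2 => reval s e1 + reval s e2
  | RSub e1 e2 => reval s e1 - reval s e2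
  end.

Fixpoint beval (s : state) (b : bexp) : bool :=
  match b with
  | NLe e1 e2 => (neval s e1 <= neval s e2)%N
  | RLe e1 e2 => reval s e1 <= reval s e2
  | BNot b1 => ~~ beval s b1
  | BAnd b1 b2 => beval s b1 && beval s b2
  end.

Definition upd (T : Type) (m : nat -> T) (a : nat) (x : T) : nat -> T :=
  fun i => if i == a then x else m i.

(** [exec ok c s t s']: started in [s], the command [c] halts in [s'] after [t]
  steps, and every state reached on the way, including [s] and [s'], satisfies
  [ok]. Each assignment, test or [Skip] is one step; evaluating an expression
  takes a number of operations that depends on the program only. *)
Inductive exec (ok : state -> Prop) : cmd -> state -> nat -> state -> Prop :=
  | ExecSkip s :
      ok s -> exec ok Skip s 1 s
  | ExecNWrite a e s :
      let s' := State (upd (nats s) (neval s a) (neval s e)) (reals s) in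
      ok s -> ok s' -> exec ok (NWrite a e) s 1 s'
  | ExecRWrite a e s :
      let s' := State (nats s) (upd (reals s) (neval s a) (reval s e)) in
      ok s -> ok s' -> exec ok (RWrite a e) s 1 s'
  | ExecSeq c1 c2 s1 t1 s2 t2 s3 :
      exec ok c1 s1 t1 s2 -> exec ok c2 s2 t2 s3 ->
      exec ok (Seq c1 c2) s1 (t1 + t2) s3
  | ExecIfTrue b c1 c2 s t s' :
      beval s b -> exec ok c1 s t s' -> exec ok (If b c1 c2) s t.+1 s'
  | ExecIfFalse b c1 c2 s t s' :
      ~~ beval s b -> exec ok c2 s t s' -> exec ok (If b c1 c2) s t.+1 s'
  | ExecWhileFalse b c s :
      ok s -> ~~ beval s b -> exec ok (While b c) s 1 s
  | ExecWhileTrue b c s1 t1 s2 t2 s3 :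
      beval s1 b -> exec ok c s1 t1 s2 -> exec ok (While b c) s2 t2 s3 ->
      exec ok (While b c) s1 (t1 + t2).+1 s3.

(** [fits S M s]: the state [s] occupies at most [S] cells of each memory, every
  natural cell holds at most [S] bits, and no real cell exceeds [M], which will
  be the magnitude of the input numbers, by a factor of more than [2 ^ S].
  Without the last two requirements, a single cell could serve as a store of
  exponentially many bits. On integral weights they say that every cell holds
  at most [S] bits more than the input numbers. Cells containing zero, the
  initial contents of unused memory, occupy no space. *)
Definition fits (S : nat) (M : R) (s : state) : Prop :=
  [/\ forall a, (S <= a)%N -> nats s a = 0%N /\ reals s a = 0,
      forall a, (nats s a < 2 ^ S)%N &
      forall a, `|reals s a| <= 2 ^+ S * M].

End Semantics.

(** * The problem *)

Definition vertex_cover (n : nat) (e : rel 'I_n) (C : {set 'I_n}) : Prop :=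
  forall u v, e u v -> (u \in C) || (v \in C).

Definition minimum_vertex_cover (n : nat) (e : rel 'I_n) (U : {set 'I_n}) :
    Prop :=
  vertex_cover e U /\ forall C, vertex_cover e C -> (#|U| <= #|C|)%N.

Definition max_degree_le (n : nat) (e : rel 'I_n) (d : nat) : Prop :=
  forall v, (#|[set u | e v u]| <= d)%N.

Record instance (R : realType) : Type := Instance {
  order : nat;
  edge : rel 'I_order;
  weight : 'I_order -> R;
  budget : R;
  mincover : {set 'I_order}
}.

Arguments edge {R} i _ _.
Arguments weight {R} i _.

Section Instances.
Variables (R : realType) (I : instance R).

Definition total_weight (C : {set 'I_(order I)}) : R :=
  \sum_(v in C) weight I v.

Definition valid_instance : Prop :=
  [/\ symmetric (edge I) /\ irreflexive (edge I),
      forall v : 'I_(order I), 1 <= weight I v,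
      1 <= budget I &
      minimum_vertex_cover (edge I) (mincover I)].

(** Natural cells: the number n of vertices, n bits for the given minimum vertex
  cover, then the n * n bits of the adjacency matrix, row by row. Real cells: W,
  then the n weights. *)
Definition nat_input : seq nat :=
  order I :: [seq (v \in mincover I : nat) | v <- enum 'I_(order I)]
    ++ [seq (edge I u v : nat) | u <- enum 'I_(order I), v <- enum 'I_(order I)].

Definition real_input : seq R :=
  budget I :: [seq weight I v | v <- enum 'I_(order I)].

Definition initial_state : state R :=
  State (nth 0%N nat_input) (nth 0 real_input).

(** The number of machine words of the input: a real number is one word. *)
Definition input_size : nat := size nat_input + size real_input.

Definition input_magnitude : R := budget I + \sum_v weight I v.

(** Natural cell 0 says whether a solution is returned; if so, the solution is
  read off cells 1, ..., n. *)
Definition output_cover (s : state R) : {set 'I_(order I)} :=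
  [set v : 'I_(order I) | nats s v.+1 != 0%N].

Definition correct_output (s : state R) : Prop :=
  if nats s 0 != 0%N then
    vertex_cover (edge I) (output_cover s) /\
    total_weight (output_cover s) <= budget I
  else
    ~ exists2 C : {set 'I_(order I)},
        vertex_cover (edge I) C & total_weight C <= budget I.

End Instances.

(** On the valid instances in [D], [p] solves WVC* in O*(b ^ t) time, where t is
  the minimum size of a vertex cover, and polynomial space. *)
Definition solves_WVCstar (R : realType) (p : cmd) (D : instance R -> Prop)
    (b : R) : Prop :=
  exists c k : nat, forall I : instance R, valid_instance I -> D I ->
    let bound := (c * input_size I ^ k)%N in
    exists (t : nat) (s : state R),
      [/\ exec (fits bound (input_magnitude I)) p (initial_state I) t s,
          correct_output I s &
          t%:R <= bound%:R * b ^+ #|mincover I|].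

(* Main.v *)
(** A branching algorithm is run as a loop over a counter [c < N] whose value
  encodes a leaf of the search tree, so that a leaf costs polynomial time and
  all leaves share the same space.

  In general the leaves are the maximal independent sets of the graph induced
  on the given cover [U]; branching on the closed neighbourhood of a vertex of
  minimum degree yields at most [3 ^ (t / 3)] of them, and 3 < 1.443 ^ 3. If [C]
  is a cover and the independent set [U \ C] extends to a maximal one [M], then
  [C] contains [U \ M]; what is left is a minimum weight cover of the bipartite
  graph between [M] and the complement of [U], which a push-relabel flow finds.

  In maximum degree three, the cost of an assignment of the vertices is a sum of
  unary and binary tables, and vertices are eliminated in order of minimum
  degree. A vertex with at most two neighbours is minimised out exactly, at the
  price of one table on its neighbours; a vertex of degree three is branched on.
  Counting edges between [U] and its complement, there are at most [2 * t]
  vertices of degree three, and each branching uses up four of them, whence at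
  most [t / 2] branchings, and 2 < 1.415 ^ 2.

  Programs are written in a language of bounded loops. A single static
  expression in the number of vertices bounds their running time, the cells they
  address and the growth of the values they compute. *)

Require Import Defs.
From HB Require Import structures.
From mathcomp Require Import all_boot all_order all_algebra.
From mathcomp Require Import boolp reals.
From mathcomp Require Import zify ring lra.

Set Implicit Arguments.
Unset Strict Implicit.
Unset Printing Implicit Defensive.

Import Order.TTheory GRing.Theory Num.Theory.

Local Open Scope nat_scope.

(** * Bounded-loop programs *)

(** Every leaf ends with an explicit check of its candidate, so soundness comes for free and a
    counter value that decodes to nonsense is harmless. What remains to be proved is that, if a
    solution exists, some counter value leads to one. The number of leaves is exponential, so
    numbers that grew from leaf to leaf would outgrow polynomially many bits. For this reason all
    working memory but the counter is cleared before each leaf: a leaf becomes a function of the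
    counter, the static bounds concern one iteration only, and the outer loop stays outside the
    bounded language. Weights are arbitrary reals, without division or rounding. The flow therefore
    needs a termination measure that ignores magnitudes, which push-relabel provides, and edges are
    enforced in the tables by a penalty obtained by additions, the budget plus all weights. A
    counter is decoded by subtraction and comparison alone, in a mixed radix for the independent
    sets and in binary for the cubic case. One program serves both bounds, as it tests the maximum
    degree at run time. *)

(* Indices of written cells only involve constants, the number of vertices and
   the variables of enclosing loops, and so do loop bounds; this is what makes
   time, addresses and the growth of stored numbers statically bounded. *)
Inductive ix : Type :=
  | IV of nat
  | IC of nat
  | IN
  | IAdd of ix & ix
  | ISub of ix & ix
  | IMul of ix & ix.

Inductive nx : Type :=
  | XI of ix
  | XU of nx                      (* bit of the given minimum cover *)
  | XA of nx & nx                 (* bit of the adjacency matrix *)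
  | XRd of nat & nx               (* array, index *)
  | XAdd of nx & nx
  | XSub of nx & nx
  | XMul of ix & nx.

Inductive rx : Type :=
  | YZ
  | YW                            (* budget *)
  | YWt of nx                     (* weight of a vertex *)
  | YRd of nat & nx
  | YAdd of rx & rx
  | YSub of rx & rx.

Inductive bx : Type :=
  | BN of nx & nx
  | BE of nx & nx
  | BR of rx & rx
  | BNeg of bx
  | BConj of bx & bx.

Inductive prog : Type :=
  | PSkip
  | PN of nat & ix & nx           (* array, index, value *)
  | PR of nat & ix & rx
  | PSeq of prog & prog
  | PIf of bx & prog & prog
  | PFor of nat & ix & prog.      (* variable, bound, body *)

Definition env0 : nat -> nat := fun _ => 0.

Fixpoint ieval (n : nat) (env : nat -> nat) (e : ix) : nat :=
  match e with
  | IV x => env x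
  | IC k => k
  | IN => n
  | IAdd a b => ieval n env a + ieval n env b
  | ISub a b => ieval n env a - ieval n env b
  | IMul a b => ieval n env a * ieval n env b
  end.

Section Run.
Variables (R : realType) (n : nat) (inn : nat -> nat) (inr : nat -> R).

Record store := Store { na : nat -> nat -> nat; ra : nat -> nat -> R }.

Definition setn (h : store) (k i v : nat) : store :=
  Store (fun k' => if k' == k then upd (na h k') i v else na h k') (ra h).
Definition setr (h : store) (k i : nat) (v : R) : store :=
  Store (na h) (fun k' => if k' == k then upd (ra h k') i v else ra h k').

(* Out-of-range input reads are clamped to the last input cell. *)
Definition uin (i : nat) : nat := inn (minn i.+1 (n * n + n)).
Definition ain (u v : nat) : nat := inn (minn (n.+1 + n * u + v) (n * n + n)).
Definition win (i : nat) : R := inr (minn i.+1 (n * n + n)).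

Fixpoint xeval (env : nat -> nat) (h : store) (e : nx) : nat :=
  match e with
  | XI i => ieval n env i
  | XU a => uin (xeval env h a)
  | XA a b => ain (xeval env h a) (xeval env h b)
  | XRd k a => na h k (xeval env h a)
  | XAdd a b => xeval env h a + xeval env h b
  | XSub a b => xeval env h a - xeval env h b
  | XMul i a => ieval n env i * xeval env h a
  end.

Fixpoint yeval (env : nat -> nat) (h : store) (e : rx) : R :=
  match e with
  | YZ => 0%R
  | YW => inr 0
  | YWt a => win (xeval env h a)
  | YRd k a => ra h k (xeval env h a)
  | YAdd a b => (yeval env h a + yeval env h b)%R
  | YSub a b => (yeval env h a - yeval env h b)%R
  end.

Fixpoint bxeval (env : nat -> nat) (h : store) (b : bx) : bool :=
  match b with
  | BN a b => xeval env h a <= xeval env h b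
  | BE a b => xeval env h a == xeval env h b
  | BR a b => (yeval env h a <= yeval env h b)%R
  | BNeg b => ~~ bxeval env h b
  | BConj a b => bxeval env h a && bxeval env h b
  end.

Fixpoint run (p : prog) (env : nat -> nat) (h : store) : store :=
  match p with
  | PSkip => h
  | PN k i e => setn h k (ieval n env i) (xeval env h e)
  | PR k i e => setr h k (ieval n env i) (yeval env h e)
  | PSeq a b => run b env (run a env h)
  | PIf b p q => if bxeval env h b then run p env h else run q env h
  | PFor x b p =>
      iteri (ieval n env b) (fun i => run p (upd env x i)) h
  end.

End Run.

Arguments Store {R} _ _.

(** Arrays and loop variables share this bound on their numbers; it fixes the width of a row in the
    memory layout. *)
Definition narr : nat := 64.

Fixpoint ix_ok (sc : seq nat) (e : ix) : bool :=
  match e with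
  | IV x => x \in sc
  | IC _ | IN => true
  | IAdd a b | ISub a b | IMul a b => ix_ok sc a && ix_ok sc b
  end.

Fixpoint nx_ok (sc : seq nat) (e : nx) : bool :=
  match e with
  | XI i => ix_ok sc i
  | XU a => nx_ok sc a
  | XRd k a => (k < narr) && nx_ok sc a
  | XA a b | XAdd a b | XSub a b => nx_ok sc a && nx_ok sc b
  | XMul i a => ix_ok sc i && nx_ok sc a
  end.

Fixpoint rx_ok (sc : seq nat) (e : rx) : bool :=
  match e with
  | YZ | YW => true
  | YWt a => nx_ok sc a
  | YRd k a => (k < narr) && nx_ok sc a
  | YAdd a b | YSub a b => rx_ok sc a && rx_ok sc b
  end.

Fixpoint bx_ok (sc : seq nat) (b : bx) : bool :=
  match b with
  | BN a b | BE a b => nx_ok sc a && nx_ok sc b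
  | BR a b => rx_ok sc a && rx_ok sc b
  | BNeg b => bx_ok sc b
  | BConj a b => bx_ok sc a && bx_ok sc b
  end.

Fixpoint prog_ok (sc : seq nat) (p : prog) : bool :=
  match p with
  | PSkip => true
  | PN k i e => [&& k < narr, ix_ok sc i & nx_ok sc e]
  | PR k i e => [&& k < narr, ix_ok sc i & rx_ok sc e]
  | PSeq a b => prog_ok sc a && prog_ok sc b
  | PIf b p q => [&& bx_ok sc b, prog_ok sc p & prog_ok sc q]
  | PFor x b p => [&& x < narr, x \notin sc, ix_ok sc b & prog_ok (x :: sc) p]
  end.

(** * Static cost *)

Fixpoint ibound (n : nat) (be : nat -> nat) (e : ix) : nat :=
  match e with
  | IV x => be x
  | IC k => k
  | IN => n
  | IAdd a b => ibound n be a + ibound n be b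
  | ISub a b => ibound n be a
  | IMul a b => ibound n be a * ibound n be b
  end.

(** The factor by which a value may exceed the largest stored number. It is linear in that number
    because the left factor of [XMul] is an index expression: two stored numbers are never
    multiplied. *)
Fixpoint nx_growth (n : nat) (be : nat -> nat) (e : nx) : nat :=
  match e with
  | XI i => ibound n be i
  | XU _ | XA _ _ | XRd _ _ => 1
  | XAdd a b => nx_growth n be a + nx_growth n be b
  | XSub a b => nx_growth n be a
  | XMul i a => ibound n be i * nx_growth n be a
  end.

Fixpoint rx_growth (e : rx) : nat :=
  match e with
  | YZ => 0
  | YW | YWt _ | YRd _ _ => 1
  | YAdd a b | YSub a b => rx_growth a + rx_growth b
  end.

(* One quantity bounds the number of steps, the indices written, and the
   base-2 logarithm of the factor by which stored numbers can grow. *)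
Fixpoint cost (n : nat) (be : nat -> nat) (p : prog) : nat :=
  match p with
  | PSkip => 1
  | PN _ i e => ibound n be i + nx_growth n be e + 1
  | PR _ i e => ibound n be i + rx_growth e + 1
  | PSeq a b => cost n be a + cost n be b
  | PIf b p q => cost n be p + cost n be q + 1
  | PFor x b p =>
      let m := ibound n be b in m * (cost n (upd be x m) p + 2) + m + 2
  end.

(** * Compilation *)

Definition cN : nexp := NRead (NConst 0).
Definition cLast : nexp := NAdd (NMul cN cN) cN.
Definition cBase : nexp := NAdd cLast (NConst 1).
Definition cAddr (e : nexp) (k : nat) : nexp :=
  NAdd cBase (NAdd (NMul (NConst narr.*2) e) (NConst k.*2)).
Definition cVar (x : nat) : nexp := NAdd cBase (NConst x.*2.+1).
Definition cClamp (e : nexp) : nexp := NSub e (NSub e cLast).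

Fixpoint cix (e : ix) : nexp :=
  match e with
  | IV x => NRead (cVar x)
  | IC k => NConst k
  | IN => cN
  | IAdd a b => NAdd (cix a) (cix b)
  | ISub a b => NSub (cix a) (cix b)
  | IMul a b => NMul (cix a) (cix b)
  end.

Fixpoint cnx (e : nx) : nexp :=
  match e with
  | XI i => cix i
  | XU a => NRead (cClamp (NAdd (NConst 1) (cnx a)))
  | XA a b =>
      NRead (cClamp (NAdd (NAdd (NAdd (NConst 1) cN) (NMul cN (cnx a))) (cnx b)))
  | XRd k a => NRead (cAddr (cnx a) k)
  | XAdd a b => NAdd (cnx a) (cnx b)
  | XSub a b => NSub (cnx a) (cnx b)
  | XMul i a => NMul (cix i) (cnx a)
  end.

Fixpoint crx (e : rx) : rexp :=
  match e with
  | YZ => RZero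
  | YW => RRead (NConst 0)
  | YWt a => RRead (cClamp (NAdd (NConst 1) (cnx a)))
  | YRd k a => RRead (cAddr (cnx a) k)
  | YAdd a b => RAdd (crx a) (crx b)
  | YSub a b => RSub (crx a) (crx b)
  end.

Fixpoint cbx (b : bx) : bexp :=
  match b with
  | BN a b => NLe (cnx a) (cnx b)
  | BE a b => BAnd (NLe (cnx a) (cnx b)) (NLe (cnx b) (cnx a))
  | BR a b => RLe (crx a) (crx b)
  | BNeg b => BNot (cbx b)
  | BConj a b => BAnd (cbx a) (cbx b)
  end.

(* Loop variables are zero outside their loop. *)
Fixpoint compile (p : prog) : cmd :=
  match p with
  | PSkip => Skip
  | PN k i e => NWrite (cAddr (cix i) k) (cnx e)
  | PR k i e => RWrite (cAddr (cix i) k) (crx e)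
  | PSeq a b => Seq (compile a) (compile b)
  | PIf b p q => If (cbx b) (compile p) (compile q)
  | PFor x b p =>
      Seq (While (NLe (NAdd (NRead (cVar x)) (NConst 1)) (cix b))
             (Seq (compile p)
                  (NWrite (cVar x) (NAdd (NRead (cVar x)) (NConst 1)))))
          (NWrite (cVar x) (NConst 0))
  end.

(** * Machine states that encode an environment and a store *)

Section Simulation.
Variables (R : realType) (n : nat) (inn : nat -> nat) (inr : nat -> R).
Hypothesis inn0 : inn 0 = n.

Let base := (n * n + n + 1)%N.

(** Past the input the memory is a table with [narr.*2] columns. Row [i] holds cell [i] of array [k]
    in column [2k]; the odd columns of row 0 hold the loop variables. Interleaving the arrays lets
    all of them grow without a length fixed in advance. The real memory uses the same [base],
    although its input is shorter. *)
Definition enc (env : nat -> nat) (h : store R) : state R :=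
  State
    (fun a => if a < base then inn a else
       let c := (a - base) %% narr.*2 in let q := (a - base) %/ narr.*2 in
       if odd c then (if q == 0 then env c./2 else 0) else na h c./2 q)
    (fun a => if a < base then inr a else
       let c := (a - base) %% narr.*2 in let q := (a - base) %/ narr.*2 in
       if odd c then 0%R else ra h c./2 q).

Definition addr (k i : nat) := base + (narr.*2 * i + k.*2).
Definition vaddr (x : nat) := base + x.*2.+1.

Lemma cell_split c q : c < narr.*2 ->
  ((base + (narr.*2 * q + c) - base) %% narr.*2 = c) *
  ((base + (narr.*2 * q + c) - base) %/ narr.*2 = q).
Proof.
move=> hc; rewrite addKn [narr.*2 * q]mulnC; split.
- by rewrite modnMDl modn_small.
- by rewrite divnMDl // divn_small // addn0.
Qed.

Lemma addr_ge k i : (addr k i < base) = false.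
Proof. by apply/negbTE; rewrite -leqNgt leq_addr. Qed.
Lemma vaddr_ge x : (vaddr x < base) = false.
Proof. by apply/negbTE; rewrite -leqNgt leq_addr. Qed.

Lemma nats_addr env h k i : k < narr -> nats (enc env h) (addr k i) = na h k i.
Proof.
move=> hk; rewrite /= addr_ge.
by rewrite !cell_split ?ltn_double // odd_double doubleK.
Qed.

Lemma reals_addr env h k i : k < narr -> reals (enc env h) (addr k i) = ra h k i.
Proof.
move=> hk; rewrite /= addr_ge.
by rewrite !cell_split ?ltn_double // odd_double doubleK.
Qed.

Lemma vaddr_split x : x < narr ->
  ((vaddr x - base) %% narr.*2 = x.*2.+1) * ((vaddr x - base) %/ narr.*2 = 0).
Proof.
move=> hx; have h : x.*2.+1 < narr.*2 by lia.
have := @cell_split _ 0 h; rewrite muln0 add0n /vaddr; by case=> -> ->.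
Qed.

Lemma nats_vaddr env h x : x < narr -> nats (enc env h) (vaddr x) = env x.
Proof.
move=> hx; rewrite /= vaddr_ge !vaddr_split //= odd_double /=.
by rewrite uphalf_double.
Qed.

Lemma enc_setn env h k i v : k < narr ->
  State (upd (nats (enc env h)) (addr k i) v) (reals (enc env h))
  = enc env (setn h k i v).
Proof.
move=> hk; rewrite /enc /=; congr State; apply: funext => a; rewrite /upd.
have [-> | ne] := eqVneq a (addr k i).
  by rewrite addr_ge !cell_split ?ltn_double // odd_double doubleK !eqxx.
case: ltnP => // ha; case: ifP => // od.
case: ifP => // /eqP ek; case: ifP => // /eqP ei.
case/eqP: ne; rewrite /addr -{}ei -ek even_halfK ?od //.
by rewrite mulnC -divn_eq subnKC.
Qed.

Lemma enc_setr env h k i v : k < narr ->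
  State (nats (enc env h)) (upd (reals (enc env h)) (addr k i) v)
  = enc env (setr h k i v).
Proof.
move=> hk; rewrite /enc /=; congr State; apply: funext => a; rewrite /upd.
have [-> | ne] := eqVneq a (addr k i).
  by rewrite addr_ge !cell_split ?ltn_double // odd_double doubleK !eqxx.
case: ltnP => // ha; case: ifP => // od.
case: ifP => // /eqP ek; case: ifP => // /eqP ei.
case/eqP: ne; rewrite /addr -{}ei -ek even_halfK ?od //.
by rewrite mulnC -divn_eq subnKC.
Qed.

Lemma enc_setv env h x v : x < narr ->
  State (upd (nats (enc env h)) (vaddr x) v) (reals (enc env h))
  = enc (upd env x v) h.
Proof.
move=> hx; rewrite /enc /=; congr State; apply: funext => a; rewrite /upd.
have [-> | ne] := eqVneq a (vaddr x).
  by rewrite vaddr_ge !vaddr_split //= odd_double /= uphalf_double eqxx.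
case: ltnP => // ha; case: ifP => // od.
case: ifP => // /eqP eq0; case: ifP => // /eqP ex.
case/eqP: ne; rewrite /vaddr -ex.
have := divn_eq (a - base) narr.*2; rewrite eq0 mul0n add0n.
by have := odd_double_half ((a - base) %% narr.*2); rewrite od => <- e; lia.
Qed.

Lemma neval_cN env h : neval (enc env h) cN = n.
Proof. by rewrite /= /base addn1 inn0. Qed.

Lemma neval_cLast env h : neval (enc env h) cLast = n * n + n.
Proof.
rewrite -[LHS]/(neval (enc env h) cN * neval (enc env h) cN + neval (enc env h) cN).
by rewrite neval_cN.
Qed.

Lemma neval_cAddr env h e k :
  neval (enc env h) (cAddr e k) = addr k (neval (enc env h) e).
Proof.
rewrite -[LHS]/(neval (enc env h) cLast + 1 + (narr.*2 * neval (enc env h) e + k.*2)).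
by rewrite neval_cLast.
Qed.

Lemma neval_cVar env h x : neval (enc env h) (cVar x) = vaddr x.
Proof.
by rewrite -[LHS]/(neval (enc env h) cLast + 1 + x.*2.+1) neval_cLast.
Qed.

Lemma neval_cClamp env h e : neval (enc env h) (cClamp e) =
  minn (neval (enc env h) e) (n * n + n).
Proof.
rewrite /cClamp -[LHS]/(neval _ e - (neval _ e - neval _ cLast)) neval_cLast.
by rewrite minnE.
Qed.

Lemma neval_cix sc env h e : all (gtn narr) sc -> ix_ok sc e ->
  neval (enc env h) (cix e) = ieval n env e.
Proof.
move=> hsc; elim: e => [x|k||a IHa b IHb|a IHa b IHb|a IHa b IHb].
- move=> xsc; have hx : x < narr := allP hsc x xsc; rewrite -[LHS]/(nats _ (neval _ (cVar x))).
  by rewrite neval_cVar nats_vaddr.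
- by [].
- by rewrite neval_cN.
- by case/andP=> /IHa {}IHa /IHb {}IHb; rewrite -[LHS]/(neval _ (cix a) + neval _ (cix b)) IHa IHb.
- by case/andP=> /IHa {}IHa /IHb {}IHb; rewrite -[LHS]/(neval _ (cix a) - neval _ (cix b)) IHa IHb.
- by case/andP=> /IHa {}IHa /IHb {}IHb; rewrite -[LHS]/(neval _ (cix a) * neval _ (cix b)) IHa IHb.
Qed.

Lemma nats_in env h a : a <= n * n + n -> nats (enc env h) a = inn a.
Proof. by move=> ha; rewrite /= /base addn1 ltnS ha. Qed.

Lemma reals_in env h a : a <= n * n + n -> reals (enc env h) a = inr a.
Proof. by move=> ha; rewrite /= /base addn1 ltnS ha. Qed.

Lemma neval_cnx sc env h e : all (gtn narr) sc -> nx_ok sc e ->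
  neval (enc env h) (cnx e) = xeval n inn env h e.
Proof.
move=> hsc; elim: e => [i|a IHa|a IHa b IHb|k a IHa|a IHa b IHb|a IHa b IHb|i a IHa].
- exact: neval_cix.
- move=> /IHa {}IHa.
  rewrite -[LHS]/(nats _ (neval _ (cClamp (NAdd (NConst 1) (cnx a))))).
  rewrite neval_cClamp nats_in ?geq_minr //.
  by rewrite -[neval _ _]/(1 + neval (enc env h) (cnx a)) IHa add1n.
- case/andP=> /IHa {}IHa /IHb {}IHb.
  rewrite -[LHS]/(nats _ (neval _ (cClamp (NAdd (NAdd (NAdd (NConst 1) cN) (NMul cN (cnx a))) (cnx b))))).
  rewrite neval_cClamp nats_in ?geq_minr //.
  rewrite -[neval _ _]/(1 + neval (enc env h) cN + neval (enc env h) cN * neval (enc env h) (cnx a) + neval (enc env h) (cnx b)).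
  by rewrite neval_cN IHa IHb.
- case/andP=> hk /IHa {}IHa.
  rewrite -[LHS]/(nats _ (neval _ (cAddr (cnx a) k))).
  by rewrite neval_cAddr nats_addr // IHa.
- by case/andP=> /IHa {}IHa /IHb {}IHb; rewrite -[LHS]/(neval _ (cnx a) + neval _ (cnx b)) IHa IHb.
- by case/andP=> /IHa {}IHa /IHb {}IHb; rewrite -[LHS]/(neval _ (cnx a) - neval _ (cnx b)) IHa IHb.
- case/andP=> hi /IHa {}IHa; rewrite -[LHS]/(neval _ (cix i) * neval _ (cnx a)) IHa.
  by rewrite (neval_cix _ _ hsc hi).
Qed.

Lemma reval_crx sc env h e : all (gtn narr) sc -> rx_ok sc e ->
  reval (enc env h) (crx e) = yeval n inn inr env h e.
Proof.
move=> hsc; elim: e => [||a|k a|a IHa b IHb|a IHa b IHb].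
- by [].
- by move=> _; rewrite -[LHS]/(reals (enc env h) 0) reals_in.
- move=> ok; rewrite -[LHS]/(reals _ (neval _ (cClamp (NAdd (NConst 1) (cnx a))))).
  rewrite neval_cClamp reals_in ?geq_minr //.
  by rewrite -[neval _ _]/(1 + neval (enc env h) (cnx a)) (neval_cnx _ _ hsc ok) add1n.
- case/andP=> hk ok; rewrite -[LHS]/(reals _ (neval _ (cAddr (cnx a) k))).
  by rewrite neval_cAddr reals_addr // (neval_cnx _ _ hsc ok).
- by case/andP=> /IHa {}IHa /IHb {}IHb; rewrite -[LHS]/(reval _ (crx a) + reval _ (crx b))%R IHa IHb.
- by case/andP=> /IHa {}IHa /IHb {}IHb; rewrite -[LHS]/(reval _ (crx a) - reval _ (crx b))%R IHa IHb.
Qed.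

Lemma beval_cbx sc env h b : all (gtn narr) sc -> bx_ok sc b ->
  beval (enc env h) (cbx b) = bxeval n inn inr env h b.
Proof.
move=> hsc; elim: b => [a b|a b|a b|b IHb|a IHa b IHb].
- case/andP=> oka okb; rewrite -[LHS]/(neval _ (cnx a) <= neval _ (cnx b)).
  by rewrite (neval_cnx _ _ hsc oka) (neval_cnx _ _ hsc okb).
- case/andP=> oka okb; rewrite -[LHS]/((neval _ (cnx a) <= neval _ (cnx b)) && (neval _ (cnx b) <= neval _ (cnx a))).
  by rewrite -eqn_leq (neval_cnx _ _ hsc oka) (neval_cnx _ _ hsc okb).
- case/andP=> oka okb; rewrite -[LHS]/(reval _ (crx a) <= reval _ (crx b))%R.
  by rewrite (reval_crx _ _ hsc oka) (reval_crx _ _ hsc okb).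
- by move=> /IHb {}IHb; rewrite -[LHS]/(~~ beval _ (cbx b)) IHb.
- by case/andP=> /IHa {}IHa /IHb {}IHb; rewrite -[LHS]/(beval _ (cbx a) && beval _ (cbx b)) IHa IHb.
Qed.

End Simulation.

(** * Static bounds on memory and time *)

Section Bounds.
Variables (R : realType) (n : nat) (inn : nat -> nat) (inr : nat -> R).

Lemma updE (T : Type) (m : nat -> T) a v i :
  upd m a v i = if i == a then v else m i.
Proof. by []. Qed.

Lemma upd_upd (T : Type) (m : nat -> T) a v w : upd (upd m a v) a w = upd m a w.
Proof. by apply: funext => i; rewrite !updE; case: eqP. Qed.

Lemma iteri_inv (T : Type) (P : nat -> T -> Prop) b g (x : T) :
  P 0 x -> (forall i y, i < b -> P i y -> P i.+1 (g i y)) -> P b (iteri b g x).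
Proof.
move=> h0 hs; suff: forall k, k <= b -> P k (iteri k g x) by exact.
by elim=> [//|k IH] hk /=; apply: hs => //; apply: IH; apply: ltnW.
Qed.

Definition bounded_mem (h : store R) (IB V : nat) (Rv : R) : Prop :=
  [/\ forall k i, IB <= i -> na h k i = 0 /\ ra h k i = 0%R,
      forall k i, na h k i <= V &
      forall k i, (`|ra h k i| <= Rv)%R].

Lemma ieval_le sc env be e : (forall x, x \in sc -> env x <= be x) ->
  ix_ok sc e -> ieval n env e <= ibound n be e.
Proof.
move=> hbe; elim: e => [x|k||a IHa b IHb|a IHa b IHb|a IHa b IHb] //=.
- exact: hbe.
- by case/andP=> /IHa {}IHa /IHb {}IHb; apply: leq_add.
- by case/andP=> /IHa {}IHa _; apply: leq_trans IHa; apply: leq_subr.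
- by case/andP=> /IHa {}IHa /IHb {}IHb; apply: leq_mul.
Qed.

Lemma xeval_le sc env be (h : store R) V e : (forall x, x \in sc -> env x <= be x) ->
  0 < V -> (forall a, inn a <= V) -> (forall k i, na h k i <= V) ->
  nx_ok sc e -> xeval n inn env h e <= nx_growth n be e * V.
Proof.
move=> hbe V0 hin hh.
elim: e => [i|a IHa|a IHa b IHb|k a IHa|a IHa b IHb|a IHa b IHb|i a IHa] //=.
- by move=> /(ieval_le hbe) hi; apply: leq_trans hi _; rewrite leq_pmulr.
- by move=> _; rewrite mul1n; apply: hin.
- by move=> _; rewrite mul1n; apply: hin.
- by move=> _; rewrite mul1n.
- by case/andP=> /IHa {}IHa /IHb {}IHb; rewrite mulnDl; apply: leq_add.
- by case/andP=> /IHa {}IHa _; apply: leq_trans IHa; apply: leq_subr.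
- by case/andP=> /(ieval_le hbe) hi /IHa {}IHa; rewrite -mulnA; apply: leq_mul.
Qed.

Lemma yeval_le sc env (h : store R) Rv e :
  (0 <= Rv)%R -> (forall a, `|inr a| <= Rv)%R ->
  (forall k i, `|ra h k i| <= Rv)%R ->
  rx_ok sc e -> (`|yeval n inn inr env h e| <= (rx_growth e)%:R * Rv)%R.
Proof.
move=> R0 hir hh; elim: e => [||a|k a|a IHa b IHb|a IHa b IHb] /=.
- by rewrite normr0 mul0r.
- by rewrite mul1r.
- by move=> _; rewrite mul1r; apply: hir.
- by rewrite mul1r.
- case/andP=> /IHa {}IHa /IHb {}IHb; rewrite natrD mulrDl.
  by apply: le_trans (ler_normD _ _) _; apply: lerD.
- case/andP=> /IHa {}IHa /IHb {}IHb; rewrite natrD mulrDl.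
  by apply: le_trans (ler_normB _ _) _; apply: lerD.
Qed.

Lemma bounded_memS h IB V V' Rv Rv' : V <= V' -> (Rv <= Rv')%R ->
  bounded_mem h IB V Rv -> bounded_mem h IB V' Rv'.
Proof.
move=> hV hR [h1 h2 h3]; split=> // k i.
- exact: leq_trans (h2 k i) hV.
- exact: le_trans (h3 k i) hR.
Qed.

Lemma ler_natX2 (m k : nat) : m <= k -> ((m%:R : R) <= 2 ^+ k)%R.
Proof.
move=> hm; apply: (@le_trans _ _ (2 ^ k)%:R%R); last by rewrite natrX.
by rewrite ler_nat; apply: leq_trans hm _; apply: ltnW; apply: ltn_expl.
Qed.

(** Costs add along a program while growth factors multiply, so a factor [2 ^ cost] is stable under
    sequencing; a single assignment of growth [g] is covered by $g \le 2^g$. The bounds [V] and [Rv]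
    are generalised because the second part of a sequence starts from what the first part leaves. *)
Lemma run_bounded p : forall sc env be h IB V Rv,
  prog_ok sc p -> (forall x, x \in sc -> env x <= be x) ->
  cost n be p <= IB -> bounded_mem h IB V Rv ->
  0 < V -> (forall a, inn a <= V) -> (0 <= Rv)%R ->
  (forall a, `|inr a| <= Rv)%R ->
  bounded_mem (run n inn inr p env h) IB (2 ^ cost n be p * V)
    (2 ^+ cost n be p * Rv)%R.
Proof.
have gr1 c V : V <= 2 ^ c * V by rewrite leq_pmull // expn_gt0.
have gr2 c (Rv : R) : (0 <= Rv)%R -> (Rv <= 2 ^+ c * Rv)%R.
  by move=> R0; rewrite ler_peMl // exprn_ege1 // ler1n.
elim: p => [|k i e|k i e|a IHa b IHb|b p IHp q IHq|x b p IHp] sc env be h IB V Rv.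
- by move=> _ _ _ hb V0 _ R0 _; apply: bounded_memS hb; [apply: gr1|apply: gr2].
- case/and3P=> _ oki oke hbe /= hIB hb V0 hin R0 hir.
  have hi := ieval_le hbe oki.
  case: hb => h1 h2 h3; split=> [k' j hj|k' j|k' j] /=.
  + split; last by case: (h1 k' j hj).
    case: ifP => _; last by case: (h1 k' j hj).
    rewrite updE; case: eqP => [ej|_]; last by case: (h1 k' j hj).
    by move: hj; rewrite ej; lia.
  + have old := leq_trans (h2 k' j) (gr1 (ibound n be i + nx_growth n be e + 1) V).
    case: ifP => // _; rewrite updE; case: eqP => // _.
    apply: leq_trans (xeval_le hbe V0 hin h2 oke) _; rewrite leq_mul2r.
    apply/orP; right; apply: leq_trans (ltnW (ltn_expl _ (ltnSn 1))) _.
    by rewrite leq_exp2l //; lia.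
  + by apply: le_trans (h3 k' j) _; apply: gr2.
- case/and3P=> _ oki oke hbe /= hIB hb V0 hin R0 hir.
  have hi := ieval_le hbe oki.
  case: hb => h1 h2 h3; split=> [k' j hj|k' j|k' j] /=.
  + split; first by case: (h1 k' j hj).
    case: ifP => _; last by case: (h1 k' j hj).
    rewrite updE; case: eqP => [ej|_]; last by case: (h1 k' j hj).
    by move: hj; rewrite ej; lia.
  + exact: leq_trans (h2 k' j) (gr1 _ V).
  + have old := le_trans (h3 k' j) (gr2 (ibound n be i + rx_growth e + 1) Rv R0).
    case: ifP => // _; rewrite updE; case: eqP => // _.
    apply: le_trans (yeval_le env R0 hir h3 oke) _; rewrite ler_wpM2r //.
    by apply: ler_natX2; lia.
- case/andP=> oka okb hbe /= hIB hb V0 hin R0 hir.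
  rewrite expnD exprD [2 ^ _ * 2 ^ _]mulnC [(2 ^+ _ * 2 ^+ _)%R]mulrC -mulnA -mulrA.
  apply: (IHb sc) => //; first by lia.
  + apply: (IHa sc) => //; lia.
  + by rewrite muln_gt0 expn_gt0.
  + by move=> a'; apply: leq_trans (gr1 _ V).
  + by apply: mulr_ge0 => //; apply: exprn_ge0.
  + by move=> a'; apply: le_trans (gr2 _ _ R0).
- case/and3P=> okb okp okq hbe /= hIB hb V0 hin R0 hir.
  case: ifP => _.
  + apply: (@bounded_memS _ _ (2 ^ cost n be p * V) _ (2 ^+ cost n be p * Rv)%R).
    * by rewrite leq_mul2r leq_exp2l // -addnA leq_addr orbT.
    * by rewrite ler_wpM2r // ler_weXn2l ?ler1n // -addnA leq_addr.
    * by apply: (IHp sc) => //; lia.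
  + apply: (@bounded_memS _ _ (2 ^ cost n be q * V) _ (2 ^+ cost n be q * Rv)%R).
    * by rewrite leq_mul2r leq_exp2l //; apply/orP; right; lia.
    * by rewrite ler_wpM2r // ler_weXn2l ?ler1n //; lia.
    * by apply: (IHq sc) => //; lia.
- case/and4P=> _ xsc okb okp hbe /= hIB hb V0 hin R0 hir.
  set m := ibound n be b in hIB *; set c := cost n (upd be x m) p in hIB *.
  have hm : ieval n env b <= m by apply: ieval_le hbe okb.
  set C := m * (c + 2) + m + 2 in hIB *.
  apply: (@bounded_memS _ _ (2 ^ (ieval n env b * c) * V) _ (2 ^+ (ieval n env b * c) * Rv)%R).
  + rewrite leq_mul2r leq_exp2l //; apply/orP; right.
    by apply: (@leq_trans (m * c)); rewrite ?leq_mul2r ?hm ?orbT // /C; lia.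
  + rewrite ler_wpM2r // ler_weXn2l ?ler1n //.
    by apply: (@leq_trans (m * c)); rewrite ?leq_mul2r ?hm ?orbT // /C; lia.
  (* The body is charged at the bound [m] of its loop variable, so that all rounds share the
     exponent [c]. *)
  apply: (@iteri_inv _ (fun j h => bounded_mem h IB (2 ^ (j * c) * V) (2 ^+ (j * c) * Rv)%R)).
    by rewrite mul0n expn0 mul1n expr0 mul1r.
  move=> j y hj hy.
  rewrite mulSn expnD exprD -mulnA -mulrA; apply: (IHp (x :: sc)) => //.
  + move=> y'; rewrite inE !updE; case: eqP => [_ _|_ /= /hbe //].
    by apply: ltnW; apply: leq_trans hm.
  + apply: leq_trans hIB; rewrite /C -/c.
    have m0 : 0 < m by apply: leq_trans hm; apply: leq_trans hj.
    by apply: (@leq_trans (1 * c)); first lia; apply: (@leq_trans (m * c)); [rewrite leq_mul2r m0 orbT|lia].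
  + by rewrite muln_gt0 expn_gt0.
  + by move=> a'; apply: leq_trans (gr1 _ V).
  + by apply: mulr_ge0 => //; apply: exprn_ge0.
  + by move=> a'; apply: le_trans (gr2 _ _ R0).
Qed.

Variables (S IB VB : nat) (M RB : R).
Hypothesis hS : n * n + n + 1 + narr.*2 * IB.+1 <= S.
Hypothesis hVB : VB < 2 ^ S.
Hypothesis hIB : IB < 2 ^ S.
Hypothesis hRB : (RB <= 2 ^+ S * M)%R.
Hypothesis inn_le : forall a, inn a <= VB.
Hypothesis inr_le : forall a, (`|inr a| <= RB)%R.

Lemma fits_enc env h : (forall x, env x <= IB) -> bounded_mem h IB VB RB ->
  fits S M (enc n inn inr env h).
Proof.
move=> henv [h1 h2 h3]; split=> a.
- move=> ha; rewrite /enc /=.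
  have lt : (a < n * n + n + 1) = false by apply/negbTE; rewrite -leqNgt; lia.
  rewrite lt; have q : IB < (a - (n * n + n + 1)) %/ narr.*2.
    by rewrite leq_divRL // mulnC; lia.
  have -> : ((a - (n * n + n + 1)) %/ narr.*2 == 0) = false.
    by apply/negbTE; rewrite -lt0n; apply: leq_trans q.
  case: ifP => _; first by [].
  by apply: h1; apply: ltnW.
- rewrite /enc /=; case: ifP => _; first exact: leq_ltn_trans (inn_le a) hVB.
  case: ifP => _; last exact: leq_ltn_trans (h2 _ _) hVB.
  by case: ifP => _; [exact: leq_ltn_trans (henv _) hIB | rewrite expn_gt0].
- rewrite /enc /=; case: ifP => _; first exact: le_trans (inr_le a) hRB.
  case: ifP => _; last exact: le_trans (h3 _ _) hRB.
  by rewrite normr0; apply: le_trans hRB; apply: le_trans (inr_le 0); apply: normr_ge0.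
Qed.

Hypothesis inn0 : inn 0 = n.

Local Notation enc := (enc n inn inr).
Local Notation run := (run n inn inr).

(** Every state on the way encodes a store whose growth is a partial product of the factor in
    [run_bounded]; it is dominated by the final [VB] and [RB], so [fits_enc] applies throughout.
    Variables out of scope are required to be zero so that the reset after a loop restores the
    environment exactly. *)
Lemma exec_compile p : forall sc env be h V Rv,
  all (gtn narr) sc -> prog_ok sc p ->
  (forall x, x \in sc -> env x <= be x) ->
  (forall x, x \notin sc -> env x = 0) -> (forall x, env x <= IB) ->
  cost n be p <= IB -> bounded_mem h IB V Rv ->
  0 < V -> (forall a, inn a <= V) -> (0 <= Rv)%R ->
  (forall a, `|inr a| <= Rv)%R ->
  2 ^ cost n be p * V <= VB -> (2 ^+ cost n be p * Rv <= RB)%R ->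
  exists2 t, t <= cost n be p &
    exec (fits S M) (compile p) (enc env h) t (enc env (run p env h)).
Proof.
have gr1 c V : V <= 2 ^ c * V by rewrite leq_pmull // expn_gt0.
have gr2 c (Rv : R) : (0 <= Rv)%R -> (Rv <= 2 ^+ c * Rv)%R.
  by move=> R0; rewrite ler_peMl // exprn_ege1 // ler1n.
have expm a b V : a <= b -> 2 ^ a * V <= 2 ^ b * V.
  by move=> ab; rewrite leq_mul2r leq_exp2l // ab orbT.
have exprm a b (Rv : R) : (0 <= Rv)%R -> a <= b -> (2 ^+ a * Rv <= 2 ^+ b * Rv)%R.
  by move=> R0 ab; rewrite ler_wpM2r // ler_weXn2l ?ler1n.
elim: p => [|k i e|k i e|a IHa b IHb|b p IHp q IHq|x b p IHp] sc env be h V Rv hsc;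
  move=> ok hbe henv hEB cIB hb V0 hin R0 hir cV cR;
  have hb' := run_bounded ok hbe cIB hb V0 hin R0 hir;
  have f0 : fits S M (enc env h) by
    apply: fits_enc => //; apply: bounded_memS hb;
    [exact: leq_trans (gr1 _ _) cV | exact: le_trans (gr2 _ _ R0) cR].
- by exists 1 => //; apply: ExecSkip.
- have f1 := fits_enc hEB (bounded_memS cV cR hb').
  case/and3P: ok => hk oki oke; exists 1; first by rewrite /= addn1.
  rewrite /= -enc_setn //.
  have ea : neval (enc env h) (cAddr (cix i) k) = addr n k (ieval n env i).
    by rewrite neval_cAddr // (neval_cix inr inn0 env h hsc oki).
  have ee := neval_cnx inr inn0 env h hsc oke.
  rewrite -ea -ee; apply: ExecNWrite => //.
  by rewrite ea ee enc_setn.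
- have f1 := fits_enc hEB (bounded_memS cV cR hb').
  case/and3P: ok => hk oki oke; exists 1; first by rewrite /= addn1.
  rewrite /= -enc_setr //.
  have ea : neval (enc env h) (cAddr (cix i) k) = addr n k (ieval n env i).
    by rewrite neval_cAddr // (neval_cix inr inn0 env h hsc oki).
  have ee := reval_crx inr inn0 env h hsc oke.
  rewrite -ea -ee; apply: ExecRWrite => //.
  by rewrite ea ee enc_setr.
- case/andP: ok => oka okb; rewrite /= in cIB cV cR *.
  have c1 : cost n be a <= IB by lia.
  have c2 : cost n be b <= IB by lia.
  have hba := run_bounded oka hbe c1 hb V0 hin R0 hir.
  have [|| t1 h1 e1] := IHa sc env be h V Rv hsc oka hbe henv hEB c1 hb V0 hin R0 hir.
  + by apply: leq_trans cV; apply: expm; apply: leq_addr.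
  + by apply: le_trans cR; apply: exprm => //; apply: leq_addr.
  have [||||||t2 h2 e2] := IHb sc env be (run a env h) _ _ hsc okb hbe henv hEB c2 hba.
  + by rewrite muln_gt0 expn_gt0.
  + by move=> a'; apply: leq_trans (gr1 _ V).
  + by apply: mulr_ge0 => //; apply: exprn_ge0.
  + by move=> a'; apply: le_trans (gr2 _ _ R0).
  + by rewrite mulnA -expnD addnC.
  + by rewrite mulrA -exprD addnC.
  by exists (t1 + t2); [apply: leq_add | apply: ExecSeq e1 e2].
- case/and3P: ok => okb okp okq; rewrite /= in cIB cV cR *.
  have eb := beval_cbx inr inn0 env h hsc okb.
  case: ifP => bb.
  + have [|||t h1 e1] := IHp sc env be h V Rv hsc okp hbe henv hEB _ hb V0 hin R0 hir.
    * by lia.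
    * by apply: leq_trans cV; apply: expm; lia.
    * by apply: le_trans cR; apply: exprm => //; lia.
    by exists t.+1; [lia | apply: ExecIfTrue => //; rewrite eb].
  + have [|||t h1 e1] := IHq sc env be h V Rv hsc okq hbe henv hEB _ hb V0 hin R0 hir.
    * by lia.
    * by apply: leq_trans cV; apply: expm; lia.
    * by apply: le_trans cR; apply: exprm => //; lia.
    by exists t.+1; [lia | apply: ExecIfFalse => //; rewrite eb bb].
- case/and4P: ok => hx xsc okb okp; rewrite /= in cIB cV cR *.
  set m := ibound n be b in cIB cV cR *.
  set c := cost n (upd be x m) p in cIB cV cR *.
  have hm : ieval n env b <= m by apply: ieval_le hbe okb.
  have mIB : m <= IB by lia.
  set m' := ieval n env b in hm *.
  pose g := fun i => run p (upd env x i).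
  rewrite -/g.
  have hsc' : all (gtn narr) (x :: sc) by rewrite /= hsc andbT.
  have mc j : j <= m' -> j * c <= m * (c + 2) + m + 2.
    move=> hj; apply: (@leq_trans (m * c)); last lia.
    by rewrite leq_mul2r (leq_trans hj hm) orbT.
  have env_j j : (forall y, y \notin x :: sc -> upd env x j y = 0).
    by move=> y; rewrite inE negb_or updE => /andP[/negbTE -> /henv].
  have hbe_j j : j <= m -> forall y, y \in x :: sc -> upd env x j y <= upd be x m y.
    by move=> hj y; rewrite inE !updE; case: eqP => //= _ /hbe.
  have hEB_j j : j <= m -> forall y, upd env x j y <= IB.
    by move=> hj y; rewrite updE; case: eqP => // _; apply: leq_trans mIB.
  have hbj j : j <= m' -> bounded_mem (iteri j g h) IB (2 ^ (j * c) * V) (2 ^+ (j * c) * Rv)%R.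
    elim: j => [|j IHj] hj; first by rewrite mul0n expn0 mul1n expr0 mul1r.
    rewrite mulSn expnD exprD -mulnA -mulrA.
    apply: (@run_bounded _ (x :: sc)) (IHj (ltnW hj)) _ _ _ _ => //.
    + by apply: hbe_j; apply: leq_trans hm; apply: ltnW.
    + rewrite -/c; have m0 : 0 < m by apply: leq_trans hm; apply: leq_trans hj.
      apply: leq_trans cIB; apply: (@leq_trans (1 * c)); first lia.
      by apply: (@leq_trans (m * c)); [rewrite leq_mul2r m0 orbT|lia].
    + by rewrite muln_gt0 expn_gt0.
    + by move=> a'; apply: leq_trans (gr1 _ V).
    + by apply: mulr_ge0 => //; apply: exprn_ge0.
    + by move=> a'; apply: le_trans (gr2 _ _ R0).
  have fj j j' : j <= m' -> j' <= m -> fits S M (enc (upd env x j') (iteri j g h)).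
    move=> hj hj'; apply: fits_enc; first exact: hEB_j.
    apply: bounded_memS (hbj j hj).
    + by apply: leq_trans cV; apply: expm; apply: mc.
    + by apply: le_trans cR; apply: exprm => //; apply: mc.
  (* The machine evaluates the loop bound again in each round, with [x] already changed; as [x] is
     not in the scope of [b], the value stays [m']. *)
  have test j h' : beval (enc (upd env x j) h')
      (NLe (NAdd (NRead (cVar x)) (NConst 1)) (cix b)) = (j < m').
    rewrite -[LHS]/(nats (enc (upd env x j) h') (neval (enc (upd env x j) h') (cVar x)) + 1
       <= neval (enc (upd env x j) h') (cix b)).
    rewrite neval_cVar // nats_vaddr // updE eqxx addn1.
    rewrite (neval_cix inr inn0 (upd env x j) h' hsc okb).
    congr (_ < _); rewrite /m' -/(ieval n env b).
    elim: {cIB cV cR hb' m hm mIB m' mc hbe_j hEB_j hbj fj c} b okb => [y|||a IHa b IHb|a IHa b IHb|a IHa b IHb] //=.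
    + by rewrite updE; case: eqP => // -> ; rewrite (negbTE xsc).
    + by case/andP=> /IHa -> /IHb ->.
    + by case/andP=> /IHa -> /IHb ->.
    + by case/andP=> /IHa -> /IHb ->.
  (* The induction is on the number of rounds left, because the semantics of [While] unfolds the
     first round. *)
  have loop j : j <= m' -> exists2 t, t <= j * (c + 2) + 1 &
      exec (fits S M) (While (NLe (NAdd (NRead (cVar x)) (NConst 1)) (cix b))
             (Seq (compile p)
                  (NWrite (cVar x) (NAdd (NRead (cVar x)) (NConst 1)))))
        (enc (upd env x (m' - j)) (iteri (m' - j) g h)) t
        (enc (upd env x m') (iteri m' g h)).
    elim: j => [|j IHj] hj.
      exists 1; first by lia.
      by rewrite subn0; apply: ExecWhileFalse; [apply: fj | rewrite test ltnn].
    have [t ht et] := IHj (ltnW hj).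
    have lt : m' - j.+1 < m' by lia.
    have e1 : m' - j = (m' - j.+1).+1 by lia.
    have [||||||||t1 ht1 et1] := IHp (x :: sc) (upd env x (m' - j.+1)) (upd be x m)
      (iteri (m' - j.+1) g h) (2 ^ ((m' - j.+1) * c) * V) (2 ^+ ((m' - j.+1) * c) * Rv)%R
      hsc' okp (hbe_j _ (leq_trans (ltnW lt) hm)) (env_j _) (hEB_j _ (leq_trans (ltnW lt) hm)).
    + rewrite -/c; have m0 : 0 < m by apply: leq_trans hm; apply: leq_trans lt.
      apply: leq_trans cIB; apply: (@leq_trans (1 * c)); first lia.
      by apply: (@leq_trans (m * c)); [rewrite leq_mul2r m0 orbT|lia].
    + by apply: hbj; apply: ltnW.
    + by rewrite muln_gt0 expn_gt0.
    + by move=> a'; apply: leq_trans (gr1 _ V).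
    + by apply: mulr_ge0 => //; apply: exprn_ge0.
    + by move=> a'; apply: le_trans (gr2 _ _ R0).
    + rewrite mulnA -expnD -/c -mulSn; apply: leq_trans cV; apply: expm; exact: mc.
    + rewrite mulrA -exprD -/c -mulSn; apply: le_trans cR; apply: exprm => //; exact: mc.
    exists (t1 + 1 + t).+1; first by rewrite -/c in ht1; rewrite mulSn; lia.
    apply: ExecWhileTrue et; first by rewrite test.
    apply: ExecSeq et1 _.
    rewrite e1 /=; set h1 := run p _ _.
    have -> : enc (upd env x (m' - j.+1).+1) h1 =
      State (upd (nats (enc (upd env x (m' - j.+1)) h1))
             (neval (enc (upd env x (m' - j.+1)) h1) (cVar x))
             (neval (enc (upd env x (m' - j.+1)) h1) (NAdd (NRead (cVar x)) (NConst 1))))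
            (reals (enc (upd env x (m' - j.+1)) h1)).
      have -> : neval (enc (upd env x (m' - j.+1)) h1) (NAdd (NRead (cVar x)) (NConst 1)) = (m' - j.+1).+1.
        rewrite -[LHS]/(nats (enc (upd env x (m' - j.+1)) h1) (neval (enc (upd env x (m' - j.+1)) h1) (cVar x)) + 1).
        by rewrite neval_cVar // nats_vaddr // updE eqxx addn1.
      by rewrite neval_cVar // enc_setv // upd_upd.
    have f1 : fits S M (enc (upd env x (m' - j.+1)) h1).
      by have := fj (m' - j.+1).+1 (m' - j.+1) lt (leq_trans (ltnW lt) hm).
    apply: ExecNWrite => //.
    rewrite neval_cVar //.
    have -> : neval (enc (upd env x (m' - j.+1)) h1) (NAdd (NRead (cVar x)) (NConst 1)) = (m' - j.+1).+1.
      rewrite -[LHS]/(nats (enc (upd env x (m' - j.+1)) h1) (neval (enc (upd env x (m' - j.+1)) h1) (cVar x)) + 1).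
      by rewrite neval_cVar // nats_vaddr // updE eqxx addn1.
    rewrite enc_setv // upd_upd.
    by have := fj (m' - j.+1).+1 (m' - j.+1).+1 lt (leq_trans lt hm).
  have [t ht et] := loop m' (leqnn m').
  exists (t + 1).
    apply: (@leq_trans (m' * (c + 2) + 2)); first lia.
    have : m' * (c + 2) <= m * (c + 2) by rewrite leq_mul2r hm orbT.
    by lia.
  move: et; rewrite subnn /=.
  have -> : upd env x 0 = env.
    by apply: funext => y; rewrite updE; case: eqP => // ->; rewrite henv.
  move=> et; apply: ExecSeq et _.
  set h1 := iteri m' g h.
  have e2 : enc env h1 = State (upd (nats (enc (upd env x m') h1))
      (neval (enc (upd env x m') h1) (cVar x)) (neval (enc (upd env x m') h1) (NConst 0)))
      (reals (enc (upd env x m') h1)).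
    rewrite neval_cVar // -[neval _ (NConst 0)]/0 enc_setv // upd_upd; congr enc.
    by apply: funext => y; rewrite updE; case: eqP => // ->; rewrite henv.
  rewrite [X in exec _ _ _ _ X]e2; apply: ExecNWrite; first exact: fj.
  rewrite -e2; have := @fits_enc env h1 hEB; apply.
  apply: bounded_memS (hbj m' (leqnn m')).
  + by apply: leq_trans cV; apply: expm; apply: mc.
  + by apply: le_trans cR; apply: exprm => //; apply: mc.
Qed.

End Bounds.

(** * Repeating a program over the values of a counter *)

(** The base [n + 2] is positive even at [n = 0], so exponents can be raised when bounds are added,
    and it is at most the input size. *)
Definition poly_bounded (f : nat -> nat) : Prop :=
  exists c k, forall n, f n <= c * (n + 2) ^ k.

Lemma poly_const a : poly_bounded (fun _ => a).
Proof. by exists a, 0 => n; rewrite expn0 muln1. Qed.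

Lemma poly_id : poly_bounded id.
Proof. by exists 1, 1 => n; rewrite expn1 mul1n leq_addr. Qed.

Lemma poly_add f g : poly_bounded f -> poly_bounded g ->
  poly_bounded (fun n => f n + g n).
Proof.
move=> [c [k hf]] [d [l hg]]; exists (c + d), (k + l) => n.
rewrite mulnDl; apply: leq_add.
- apply: leq_trans (hf n) _; rewrite leq_mul2l expnD leq_pmulr ?orbT //.
  by rewrite expn_gt0 addn2.
- apply: leq_trans (hg n) _; rewrite leq_mul2l expnD leq_pmull ?orbT //.
  by rewrite expn_gt0 addn2.
Qed.

Lemma poly_mul f g : poly_bounded f -> poly_bounded g ->
  poly_bounded (fun n => f n * g n).
Proof.
move=> [c [k hf]] [d [l hg]]; exists (c * d), (k + l) => n.
by rewrite expnD mulnACA; apply: leq_mul.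
Qed.

Lemma poly_le f g : (forall n, f n <= g n) -> poly_bounded g -> poly_bounded f.
Proof. by move=> fg [c [k h]]; exists c, k => n; apply: leq_trans (fg n) (h n). Qed.

Lemma poly_ibound sc be e : (forall x, x \in sc -> poly_bounded (be^~ x)) ->
  ix_ok sc e -> poly_bounded (fun n => ibound n (be n) e).
Proof.
move=> hbe; elim: e => [x|k||a IHa b IHb|a IHa b IHb|a IHa b IHb] /=.
- exact: hbe.
- by move=> _; apply: poly_const.
- by move=> _; apply: poly_id.
- by case/andP=> /IHa ? /IHb ?; apply: poly_add.
- by case/andP=> /IHa.
- by case/andP=> /IHa ? /IHb ?; apply: poly_mul.
Qed.

Lemma poly_nx_growth sc be e : (forall x, x \in sc -> poly_bounded (be^~ x)) ->
  nx_ok sc e -> poly_bounded (fun n => nx_growth n (be n) e).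
Proof.
move=> hbe; elim: e => [i|a IHa|a IHa b IHb|k a IHa|a IHa b IHb|a IHa b IHb|i a IHa] /=.
- exact: poly_ibound.
- by move=> _; apply: poly_const.
- by move=> _; apply: poly_const.
- by move=> _; apply: poly_const.
- by case/andP=> /IHa ? /IHb ?; apply: poly_add.
- by case/andP=> /IHa.
- by case/andP=> hi /IHa ?; apply: poly_mul => //; apply: poly_ibound hi.
Qed.

(** The nesting of loops is fixed by the program, and the bound of a loop is a polynomial in [n] and
    in the bounds of the enclosing loop variables, hence in [n] alone. *)
Lemma poly_cost p : forall sc be,
  (forall x, x \in sc -> poly_bounded (be^~ x)) ->
  prog_ok sc p -> poly_bounded (fun n => cost n (be n) p).
Proof.
elim: p => [|k i e|k i e|a IHa b IHb|b p IHp q IHq|x b p IHp] sc be hbe.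
- by move=> _; apply: poly_const.
- case/and3P=> _ oki oke; do 2?apply: poly_add; last exact: poly_const.
  + exact: poly_ibound oki.
  + exact: poly_nx_growth oke.
- case/and3P=> _ oki oke; do 2?apply: poly_add; try exact: poly_const.
  exact: poly_ibound oki.
- by case/andP=> /(IHa _ _ hbe) ? /(IHb _ _ hbe) ?; apply: poly_add.
- case/and3P=> _ /(IHp _ _ hbe) ? /(IHq _ _ hbe) ?.
  by do 2?apply: poly_add => //; apply: poly_const.
- case/and4P=> _ xsc okb okp; have hb := poly_ibound hbe okb.
  apply: poly_add; last exact: poly_const.
  apply: poly_add => //; apply: poly_mul => //; apply: poly_add; last exact: poly_const.
  apply: (IHp (x :: sc) (fun n => upd (be n) x (ibound n (be n) b)) _ okp) => y.
  rewrite inE; case: eqP => [-> _|ne /= hy].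
  + by apply: poly_le hb => n; rewrite updE eqxx.
  + by apply: poly_le (hbe y hy) => n; rewrite updE; case: eqP.
Qed.

Fixpoint ixpow (e : ix) (k : nat) : ix :=
  if k is k'.+1 then IMul e (ixpow e k') else IC 1.

Lemma ieval_ixpow n env e k : ieval n env (ixpow e k) = ieval n env e ^ k.
Proof. by elim: k => //= k ->; rewrite expnS. Qed.

Lemma ix_ok_ixpow sc e k : ix_ok sc e -> ix_ok sc (ixpow e k).
Proof. by move=> h; elim: k => //= k ->; rewrite h. Qed.

(* Arrays are numbered, and a scalar is an array read and written at 0 only. *)
Definition aC := 0.
Definition aGO := 1.
Definition aFND := 2.
Definition aOUT := 3.

(** The natural array 0, which is [aC], is left out: its cell 0 is the counter, the only datum
    handed from one leaf to the next. The rest of [aC] is cleared by the second loop of [clear]. *)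
Definition clear_row : prog :=
  foldr PSeq PSkip ([seq PN k (IV 0) (XI (IC 0)) | k <- iota 1 narr.-1]
                    ++ [seq PR k (IV 0) YZ | k <- iota 0 narr]).

Definition clear (m : ix) : prog :=
  PSeq (PFor 0 m clear_row) (PFor 0 m (PN aC (IAdd (IV 0) (IC 1)) (XI (IC 0)))).

Lemma clear_ok m : ix_ok [::] m -> prog_ok [::] (clear m).
Proof. by move=> h; rewrite /= h. Qed.

Section Clear.
Variables (R : realType) (n : nat) (inn : nat -> nat) (inr : nat -> R).
Local Notation run := (run n inn inr).

Definition zero_store : store R := Store (fun _ _ => 0) (fun _ _ => 0%R).
Definition counter_store (c : nat) : store R := setn zero_store aC 0 c.

Lemma run_PSeq a b env h : run (PSeq a b) env h = run b env (run a env h).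
Proof. by []. Qed.

Lemma run_PFor x b p env h : run (PFor x b p) env h =
  iteri (ieval n env b) (fun i => run p (upd env x i)) h.
Proof. by []. Qed.

(** A store has infinitely many arrays; those out of reach of programs must be known to stay zero
    for [run_clear] to give an equality of stores. *)
Lemma run_high p : forall sc env h, prog_ok sc p -> forall k, narr <= k ->
  na (run p env h) k = na h k /\ ra (run p env h) k = ra h k.
Proof.
elim: p => [|k i e|k i e|a IHa b IHb|b p IHp q IHq|x b p IHp] sc env h //.
- case/and3P=> hk _ _ k' hk' /=; case: eqP => // ek.
  by move: hk'; rewrite ek leqNgt hk.
- case/and3P=> hk _ _ k' hk' /=; case: eqP => // ek.
  by move: hk'; rewrite ek leqNgt hk.
- case/andP=> oka okb k' hk'; rewrite run_PSeq.
  have [-> ->] := IHb sc env (run a env h) okb k' hk'.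
  exact: (IHa sc env h oka k' hk').
- case/and3P=> _ okp okq k' hk' /=; case: ifP => _.
  + exact: (IHp sc).
  + exact: (IHq sc).
- case/and4P=> _ _ _ okp k' hk'; rewrite run_PFor.
  apply: (@iteri_inv _ (fun _ g => na g k' = na h k' /\ ra g k' = ra h k')) => //.
  move=> j y _ [<- <-]; exact: (IHp (x :: sc)).
Qed.

Lemma run_foldr_PN (ks : seq nat) env (h : store R) (i := env 0) :
  let h' := run (foldr PSeq PSkip [seq PN k (IV 0) (XI (IC 0)) | k <- ks]) env h in
  (ra h' = ra h) /\
  forall k j, na h' k j = if (k \in ks) && (j == i) then 0 else na h k j.
Proof.
elim: ks h => [|k0 ks IH] h //=.
have [-> hn] := IH (setn h k0 i 0); split=> // k j; rewrite hn /= inE.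
by case: (k == k0); rewrite /= ?updE; case: (j == i); rewrite ?andbF ?andbT ?if_same.
Qed.

Lemma run_foldr_PR (ks : seq nat) env (h : store R) (i := env 0) :
  let h' := run (foldr PSeq PSkip [seq PR k (IV 0) YZ | k <- ks]) env h in
  (na h' = na h) /\
  forall k j, ra h' k j = if (k \in ks) && (j == i) then 0%R else ra h k j.
Proof.
elim: ks h => [|k0 ks IH] h //=.
have [-> hn] := IH (setr h k0 i 0%R); split=> // k j; rewrite hn /= inE.
by case: (k == k0); rewrite /= ?updE; case: (j == i); rewrite ?andbF ?andbT ?if_same.
Qed.

Lemma foldr_PSeq_cat (s t : seq prog) env h :
  run (foldr PSeq PSkip (s ++ t)) env h =
  run (foldr PSeq PSkip t) env (run (foldr PSeq PSkip s) env h).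
Proof. by elim: s h => [|p s IH] h //=. Qed.

(** An equality, not a bound: after clearing, the store depends on the counter alone, which makes
    the result of an iteration a function of it. *)
Lemma run_clear m env (h : store R) :
  (forall k, narr <= k -> na h k = (fun _ => 0) /\ ra h k = (fun _ => 0%R)) ->
  (forall k i, ieval n env m <= i -> na h k i = 0 /\ ra h k i = 0%R) ->
  run (clear m) env h = counter_store (na h aC 0).
Proof.
move=> hhigh hsup; rewrite /clear run_PSeq !run_PFor.
set h1 := iteri _ _ h; set M := ieval n env m in hsup h1 *.
have [H1 H2] : (forall k j, na h1 k j = if (0 < k < narr) && (j < M) then 0 else na h k j)
   /\ (forall k j, ra h1 k j = if (k < narr) && (j < M) then 0%R else ra h k j).
  apply: (@iteri_inv _ (fun t g =>
    (forall k j, na g k j = if (0 < k < narr) && (j < t) then 0 else na h k j)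
   /\ (forall k j, ra g k j = if (k < narr) && (j < t) then 0%R else ra h k j))).
    by split=> k j; rewrite ltn0 andbF.
  move=> t g _ [g1 g2]; rewrite /clear_row foldr_PSeq_cat.
  set ga := run _ _ g.
  have [a1 a2] := run_foldr_PN (iota 1 narr.-1) (upd env 0 t) g.
  have [b1 b2] := run_foldr_PR (iota 0 narr) (upd env 0 t) ga.
  rewrite -/ga in a1 a2; split=> k j.
  - rewrite b1 a2 g1 mem_iota -/narr updE eqxx [j < t.+1]ltnS [j <= t]leq_eqVlt.
    have -> : 1 + narr.-1 = narr by []. case: (0 < k < narr) => //=.
    by case: (j == t).
  - rewrite b2 a1 g2 mem_iota add0n leq0n updE eqxx [j < t.+1]ltnS [j <= t]leq_eqVlt.
    by case: (k < narr) => //=; case: (j == t).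
have [K1 K2] : (forall k j, na (iteri M (fun i => run (PN aC (IAdd (IV 0) (IC 1)) (XI (IC 0))) (upd env 0 i)) h1) k j
     = if [&& k == aC, 0 < j & j < M.+1] then 0 else na h1 k j) /\
    ra (iteri M (fun i => run (PN aC (IAdd (IV 0) (IC 1)) (XI (IC 0))) (upd env 0 i)) h1) = ra h1.
  apply: (@iteri_inv _ (fun t g => (forall k j, na g k j
     = if [&& k == aC, 0 < j & j < t.+1] then 0 else na h1 k j) /\ ra g = ra h1)).
    by split=> // k [|j] //; rewrite !ltnS ltn0 !andbF.
  move=> t g _ [g1 g2]; split=> // k j /=; rewrite [upd env 0 t 0]updE eqxx addn1.
  case: (k =P aC) => [-> | ne]; last by rewrite g1; case: eqP ne.
  rewrite updE g1 eqxx /=; case: j => [|j] //=.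
  rewrite eqSS !ltnS [in RHS]leq_eqVlt; by case: (j == t).
set h2 := iteri M _ h1 in K1 K2 *.
have e1 : na h2 = na (counter_store (na h aC 0)).
  apply: funext => k; apply: funext => j; rewrite K1 H1 /=.
  have [hk|hk] := ltnP k narr; last first.
    have -> : (k == aC) = false by apply/eqP => e; rewrite e in hk.
    by rewrite /= andbF /=; case: (hhigh k hk) => -> _.
  case: (k =P aC) => [->|ne] /=.
    rewrite updE; case: j => [|j] //=; case: ltnP => // hj.
    by case: (hsup aC j.+1 (ltnW hj)).
  have -> : 0 < k by rewrite lt0n; apply/eqP.
  by rewrite /=; case: ltnP => // hj; case: (hsup k j hj).
have e2 : ra h2 = ra (counter_store (na h aC 0)).
  apply: funext => k; apply: funext => j; rewrite K2 H2 /=.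
  have [hk|hk] := ltnP k narr; last by case: (hhigh k hk) => _ ->.
  by case: ltnP => // hj; case: (hsup k j hj).
by move: e1 e2; case: h2 {K1 K2} => a b /= -> ->.
Qed.

End Clear.

(** * Size and magnitude of the input *)

Definition inn_of (R : realType) (I : instance R) : nat -> nat := nth 0 (nat_input I).
Definition inr_of (R : realType) (I : instance R) : nat -> R := nth 0%R (real_input I).

Section Inputs.
Variables (R : realType) (I : instance R).
Hypothesis valid : valid_instance I.
Local Notation n := (Defs.order I).
Local Notation inn := (inn_of I).
Local Notation inr := (inr_of I).

Lemma size_nat_input : size (nat_input I) = n * n + n + 1.
Proof.
by rewrite /= size_cat size_map size_allpairs size_enum_ord; lia.
Qed.

Lemma size_real_input : size (real_input I) = n.+1.
Proof. by rewrite /= size_map size_enum_ord. Qed.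

Lemma inn_le a : inn a <= n.+1.
Proof.
have [ha|ha] := ltnP a (size (nat_input I)); last by rewrite /inn_of nth_default.
have := mem_nth 0 ha; rewrite -/(inn a) inE => /orP[/eqP ->|]; first exact: leqnSn.
rewrite mem_cat => /orP[/mapP[v _ ->]|/allpairsP[uv [_ _ ->]]].
- by apply: leq_trans (leq_b1 _) _.
- by apply: leq_trans (leq_b1 _) _.
Qed.

Lemma weight_ge0 v : (0 <= weight I v)%R.
Proof. by case: valid => _ h _ _; apply: le_trans (h v). Qed.

Lemma inr_le a : (`|inr a| <= input_magnitude I)%R.
Proof.
have [_ hw hb _] := valid.
have s0 : (0 <= \sum_v weight I v)%R by apply: sumr_ge0 => v _; apply: weight_ge0.
have b0 : (0 <= budget I)%R by apply: le_trans hb.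
have [ha|ha] := ltnP a (size (real_input I)); last first.
  by rewrite /inr_of nth_default // normr0; apply: addr_ge0.
have := mem_nth 0%R ha; rewrite -/(inr a) inE => /orP[/eqP ->|/mapP[v _ ->]].
- by rewrite ger0_norm // lerDl.
- rewrite ger0_norm ?weight_ge0 // /input_magnitude (bigD1 v) //=.
  rewrite addrCA lerDl; apply: addr_ge0 => //.
  by apply: sumr_ge0 => u _; apply: weight_ge0.
Qed.

Lemma magnitude_ge1 : (1 <= input_magnitude I)%R.
Proof.
have [_ hw hb _] := valid; apply: le_trans hb _; rewrite lerDl.
by apply: sumr_ge0 => v _; apply: weight_ge0.
Qed.

Lemma enc_initial : enc n inn inr env0 (zero_store R) = initial_state I.
Proof.
rewrite /enc /initial_state; congr State; apply: funext => a.
- case: ltnP => // ha; rewrite nth_default ?size_nat_input //.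
  by case: ifP => // _; case: ifP.
- case: ltnP => // ha; rewrite nth_default ?size_real_input //; last lia.
  by case: ifP.
Qed.

End Inputs.

(** * The main loop *)

Section MainLoop.
Variables (body : prog) (mx : ix).

Definition cGO : bexp := NLe (NConst 1) (NRead (cAddr (NConst 0) aGO)).
Definition iteration : prog := PSeq (clear mx) body.

Definition copy_loop : cmd :=
  While (NLe (NAdd (NRead (cVar 0)) (NConst 1)) cN)
    (Seq (NWrite (NAdd (NRead (cVar 0)) (NConst 1)) (NRead (cAddr (NRead (cVar 0)) aOUT)))
         (NWrite (cVar 0) (NAdd (NRead (cVar 0)) (NConst 1)))).
(* The flag overwrites the number of vertices, so it is written last. *)
Definition copy_out : cmd :=
  Seq copy_loop (NWrite (NConst 0) (NRead (cAddr (NConst 0) aFND))).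

Definition main_cmd : cmd :=
  Seq (compile (PN aGO (IC 0) (XI (IC 1))))
    (Seq (While cGO (compile iteration)) copy_out).

End MainLoop.

(** * Writing the answer over the input *)

Section CopyOut.
Variables (R : realType) (n : nat) (inn : nat -> nat) (inr : nat -> R) (h : store R).
Hypothesis inn0 : inn 0 = n.
Variable ok : state R -> Prop.
Variable VB : nat.
Hypothesis inn_le : forall a, inn a <= VB.
Hypothesis h_le : forall k i, na h k i <= VB.
Hypothesis ok_enc : forall inn' env, (forall a, inn' a <= VB) ->
  (forall x, env x <= n) -> ok (enc n inn' inr env h).

(** The input after [j] cells of the answer have replaced it. Cell 0 still holds [n], on which all
    addresses depend, so the state remains an encoding of the same store. *)
Let innj j a := if 0 < a <= j then na h aOUT a.-1 else inn a.

Lemma enc_inn inn' env a v : a <= n * n + n ->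
  State (upd (nats (enc n inn' inr env h)) a v) (reals (enc n inn' inr env h))
  = enc n (upd inn' a v) inr env h.
Proof.
move=> ha; rewrite /enc /=; congr State; apply: funext => b; rewrite !updE.
by case: eqP => // ->; rewrite addn1 ltnS ha.
Qed.

Lemma copy_loopP j : j <= n ->
  exec ok copy_loop (enc n (innj (n - j)) inr (upd env0 0 (n - j)) h) (3 * j + 1)
    (enc n (innj n) inr (upd env0 0 n) h).
Proof.
have inj_le j' a : innj j' a <= VB by rewrite /innj; case: ifP.
have inj0 j' : innj j' 0 = n by rewrite /innj.
have env_le j' x : j' <= n -> upd env0 0 j' x <= n by rewrite updE; case: eqP.
have test i : beval (enc n (innj i) inr (upd env0 0 i) h)
    (NLe (NAdd (NRead (cVar 0)) (NConst 1)) cN) = (i < n).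
  rewrite -[LHS]/(nats (enc n (innj i) inr (upd env0 0 i) h)
    (neval (enc n (innj i) inr (upd env0 0 i) h) (cVar 0)) + 1 <=
     neval (enc n (innj i) inr (upd env0 0 i) h) cN).
  by rewrite neval_cVar // nats_vaddr // neval_cN // addn1.
elim: j => [|j IH] hj.
  rewrite subn0; apply: ExecWhileFalse; last by rewrite test ltnn.
  by apply: ok_enc => // x; apply: env_le.
set i := n - j.+1; have e1 : n - j = i.+1 by rewrite /i; lia.
have hi : i < n by rewrite /i; lia.
have -> : 3 * j.+1 + 1 = (1 + 1 + (3 * j + 1)).+1 by lia.
apply: ExecWhileTrue (IH (ltnW hj)); first by rewrite test.
have inS : upd (innj i) i.+1 (na h aOUT i) = innj i.+1.
  apply: funext => a; rewrite updE /innj; case: eqP => [->|ne].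
    by rewrite ltnSn.
  by rewrite [a <= i.+1]leq_eqVlt ltnS; case: eqP ne.
have nn : n <= n * n + n by rewrite leq_addl.
rewrite e1; apply: (@ExecSeq _ _ _ _ _ _ (enc n (innj i.+1) inr (upd env0 0 i) h)).
- have -> : enc n (innj i.+1) inr (upd env0 0 i) h =
    State (upd (nats (enc n (innj i) inr (upd env0 0 i) h))
      (neval (enc n (innj i) inr (upd env0 0 i) h) (NAdd (NRead (cVar 0)) (NConst 1)))
      (neval (enc n (innj i) inr (upd env0 0 i) h) (NRead (cAddr (NRead (cVar 0)) aOUT))))
     (reals (enc n (innj i) inr (upd env0 0 i) h)).
    set s := enc n (innj i) inr (upd env0 0 i) h.
    have ev : neval s (NRead (cVar 0)) = i.
      by rewrite -[LHS]/(nats s (neval s (cVar 0))) neval_cVar // nats_vaddr.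
    have -> : neval s (NAdd (NRead (cVar 0)) (NConst 1)) = i.+1.
      by rewrite -[LHS]/(neval s (NRead (cVar 0)) + 1) ev addn1.
    have -> : neval s (NRead (cAddr (NRead (cVar 0)) aOUT)) = na h aOUT i.
      rewrite -[LHS]/(nats s (neval s (cAddr (NRead (cVar 0)) aOUT))).
      by rewrite neval_cAddr // ev nats_addr.
    by rewrite enc_inn ?inS // (leq_trans hi).
  set s := enc n (innj i) inr (upd env0 0 i) h.
  apply: ExecNWrite; first by apply: ok_enc => // x; apply: env_le; apply: ltnW.
  have ev : neval s (NRead (cVar 0)) = i.
    by rewrite -[LHS]/(nats s (neval s (cVar 0))) neval_cVar // nats_vaddr.
  have -> : neval s (NAdd (NRead (cVar 0)) (NConst 1)) = i.+1.
    by rewrite -[LHS]/(neval s (NRead (cVar 0)) + 1) ev addn1.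
  have -> : neval s (NRead (cAddr (NRead (cVar 0)) aOUT)) = na h aOUT i.
    rewrite -[LHS]/(nats s (neval s (cAddr (NRead (cVar 0)) aOUT))).
    by rewrite neval_cAddr // ev nats_addr.
  rewrite enc_inn ?inS // ?(leq_trans hi) //.
  by apply: ok_enc => // x; apply: env_le; apply: ltnW.
- set s := enc n (innj i.+1) inr (upd env0 0 i) h.
  have ev : neval s (NAdd (NRead (cVar 0)) (NConst 1)) = i.+1.
    rewrite -[LHS]/(nats s (neval s (cVar 0)) + 1).
    by rewrite neval_cVar // nats_vaddr // addn1.
  have -> : enc n (innj i.+1) inr (upd env0 0 i.+1) h =
    State (upd (nats s) (neval s (cVar 0)) (neval s (NAdd (NRead (cVar 0)) (NConst 1))))
      (reals s).
    by rewrite ev neval_cVar // enc_setv // upd_upd.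
  apply: ExecNWrite; first by apply: ok_enc => // x; apply: env_le; apply: ltnW.
  rewrite ev neval_cVar // enc_setv // upd_upd.
  by apply: ok_enc => // x; apply: env_le.
Qed.

Lemma copy_outP : exists2 inn', exec ok copy_out (enc n inn inr env0 h) (3 * n + 2)
    (enc n inn' inr (upd env0 0 n) h) &
  inn' 0 = na h aFND 0 /\ forall v, v < n -> inn' v.+1 = na h aOUT v.
Proof.
exists (upd (innj n) 0 (na h aFND 0)); last first.
  by split=> [//|v hv]; rewrite updE /innj /= hv.
have := copy_loopP (leqnn n); rewrite subnn.
have -> : innj 0 = inn by apply: funext => a; rewrite /innj; case: a.
have -> : upd env0 0 0 = env0 by apply: funext => x; rewrite updE; case: eqP.
have -> : 3 * n + 2 = 3 * n + 1 + 1 by lia.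
move=> e; apply: ExecSeq e _; set s := enc n (innj n) inr _ h.
have inj_le a : innj n a <= VB by rewrite /innj; case: ifP.
have env_le x : upd env0 0 n x <= n by rewrite updE; case: eqP.
have inj0 : innj n 0 = n by rewrite /innj.
have ev : neval s (NRead (cAddr (NConst 0) aFND)) = na h aFND 0.
  rewrite -[LHS]/(nats s (neval s (cAddr (NConst 0) aFND))).
  by rewrite neval_cAddr // nats_addr.
rewrite -enc_inn // -[X in State X]/(upd (nats s) (neval s (NConst 0)) (na h aFND 0)) -ev.
apply: ExecNWrite; first exact: ok_enc.
rewrite ev enc_inn //; apply: ok_enc => // a.
by rewrite updE; case: eqP.
Qed.

End CopyOut.

Lemma cost_gt0 n be p : 0 < cost n be p.
Proof.
elim: p be => [|k i e|k i e|a IHa b IHb|b p IHp q IHq|x b p IHp] be //=.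
- by rewrite addn1.
- by rewrite addn1.
- by rewrite addn_gt0 IHa.
- by rewrite addn1.
- by rewrite addn2.
Qed.

(** * From one leaf to the whole search *)

Section Assembly.
Variables (R : realType) (body : prog).
Hypothesis body_ok : prog_ok [::] body.

Definition body_result (I : instance R) (c : nat) : store R :=
  run (Defs.order I) (inn_of I) (inr_of I) body env0 (counter_store R c).

Definition candidate (I : instance R) (c : nat) : {set 'I_(Defs.order I)} :=
  [set v : 'I_(Defs.order I) | na (body_result I c) aOUT v != 0].

Definition found (I : instance R) (c : nat) : bool :=
  na (body_result I c) aFND 0 != 0.

(** The contract of a leaf program with [N] leaves. The bound [2 ^ order] keeps the counter within
    polynomially many bits; soundness is asked of every leaf, success of only one. *)
Definition searches (I : instance R) (N : nat) : Prop :=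
  [/\ 0 < N <= 2 ^ Defs.order I,
      forall c, c < N -> na (body_result I c) aC 0 = c.+1 /\
        na (body_result I c) aGO 0 = ~~ found I c && (c.+1 < N),
      forall c, c < N -> found I c ->
        vertex_cover (edge I) (candidate I c) /\
        (total_weight (candidate I c) <= budget I)%R &
      (exists2 C : {set 'I_(Defs.order I)},
        vertex_cover (edge I) C & (total_weight C <= budget I)%R) ->
        exists2 c, c < N & found I c].

(** The program is chosen before [D] and [b], so that the same one can meet two time bounds. Each
    iteration starts from a store bounded as the result of some body, hence all of them obey one
    space bound. *)
Lemma assembly : exists p : cmd, forall (D : instance R -> Prop) (b : R),
  (1 <= b)%R ->
  (forall I, valid_instance I -> D I -> exists2 N, searches I N &
     (N%:R <= b ^+ #|mincover I|)%R) ->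
  solves_WVCstar p D b.
Proof.
have [c1 [k1 hcb]] : poly_bounded (fun n => cost n env0 body).
  by apply: (@poly_cost _ [::] (fun _ => env0)).
(* The range to be cleared must be an expression of the language, so the polynomial bound on the
   cost of the body, which also bounds the indices it writes, is spelled out as one. *)
pose mx := IMul (IC c1) (ixpow (IAdd IN (IC 2)) k1).
have mx_ok : ix_ok [::] mx by rewrite /= ix_ok_ixpow.
have it_ok : prog_ok [::] (iteration body mx).
  by rewrite -[prog_ok _ _]/(prog_ok [::] (clear mx) && prog_ok [::] body) clear_ok.
exists (main_cmd body mx) => D b b1 hD.
pose ci n := cost n env0 (iteration body mx).
pose cm n := c1 * (n + 2) ^ k1.
have pci : poly_bounded ci by apply: (@poly_cost _ [::] (fun _ => env0)).
have pcm : poly_bounded cm by exists c1, k1.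
have ciE m : ci m = cost m env0 (iteration body mx) by [].
have cmE m : cm m = c1 * (m + 2) ^ k1 by [].
clearbody ci cm.
(* All demands in one polynomial: the cells of the input and of the table, the bits of the numbers,
   and the steps per leaf together with the final copying. *)
pose f n := n * n + n + 1 + narr.*2 * (ci n + cm n + n + 2 + 1) + ci n + cm n + 4 * n + 10.
have [c [k hf]] : poly_bounded f.
  by rewrite /f; clear -pci pcm; repeat (first [exact: pci | exact: pcm | exact: poly_id
    | exact: poly_const | apply: poly_add | apply: poly_mul]).
exists c, k => I valid DI.
set n := Defs.order I; set S := (c * input_size I ^ k)%N => /=.
have hS : f n <= S.
  apply: leq_trans (hf n) _; rewrite leq_mul2l; apply/orP; right.
  case: (k) => [|k']; first by rewrite !expn0.
  by rewrite leq_exp2r // /input_size size_nat_input size_real_input -/n; lia.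
have [N [/andP[N0 N2] hres hfound hcomp] Nb] := hD I valid DI.
set M := input_magnitude I.
have M1 : (1 <= M)%R by apply: magnitude_ge1.
have M0 : (0 <= M)%R by apply: le_trans M1.
(* Covers the counter, at most [2 ^ n], and the input cells, at most [n.+1]. *)
pose V1 := 2 ^ n + n.+2.
have V10 : 0 < V1 by rewrite addn_gt0 orbT.
(* [Vh] and [Rh] bound what a body leaves when started from a cleared store; [VB] and [RB] allow for
   one more iteration from there. *)
pose Vh := 2 ^ cm n * V1; pose Rh := (2 ^+ cm n * M)%R.
pose IB := ci n + cm n + n + 2.
pose VB := 2 ^ (ci n + 2) * Vh; pose RB := (2 ^+ (ci n + 2) * Rh)%R.
have inn0 : inn_of I 0 = n by [].
have inV1 a : inn_of I a <= V1.
  exact: leq_trans (leq_trans (inn_le I a) (leqnSn _)) (leq_addl _ _).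
have gr1 e V : V <= 2 ^ e * V by rewrite leq_pmull // expn_gt0.
have gr2 e (Rv : R) : (0 <= Rv)%R -> (Rv <= 2 ^+ e * Rv)%R.
  by move=> R0; rewrite ler_peMl // exprn_ege1 // ler1n.
have Rh0 : (0 <= Rh)%R by apply: mulr_ge0 => //; apply: exprn_ge0.
have inVh a : inn_of I a <= Vh by apply: leq_trans (gr1 _ _).
have inVB a : inn_of I a <= VB by apply: leq_trans (gr1 _ _).
have irM a : (`|inr_of I a| <= M)%R by apply: inr_le.
have irRh a : (`|inr_of I a| <= Rh)%R by apply: le_trans (gr2 _ _ M0).
have irRB a : (`|inr_of I a| <= RB)%R by apply: le_trans (gr2 _ _ Rh0).
have V1le : V1 <= 2 ^ (n + 2).
  rewrite /V1 expnD (_ : 2 ^ 2 = 4) //; have := ltn_expl n (ltnSn 1); clear; lia.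
have key : n * n + n + 1 + narr.*2 * (ci n + cm n + n + 2 + 1) + (ci n + cm n + 4 * n + 10) <= S.
  have E A x y z : A + (x + y + z + 10) = A + x + y + z + 10 by clear; lia.
  by rewrite E.
have hS' : n * n + n + 1 + narr.*2 * IB.+1 <= S.
  by rewrite -[IB.+1]addn1; apply: leq_trans key; apply: leq_addr.
have {}key : ci n + cm n + 4 * n + 10 <= S by apply: leq_trans key; apply: leq_addl.
have hVB : VB < 2 ^ S.
  apply: (@leq_trans (2 ^ (ci n + 2) * (2 ^ cm n * 2 ^ (n + 2))).+1).
    by rewrite ltnS /VB /Vh !leq_mul2l V1le !orbT.
  rewrite -!expnD ltn_exp2l //.
  by move: key; move: (ci n) (cm n) => a1 a2; clear; lia.
have hIB : IB < 2 ^ S.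
  apply: leq_trans (ltn_expl S (ltnSn 1)); rewrite ltnS.
  by move: key; rewrite /IB; move: (ci n) (cm n) => a1 a2; clear; lia.
have hRB : (RB <= 2 ^+ S * M)%R.
  rewrite /RB /Rh mulrA -exprD ler_wpM2r // ler_weXn2l ?ler1n //.
  by move: key; move: (ci n) (cm n) => a1 a2; clear; lia.
have mxE : ieval n env0 mx = cm n by rewrite /= ieval_ixpow cmE.
have cbm : cost n env0 body <= cm n by rewrite cmE; apply: hcb.
pose high (h : store R) := forall k, narr <= k ->
  na h k = (fun _ => 0) /\ ra h k = (fun _ => 0%R).
(* Holds between iterations: no trace of growth accumulates, because each body result is bounded
   afresh from its counter. *)
pose good (h : store R) := bounded_mem h (cm n) Vh Rh /\ high h.
have no_sc : forall x : nat, x \in [::] -> env0 x <= env0 x by [].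
have good_res e : e < N -> good (body_result I e).
  move=> he; split.
  - apply: (@bounded_memS _ _ _ (2 ^ cost n env0 body * V1) _ (2 ^+ cost n env0 body * M)%R).
    + by rewrite leq_mul2r leq_exp2l // cbm orbT.
    + by rewrite ler_wpM2r // ler_weXn2l // ler1n.
    have := @run_bounded R n (inn_of I) (inr_of I) body [::] env0 env0 (counter_store R e) (cm n) V1 M body_ok no_sc cbm _ V10 inV1 M0 irM; apply; split=> [a i hi|a i|a i] /=.
    + split=> //; case: eqP => // _; rewrite updE; case: eqP => // i0.
      by move: hi; rewrite i0 leqNgt (leq_trans (cost_gt0 _ _ _) cbm).
    + case: eqP => // _; rewrite updE; case: eqP => // _.
      by rewrite /V1; apply: leq_trans (ltnW he) _; apply: leq_trans N2 _; apply: leq_addr.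
    + by rewrite normr0.
  - move=> a ha; have [-> ->] := run_high n (inn_of I) (inr_of I) env0 (counter_store R e) body_ok ha.
    split=> //=; apply: funext => i; case: eqP => // ea.
    by rewrite ea in ha.
have high_clear h : good h -> run n (inn_of I) (inr_of I) (iteration body mx) env0 h
    = body_result I (na h aC 0).
  move=> [[h1 _ _] h2]; rewrite /iteration run_PSeq run_clear //.
  by move=> a i; rewrite mxE; apply: h1.
pose ok := fits S M.
have step h : good h -> exists2 t, t <= ci n & exec ok (compile (iteration body mx))
    (enc n (inn_of I) (inr_of I) env0 h) t
    (enc n (inn_of I) (inr_of I) env0 (body_result I (na h aC 0))).
  move=> gh; rewrite -high_clear // ciE.
  have [hb _] := gh.
  have hb' : bounded_mem h IB Vh Rh.
    by case: hb => b1' b2 b3; split=> // a i hi; apply: b1'; move: hi; rewrite /IB; move: (ci n) (cm n) => a1 a2; clear; lia.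
  apply: (@exec_compile _ _ _ (inr_of I) S IB VB M RB hS' hVB hIB hRB inVB irRB inn0
    _ [::] env0 env0 h Vh Rh) => //.
  - by rewrite -ciE /IB; move: (ci n) (cm n) => a1 a2; clear; lia.
  - exact: leq_trans V10 (gr1 _ _).
  - by rewrite /VB leq_mul2r leq_exp2l // -ciE leq_addr orbT.
  - by rewrite /RB ler_wpM2r // ler_weXn2l ?ler1n // -ciE leq_addr.
have ok_enc h inn' env : good h -> (forall a, inn' a <= VB) -> (forall x, env x <= n) ->
    ok (enc n inn' (inr_of I) env h).
  move=> [hb _] hin henv.
  apply: (@fits_enc _ _ _ _ S IB VB M RB hS' hVB hIB hRB hin irRB) => [x|].
    by apply: leq_trans (henv x) _; rewrite /IB; move: (ci n) (cm n) => a1 a2; clear; lia.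
  apply: (@bounded_memS _ _ _ Vh _ Rh); [exact: gr1 | exact: gr2 |].
  by case: hb => b1' b2 b3; split=> // a i hi; apply: b1'; move: hi; rewrite /IB; move: (ci n) (cm n) => a1 a2; clear; lia.
have testGO h : beval (enc n (inn_of I) (inr_of I) env0 h) cGO = (0 < na h aGO 0).
  set s := enc _ _ _ _ h.
  rewrite -[LHS]/(1 <= nats s (neval s (cAddr (NConst 0) aGO))).
  by rewrite neval_cAddr // nats_addr.
(* Induction on the leaves still to be run. The loop ends at some leaf [e], which either succeeds or
   witnesses that all leaves from the starting counter on have failed. *)
have loop r : forall h, good h -> N - na h aC 0 = r -> na h aC 0 < N -> na h aGO 0 = 1 ->
    exists e t, [/\ e < N, t <= r * (ci n).+1 + 1,
      exec ok (While cGO (compile (iteration body mx)))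
        (enc n (inn_of I) (inr_of I) env0 h) t
        (enc n (inn_of I) (inr_of I) env0 (body_result I e)) &
      found I e \/ forall e', na h aC 0 <= e' < N -> ~~ found I e'].
  elim: r => [|r IH] h gh hr hc hgo; first by move: hc; rewrite -subn_gt0 hr.
  set e := na h aC 0 in hr hc *.
  have [t1 ht1 et1] := step h gh; rewrite -/e in et1.
  have [rC rG] := hres e hc.
  have gr := good_res e hc.
  have b0 : beval (enc n (inn_of I) (inr_of I) env0 h) cGO by rewrite testGO hgo.
  case: (boolP (~~ found I e && (e.+1 < N))) => [go|stop].
  - rewrite go in rG; case/andP: go => nf lt.
    have [|||e' [t2 [he' ht2 et2 alt]]] := IH (body_result I e) gr.
    + by move: hr; rewrite rC; clear; lia.
    + by rewrite rC.
    + by rewrite rG.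
    exists e', (t1 + t2).+1; split=> //; first by move: ht1 ht2; rewrite mulSn; move: (ci n) => a1; clear; lia.
      exact: ExecWhileTrue et1 et2.
    case: alt => [|al]; [by left|right] => e'' /andP[h1 h2].
    by have [<-//|ne] := eqVneq e e''; apply: al; rewrite rC h2 andbT; move: ne h1; clear; lia.
  - rewrite (negbTE stop) in rG.
    exists e, (t1 + 1).+1; split=> //; first by move: ht1; rewrite mulSn; move: (ci n) => a1; clear; lia.
      apply: ExecWhileTrue et1 _ => //; apply: ExecWhileFalse.
        by apply: ok_enc.
      by rewrite testGO rG.
    case: (boolP (found I e)) stop => [|nf /= ge]; first by left.
    right=> e' /andP[h1 h2]; suff -> : e' = e by [].
    by move: ge h1 h2; clear; lia.
pose h0 : store R := setn (zero_store R) aGO 0 1.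
have good0 : good h0.
  split; first split=> [a i hi|a i|a i] /=.
  - split=> //; case: eqP => // _; rewrite updE; case: eqP => // i0.
    by move: hi; rewrite i0 leqNgt (leq_trans (cost_gt0 _ _ _) cbm).
  - by case: eqP => // _; rewrite updE; case: eqP => // _; apply: leq_trans V10 (gr1 _ _).
  - by rewrite normr0.
  - move=> a ha; split=> //=; apply: funext => i; case: eqP => // ea.
    by rewrite ea in ha.
have h0C : na h0 aC 0 = 0 by [].
have [e [t1 [he ht1 et1 alt]]] := loop N h0 good0 (subn0 N) N0 erefl.
have gr := good_res e he.
have VhVB : Vh <= VB by apply: gr1.
have h_le : forall k i, na (body_result I e) k i <= VB.
  by move=> k' i; case: gr => [[_ le _] _]; apply: leq_trans VhVB.
have [inn' ef [out0 outv]] := @copy_outP R n (inn_of I) (inr_of I) (body_result I e)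
  inn0 ok VB inVB h_le (fun i' env => ok_enc _ i' env gr).
exists (1 + (t1 + (3 * n + 2))), (enc n inn' (inr_of I) (upd env0 0 n) (body_result I e)).
have nn : n <= n * n + n by rewrite leq_addl.
split.
- apply: ExecSeq (ExecSeq et1 ef).
  rewrite -enc_initial -/n.
  have e0 : State (upd (nats (enc n (inn_of I) (inr_of I) env0 (zero_store R))) (addr n aGO 0) 1)
     (reals (enc n (inn_of I) (inr_of I) env0 (zero_store R)))
     = enc n (inn_of I) (inr_of I) env0 h0 by rewrite enc_setn.
  set s := enc n _ _ _ (zero_store R) in e0 *.
  have ea : neval s (cAddr (NConst 0) aGO) = addr n aGO 0 by rewrite neval_cAddr.
  rewrite -e0 -ea -[1 in X in State X _]/(neval s (NConst 1)); apply: ExecNWrite.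
    apply: ok_enc => //; split=> //; split=> // k' i; rewrite normr0 //.
  by rewrite ea e0; apply: ok_enc.
- rewrite /correct_output nats_in // out0.
  have outC : output_cover I (enc n inn' (inr_of I) (upd env0 0 n) (body_result I e))
      = candidate I e.
    apply/setP => v; rewrite !inE nats_in ?outv //.
    by apply: leq_trans nn; apply: ltn_ord.
  case: ifP => fe; first by rewrite outC; apply: hfound.
  case: alt => [|al]; first by rewrite /found fe.
  by move=> /hcomp[e' he' fe']; have := al e'; rewrite h0C he' fe' => /(_ isT).
- apply: (@le_trans _ _ (S * N)%:R%R); last first.
    by rewrite natrM ler_wpM2l // ler0n.
  rewrite ler_nat.
  have h1 : N * (ci n).+1 + 1 + 3 * n + 3 <= N * ((ci n).+1 + 1 + 3 * n + 3).
    by move: N0; move: (ci n) => a1; clear; nia.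
  apply: leq_trans (_ : N * ((ci n).+1 + 1 + 3 * n + 3) <= _).
    by move: h1 ht1; move: (ci n) => a1; clear; lia.
  rewrite mulnC leq_mul2r; apply/orP; right.
  by move: key; move: (ci n) (cm n) => a1 a2; clear; lia.
Qed.
End Assembly.

(** * The program *)

Coercion IC : nat >-> ix.
Coercion XI : ix >-> nx.

(** Legend. [aT] is the size of the cover, [aD3] a flag for a vertex of degree above three, [aDD] a
    scratch counter, [aNN] the number of leaves, [aL] the table of [leaves], [aAL] the alive
    vertices, [aR] the rest of the counter, [aDG] the degrees, [aMV] and [aMD] a vertex of minimum
    degree and that degree, [aLL] the leaves per child, [aSEL] the selected child, [aIM] the
    independent set, [aHH] the vertices of the bipartite graph, [aD] the labels, [aAU] and [aAV] the
    ends of a push, [aG] the gap, [aS] the (filled) graph, [aNB] the number of branchings, [aRK] the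
    elimination rank, [aBF] and [aBI] the branching flag and index, [aP] powers of two, [aBT] bits,
    [aVL] values of the assignment. Vertices held in a scalar are shifted by one, 0 meaning none. *)
Definition aT := 4.
Definition aD3 := 5.
Definition aDD := 6.
Definition aNN := 7.
Definition aL := 8.
Definition aAL := 9.
Definition aR := 10.
Definition aDG := 12.
Definition aMV := 13.
Definition aMD := 14.
Definition aLL := 15.
Definition aSEL := 16.
Definition aIM := 17.
Definition aHH := 18.
Definition aD := 19.
Definition aAU := 20.
Definition aAV := 21.
Definition aG := 23.
Definition aS := 24.
Definition aNB := 25.
Definition aRK := 26.
Definition aBF := 27.
Definition aBI := 28.
Definition aP := 29.
Definition aBT := 30.
Definition aVL := 31.

(** Legend for the reals: total weight, excess, flow, amount pushed, penalty, unary and binary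
    tables, and the costs of the values 0 and 1 of a vertex. *)
Definition rWT := 0.
Definition rZ := 1.
Definition rF := 2.
Definition rAMT := 3.
Definition rBIG := 4.
Definition rUA := 5.
Definition rBB := 6.
Definition rQ0 := 7.
Definition rQ1 := 8.

Definition sc (k : nat) : nx := XRd k 0.
Definition ysc (k : nat) : rx := YRd k 0.
Definition setS (k : nat) (e : nx) : prog := PN k 0 e.
Definition xlt (a b : nx) : bx := BN (XAdd a 1) b.
Definition bor (a b : bx) : bx := BNeg (BConj (BNeg a) (BNeg b)).
Definition ypos (a : rx) : bx := BNeg (BR a YZ).
Definition incr (k : nat) : prog := setS k (XAdd (sc k) 1).
Definition when (b : bx) (p : prog) : prog := PIf b p PSkip.
Definition cell2 (u v : ix) : ix := IAdd (IMul IN u) v.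

Notation "p ;; q" := (PSeq p q) (at level 90, right associativity).

Definition p_count (x : nat) (b : ix) (c : bx) : prog :=
  setS aDD 0 ;; PFor x b (when c (incr aDD)).

(** The result is shifted by one, so that 0 means that no index qualifies; [at_index] undoes the
    shift. *)
Definition find_last (k x : nat) (b : ix) (c : bx) : prog :=
  setS k 0 ;; PFor x b (when c (setS k (IAdd (IV x) 1))).

(* Runs [p] with [x] set to [e - 1] when [e] is not zero. *)
Definition at_index (e : nx) (x : nat) (p : prog) : prog :=
  PFor x IN (when (BE (IAdd (IV x) 1) e) p).

Definition p_size : prog :=
  setS aT 0 ;; PFor 10 IN (setS aT (XAdd (sc aT) (XU (IV 10)))).

Definition p_graph : prog :=
  PFor 10 IN (PFor 11 IN (PN aS (cell2 (IV 10) (IV 11)) (XA (IV 10) (IV 11)))).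

Definition p_maxdeg : prog :=
  setS aD3 0 ;;
  PFor 10 IN (p_count 11 IN (BN 1 (XA (IV 10) (IV 11))) ;;
    when (BN 4 (sc aDD)) (setS aD3 1)).

Definition x_alive (v : ix) : bx := BN 1 (XRd aAL v).
Definition x_edge (u : nx) (v : ix) : bx := BN 1 (XRd aS (XAdd (XMul IN u) v)).

Definition p_mindeg : prog :=
  PFor 10 IN (p_count 11 IN (BConj (x_alive (IV 11)) (x_edge (IV 10) (IV 11))) ;;
    PN aDG (IV 10) (sc aDD)) ;;
  (setS aMV 0 ;; setS aMD IN) ;;
  PFor 10 IN (when (BConj (x_alive (IV 10)) (BN (XRd aDG (IV 10)) (sc aMD)))
    (setS aMD (XRd aDG (IV 10)) ;; setS aMV (IAdd (IV 10) 1))).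

(** ** Maximum degree at least four *)

(** Worst case of the branching: if the minimum degree is [m], there are [m + 1] children, each
    without at least [m + 1] of the vertices. The table tells the decoder how many counter values to
    reserve for a child. *)
Definition p_leaves : prog :=
  PN aL 0 1 ;;
  PFor 10 IN (PFor 11 (IAdd (IV 10) 1)
    (when (xlt (XRd aL (IAdd (IV 10) 1))
               (XMul (IAdd (IV 11) 1) (XRd aL (ISub (IV 10) (IV 11)))))
       (PN aL (IAdd (IV 10) 1)
               (XMul (IAdd (IV 11) 1) (XRd aL (ISub (IV 10) (IV 11))))))) ;;
  setS aNN (XRd aL (sc aT)).

(** Decodes one digit of the counter. The closed neighbourhood of the chosen vertex is scanned in
    vertex order; each member owns a block of [aLL] values, and blocks are subtracted until the
    remainder falls into one. *)
Definition p_pick : prog :=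
  setS aSEL 0 ;;
  PFor 10 IN (when (BConj (BE (sc aSEL) 0) (BConj (x_alive (IV 10))
      (bor (BE (IAdd (IV 10) 1) (sc aMV)) (x_edge (XSub (sc aMV) 1) (IV 10)))))
    (PIf (BN (sc aLL) (sc aR)) (setS aR (XSub (sc aR) (sc aLL)))
      (setS aSEL (IAdd (IV 10) 1)))).

Definition p_take : prog :=
  at_index (sc aSEL) 10
    (PN aIM (IV 10) 1 ;;
     PFor 11 IN (when (bor (BE (IV 10) (IV 11)) (x_edge (IV 10) (IV 11)))
       (PN aAL (IV 11) 0))).

Definition p_mis_step : prog :=
  p_mindeg ;;
  (p_count 10 IN (x_alive (IV 10)) ;;
   setS aLL (XRd aL (XSub (sc aDD) (XAdd (sc aMD) 1)))) ;;
  p_pick ;; p_take.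

Definition p_mis : prog :=
  PFor 10 IN (PN aAL (IV 10) (XU (IV 10))) ;;
  setS aR (sc aC) ;;
  PFor 9 IN p_mis_step.

Definition p_flow_init : prog :=
  PFor 10 IN (PIf (BE (XU (IV 10)) 0)
    (PN aHH (IV 10) 1 ;; PR rZ (IV 10) (YSub YZ (YWt (IV 10))))
    (PIf (BN 1 (XRd aIM (IV 10)))
      (PN aHH (IV 10) 1 ;; PR rZ (IV 10) (YWt (IV 10)))
      PSkip)).

(** Residual arcs: an arc leaving the cover has unlimited capacity, an arc back into it can only
    cancel existing flow. *)
Definition x_res (u v : ix) : bx :=
  BConj (BConj (BN 1 (XRd aHH u)) (BN 1 (XRd aHH v)))
    (BConj (BN 1 (XA u v)) (bor (BN 1 (XU u)) (ypos (YRd rF (cell2 v u))))).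

Definition p_push (u v : ix) : prog :=
  PR rAMT 0 (YRd rZ u) ;;
  when (BConj (BE (XU u) 0) (BR (YRd rF (cell2 v u)) (ysc rAMT)))
    (PR rAMT 0 (YRd rF (cell2 v u))) ;;
  PR rZ u (YSub (YRd rZ u) (ysc rAMT)) ;;
  PR rZ v (YAdd (YRd rZ v) (ysc rAMT)) ;;
  PIf (BN 1 (XU u))
    (PR rF (cell2 u v) (YAdd (YRd rF (cell2 u v)) (ysc rAMT)))
    (PR rF (cell2 v u) (YSub (YRd rF (cell2 v u)) (ysc rAMT))).

(** An active vertex with no residual arc to a label one lower is relabelled, otherwise it pushes.
    Labels stop at [n]: a vertex that reaches it keeps its excess. *)
Definition p_flow_step : prog :=
  find_last aAU 10 IN (BConj (BN 1 (XRd aHH (IV 10)))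
    (BConj (ypos (YRd rZ (IV 10))) (xlt (XRd aD (IV 10)) IN))) ;;
  at_index (sc aAU) 10
    (find_last aAV 11 IN (BConj (x_res (IV 10) (IV 11))
       (BE (XRd aD (IV 10)) (XAdd (XRd aD (IV 11)) 1))) ;;
     PIf (BE (sc aAV) 0)
       (PN aD (IV 10) (XAdd (XRd aD (IV 10)) 1))
       (at_index (sc aAV) 11 (p_push (IV 10) (IV 11)))).

(** Each step lowers [potential] while a vertex is active, and $(n+1)^4$ bounds its initial
    value. *)
Definition p_flow : prog := PFor 9 (ixpow (IAdd IN 1) 4) p_flow_step.

(** A label in $0, \dots, n$ that no vertex of the bipartite graph bears. Labels drop by at most one
    along residual arcs, so no such arc leads from above the gap to below it: the gap is a cut. *)
Definition p_gap : prog :=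
  PFor 10 (IAdd IN 1)
    (p_count 11 IN (BConj (BN 1 (XRd aHH (IV 11))) (BE (XRd aD (IV 11)) (IV 10))) ;;
     when (BE (sc aDD) 0) (setS aG (IV 10))).

Definition x_chosen (v : ix) : bx :=
  bor (BConj (BN 1 (XU v)) (BE (XRd aIM v) 0))
    (bor (BConj (BN 1 (XRd aIM v)) (xlt (XRd aD v) (sc aG)))
         (BConj (BE (XU v) 0) (xlt (sc aG) (XRd aD v)))).

Definition p_cut : prog :=
  PFor 10 IN (PIf (x_chosen (IV 10)) (PN aOUT (IV 10) 1) (PN aOUT (IV 10) 0)).

Definition p_general : prog :=
  p_leaves ;; p_mis ;; p_flow_init ;; p_flow ;; p_gap ;; p_cut.

(** ** Maximum degree at most three *)

(** The number of leaves is doubled [t / 2] times. For want of division, the bits of the counter are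
    split off from the top, by comparison with stored powers of two. *)
Definition p_bits : prog :=
  setS aNN 1 ;;
  PFor 10 IN (when (BN (IMul 2 (IAdd (IV 10) 1)) (sc aT)) (setS aNN (XMul 2 (sc aNN)))) ;;
  PN aP 0 1 ;;
  PFor 10 IN (PN aP (IAdd (IV 10) 1) (XMul 2 (XRd aP (IV 10)))) ;;
  setS aR (sc aC) ;;
  PFor 10 IN (when (BN (XRd aP (ISub (ISub IN 1) (IV 10))) (sc aR))
    (PN aBT (ISub (ISub IN 1) (IV 10)) 1 ;;
     setS aR (XSub (sc aR) (XRd aP (ISub (ISub IN 1) (IV 10)))))).

Definition x_live_nbr (v u : ix) : bx := BConj (x_alive u) (x_edge v u).

(** Minimising out [v] couples the remaining neighbours of [v], so they become adjacent. *)
Definition p_fill (v : ix) : prog :=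
  PFor 11 IN (PFor 12 IN
    (when (BConj (BNeg (BE (IV 11) (IV 12)))
       (BConj (x_live_nbr v (IV 11)) (x_live_nbr v (IV 12))))
       (PN aS (cell2 (IV 11) (IV 12)) 1))).

Definition p_elim_step : prog :=
  p_mindeg ;;
  at_index (sc aMV) 10
    (PN aRK (IV 10) (IV 9) ;; PN aAL (IV 10) 0 ;;
     PIf (BN 3 (sc aMD))
       (PN aBF (IV 10) 1 ;; PN aBI (IV 10) (sc aNB) ;; incr aNB)
       (p_fill (IV 10))).

Definition p_elim : prog :=
  PFor 10 IN (PN aAL (IV 10) 1) ;; PFor 9 IN p_elim_step.

Definition u_cell (v x : ix) : ix := IAdd (IMul 2 v) x.
Definition b_cell (v u x y : ix) : ix :=
  IAdd (IMul 4 (cell2 v u)) (IAdd (IMul 2 x) y).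
(** The address of [b_cell] when the values come from memory; it is only read, and so need not be an
    index expression. *)
Definition bx_cell (v u : ix) (x y : nx) : nx :=
  XAdd (IMul 4 (cell2 v u)) (XAdd (XMul 2 x) y).

(** In the forward pass [IV 9] is the rank of [v]. *)
Definition x_later (v u : ix) : bx := BConj (x_edge v u) (xlt (IV 9) (XRd aRK u)).

Definition y_add (k : nat) (i : ix) (e : rx) : prog := PR k i (YAdd (YRd k i) e).

(** The pair of values 0 and 0 on an edge costs the penalty. Both orientations receive it, but only
    the one that starts at the end eliminated first is ever summed. *)
Definition p_tables : prog :=
  PR rBIG 0 YW ;;
  PFor 10 IN (y_add rBIG 0 (YWt (IV 10))) ;;
  PFor 10 IN (y_add rUA (u_cell (IV 10) 1) (YWt (IV 10))) ;;
  PFor 10 IN (PFor 11 IN (when (BN 1 (XA (IV 10) (IV 11)))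
    (y_add rBB (b_cell (IV 10) (IV 11) 0 0) (ysc rBIG)))).

Definition y_add_min (k : nat) (i : ix) (a b : rx) : prog :=
  PIf (BR a b) (y_add k i a) (y_add k i b).

Definition y_loc1 (v x u y : ix) : rx :=
  YAdd (YRd rUA (u_cell v x)) (YRd rBB (b_cell v u x y)).
Definition y_loc2 (v x u y w z : ix) : rx :=
  YAdd (y_loc1 v x u y) (YRd rBB (b_cell v w x z)).

(** Once [v] is fixed, its pair costs are unary costs of the later neighbours and move there; the
    unary cost of [v] stays in place. *)
Definition p_assign_branch (v : ix) : prog :=
  PN aVL v (XRd aBT (XRd aBI v)) ;;
  PFor 11 IN (PFor 12 2 (when (x_later v (IV 11))
    (y_add rUA (u_cell (IV 11) (IV 12))
       (YRd rBB (bx_cell v (IV 11) (XRd aVL v) (IV 12)))))).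

Definition p_message1 (v : ix) : prog :=
  PFor 11 IN (PFor 12 2 (when (x_later v (IV 11))
    (y_add_min rUA (u_cell (IV 11) (IV 12))
       (y_loc1 v 0 (IV 11) (IV 12)) (y_loc1 v 1 (IV 11) (IV 12))))).

Definition p_message2 (v : ix) : prog :=
  PFor 11 IN (PFor 12 IN (when (BConj (xlt (XRd aRK (IV 11)) (XRd aRK (IV 12)))
        (BConj (x_later v (IV 11)) (x_later v (IV 12))))
    (PFor 13 2 (PFor 14 2
      (y_add_min rBB (b_cell (IV 11) (IV 12) (IV 13) (IV 14))
         (y_loc2 v 0 (IV 11) (IV 13) (IV 12) (IV 14))
         (y_loc2 v 1 (IV 11) (IV 13) (IV 12) (IV 14))))))).

(** Without later neighbours the minimum is a constant, which does not affect the choice of an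
    assignment and is not stored. *)
Definition p_forward_step : prog :=
  PFor 10 IN (when (BE (XRd aRK (IV 10)) (IV 9))
    (PIf (BN 1 (XRd aBF (IV 10))) (p_assign_branch (IV 10))
       (p_count 11 IN (x_later (IV 10) (IV 11)) ;;
        PIf (BE (sc aDD) 1) (p_message1 (IV 10))
          (PIf (BE (sc aDD) 2) (p_message2 (IV 10)) PSkip)))).

(* Here the rank is [n - 1 - IV 9], so that vertices are treated backwards. *)
Definition x_later_back (v u : ix) : bx :=
  BConj (x_edge v u) (xlt (XRd aRK v) (XRd aRK u)).

Definition p_backward_step : prog :=
  PFor 10 IN (when (BConj (BE (XRd aRK (IV 10)) (ISub (ISub IN 1) (IV 9)))
                          (BE (XRd aBF (IV 10)) 0))
    (PR rQ0 0 (YRd rUA (u_cell (IV 10) 0)) ;;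
     PR rQ1 0 (YRd rUA (u_cell (IV 10) 1)) ;;
     PFor 11 IN (when (x_later_back (IV 10) (IV 11))
       (y_add rQ0 0 (YRd rBB (bx_cell (IV 10) (IV 11) 0 (XRd aVL (IV 11)))) ;;
        y_add rQ1 0 (YRd rBB (bx_cell (IV 10) (IV 11) 1 (XRd aVL (IV 11)))))) ;;
     PIf (BR (ysc rQ1) (ysc rQ0)) (PN aVL (IV 10) 1) (PN aVL (IV 10) 0))).

Definition p_cubic : prog :=
  p_elim ;; p_bits ;; p_tables ;; PFor 9 IN p_forward_step ;;
  PFor 9 IN p_backward_step ;;
  PFor 10 IN (PN aOUT (IV 10) (XRd aVL (IV 10))).

(** ** Verification of the candidate *)

Definition p_check : prog :=
  (setS aDD 0 ;;
   PFor 10 IN (PFor 11 IN (when (BConj (BN 1 (XA (IV 10) (IV 11)))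
      (BConj (BE (XRd aOUT (IV 10)) 0) (BE (XRd aOUT (IV 11)) 0))) (incr aDD)))) ;;
  (PR rWT 0 YZ ;;
   PFor 10 IN (when (BNeg (BE (XRd aOUT (IV 10)) 0))
      (PR rWT 0 (YAdd (ysc rWT) (YWt (IV 10)))))) ;;
  (setS aFND 0 ;;
   when (BConj (BE (sc aDD) 0) (BR (ysc rWT) YW)) (setS aFND 1)) ;;
  incr aC ;;
  (setS aGO 0 ;;
   when (BConj (BE (sc aFND) 0) (xlt (sc aC) (sc aNN))) (setS aGO 1)).

Definition body : prog :=
  (p_size ;; p_graph ;; p_maxdeg) ;;
  PIf (BE (sc aD3) 0) p_cubic p_general ;;
  p_check.

Lemma body_ok : prog_ok [::] body.
Proof. by []. Qed.

(** * Reasoning about programs *)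

Fixpoint wn (p : prog) : seq nat :=
  match p with
  | PN k _ _ => [:: k]
  | PSeq a b | PIf _ a b => wn a ++ wn b
  | PFor _ _ a => wn a
  | _ => [::]
  end.

Fixpoint wr (p : prog) : seq nat :=
  match p with
  | PR k _ _ => [:: k]
  | PSeq a b | PIf _ a b => wr a ++ wr b
  | PFor _ _ a => wr a
  | _ => [::]
  end.

Fixpoint nx_reads (k : nat) (e : nx) : bool :=
  match e with
  | XI _ => false
  | XU a | XMul _ a => nx_reads k a
  | XRd k' a => (k' == k) || nx_reads k a
  | XA a b | XAdd a b | XSub a b => nx_reads k a || nx_reads k b
  end.

Fixpoint rx_reads (k : nat) (e : rx) : bool :=
  match e with
  | YZ | YW => false
  | YWt a | YRd _ a => nx_reads k a
  | YAdd a b | YSub a b => rx_reads k a || rx_reads k b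
  end.

Fixpoint bx_reads (k : nat) (b : bx) : bool :=
  match b with
  | BN a b | BE a b => nx_reads k a || nx_reads k b
  | BR a b => rx_reads k a || rx_reads k b
  | BNeg b => bx_reads k b
  | BConj a b => bx_reads k a || bx_reads k b
  end.

Fixpoint reads (k : nat) (p : prog) : bool :=
  match p with
  | PSkip => false
  | PN _ _ e => nx_reads k e
  | PR _ _ e => rx_reads k e
  | PSeq a b => reads k a || reads k b
  | PIf c a b => [|| bx_reads k c, reads k a | reads k b]
  | PFor _ _ a => reads k a
  end.

Section Frame.
Variables (R : realType) (n : nat) (inn : nat -> nat) (inr : nat -> R).
Local Notation run := (run n inn inr).
Local Notation bxeval := (bxeval n inn inr).
Local Notation xeval := (xeval n inn).
Local Notation yeval := (yeval n inn inr).

Lemma frame_n p : forall env h k, k \notin wn p -> na (run p env h) k = na h k.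
Proof.
elim: p => [|k i e|k i e|a IHa b IHb|b p IHp q IHq|x b p IHp] env h k' //=.
- by rewrite inE => /negbTE ->.
- by rewrite mem_cat negb_or => /andP[ha hb]; rewrite IHb // IHa.
- by rewrite mem_cat negb_or => /andP[ha hb]; case: ifP => _; [apply: IHp | apply: IHq].
- move=> hk; apply: (@iteri_inv _ (fun _ g => na g k' = na h k')) => //.
  by move=> i y _ <-; apply: IHp.
Qed.

Lemma frame_r p : forall env h k, k \notin wr p -> ra (run p env h) k = ra h k.
Proof.
elim: p => [|k i e|k i e|a IHa b IHb|b p IHp q IHq|x b p IHp] env h k' //=.
- by rewrite inE => /negbTE ->.
- by rewrite mem_cat negb_or => /andP[ha hb]; rewrite IHb // IHa.
- by rewrite mem_cat negb_or => /andP[ha hb]; case: ifP => _; [apply: IHp | apply: IHq].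
- move=> hk; apply: (@iteri_inv _ (fun _ g => ra g k' = ra h k')) => //.
  by move=> i y _ <-; apply: IHp.
Qed.

Lemma run_when b p env (h : store R) :
  run (when b p) env h = if bxeval env h b then run p env h else h.
Proof. by []. Qed.

Lemma na_setn (h : store R) k i v k' :
  na (setn h k i v) k' = if k' == k then upd (na h k') i v else na h k'.
Proof. by []. Qed.

Lemma ra_setr (h : store R) k i v k' :
  ra (setr h k i v) k' = if k' == k then upd (ra h k') i v else ra h k'.
Proof. by []. Qed.

Definition agree (k : nat) (g h : store R) : Prop :=
  (forall k', k' != k -> na g k' = na h k') /\ ra g = ra h.

Lemma agree_refl k h : agree k h h. Proof. by []. Qed.

Lemma agree_setn k i v g h : agree k g h -> agree k (setn g k i v) h.
Proof. by case=> h1 h2; split=> // k' ne; rewrite na_setn (negbTE ne) h1. Qed.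

Lemma xeval_agree k e env g h : agree k g h -> ~~ nx_reads k e ->
  xeval env g e = xeval env h e.
Proof.
move=> [h1 h2].
elim: e => [i|a IHa|a IHa b IHb|k' a IHa|a IHa b IHb|a IHa b IHb|i a IHa] //=.
- by move=> /IHa ->.
- by rewrite negb_or => /andP[/IHa -> /IHb ->].
- by rewrite negb_or => /andP[ne /IHa ->]; rewrite h1.
- by rewrite negb_or => /andP[/IHa -> /IHb ->].
- by rewrite negb_or => /andP[/IHa -> /IHb ->].
- by move=> /IHa ->.
Qed.

Lemma yeval_agree k e env g h : agree k g h -> ~~ rx_reads k e ->
  yeval env g e = yeval env h e.
Proof.
move=> gh; have [h1 h2] := gh; elim: e => [||a|k' a|a IHa b IHb|a IHa b IHb] //=.
- by move=> /(xeval_agree env gh) ->.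
- by move=> /(xeval_agree env gh) ->; rewrite h2.
- by rewrite negb_or => /andP[/IHa -> /IHb ->].
- by rewrite negb_or => /andP[/IHa -> /IHb ->].
Qed.

Lemma bxeval_agree k b env g h : agree k g h -> ~~ bx_reads k b ->
  bxeval env g b = bxeval env h b.
Proof.
move=> gh; elim: b => [a b|a b|a b|b IHb|a IHa b IHb] /=.
- by rewrite negb_or => /andP[/(xeval_agree env gh) -> /(xeval_agree env gh) ->].
- by rewrite negb_or => /andP[/(xeval_agree env gh) -> /(xeval_agree env gh) ->].
- by rewrite negb_or => /andP[/(yeval_agree env gh) -> /(yeval_agree env gh) ->].
- by move=> /IHb ->.
- by rewrite negb_or => /andP[/IHa -> /IHb ->].
Qed.

(** Noninterference. With [k] the counter array, it shows that the work done before decoding is the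
    same for all leaves. *)
Lemma run_agree k p : forall env g h, agree k g h -> ~~ reads k p ->
  agree k (run p env g) (run p env h).
Proof.
elim: p => [|k' i e|k' i e|a IHa b IHb|b p IHp q IHq|x b p IHp] env g h gh //=.
- move=> /(xeval_agree env gh) ->; have [h1 h2] := gh; split=> // k2 ne.
  by rewrite !na_setn; case: eqP => _; rewrite h1.
- move=> /(yeval_agree env gh) ->; have [h1 h2] := gh; split=> //=.
  by rewrite h2.
- by rewrite negb_or => /andP[ha hb]; apply: IHb => //; apply: IHa.
- rewrite !negb_or => /and3P[hb hp hq]; rewrite (bxeval_agree env gh hb).
  by case: ifP => _; [apply: IHp | apply: IHq].
- move=> hp; elim: (ieval n env b) => [|t IH] //=.
  exact: IHp.
Qed.

(** Quantifying over all stores that agree with [h] outside [k] makes the property pass through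
    loops, whose later rounds start from partial sums. *)
Definition adds (p : prog) (k : nat) (env : nat -> nat) (h : store R) (v : nat) : Prop :=
  forall g, agree k g h ->
    agree k (run p env g) h /\ na (run p env g) k 0 = na g k 0 + v.

Lemma adds_for p k x b env h (v : nat -> nat) :
  (forall i, i < ieval n env b -> adds p k (upd env x i) h (v i)) ->
  adds (PFor x b p) k env h (\sum_(i < ieval n env b) v i).
Proof.
move=> H g gh; rewrite run_PFor.
apply: (@iteri_inv _ (fun t g' => agree k g' h /\ na g' k 0 = na g k 0 + \sum_(i < t) v i)).
  by rewrite big_ord0 addn0.
move=> i y hi [y1 y2]; have [z1 z2] := H i hi y y1.
by split=> //; rewrite z2 y2 big_ord_recr /= addnA.
Qed.

Lemma adds_when c p k env h (b : bool) v :
  (forall g, agree k g h -> bxeval env g c = b) -> adds p k env h v ->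
  adds (when c p) k env h (if b then v else 0).
Proof.
move=> hc hp g gh; rewrite run_when hc //; case: b hc => _; first exact: hp.
by rewrite addn0.
Qed.

Lemma adds_set k (e : nx) env h v :
  (forall g, agree k g h -> xeval env g e = v) ->
  adds (setS k (XAdd (sc k) e)) k env h v.
Proof.
move=> he g gh; split; first exact: agree_setn.
by rewrite /= eqxx updE eqxx he.
Qed.

Lemma adds_incr k env h : adds (incr k) k env h 1.
Proof. exact: adds_set. Qed.

Lemma run_count x b c env (h : store R) (P : nat -> bool) :
  (forall i g, i < ieval n env b -> agree aDD g h -> bxeval (upd env x i) g c = P i) ->
  agree aDD (run (p_count x b c) env h) h /\
  na (run (p_count x b c) env h) aDD 0 = \sum_(i < ieval n env b) P i.
Proof.
move=> H; rewrite /p_count run_PSeq.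
have := @adds_for (when c (incr aDD)) aDD x b env h (fun i => nat_of_bool (P i)).
move=> /(_ _ (run (setS aDD 0) env h)) [].
- move=> i hi; have -> : nat_of_bool (P i) = if P i then 1 else 0 by case: (P i).
  by apply: adds_when => [g|]; [apply: H | apply: adds_incr].
- exact: agree_setn.
by move=> h1 ->; split.
Qed.

Definition last_index (b : nat) (P : nat -> bool) : nat :=
  iteri b (fun i k => if P i then i.+1 else k) 0.

Lemma last_indexP b P : (last_index b P = 0 /\ forall i, i < b -> ~~ P i) \/
  exists2 i, i < b /\ P i & last_index b P = i.+1.
Proof.
rewrite /last_index; elim: b => [|b IH]; first by left.
rewrite /=; case: (boolP (P b)) => hb; first by right; exists b.
case: IH => [[-> h]|[i [hi Pi] ->]]; last by right; exists i => //; rewrite ltnW.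
by left; split=> // i; rewrite ltnS leq_eqVlt => /orP[/eqP->|/h].
Qed.

Lemma run_find_last k x b c env (h : store R) (P : nat -> bool) :
  (forall i g, i < ieval n env b -> agree k g h -> bxeval (upd env x i) g c = P i) ->
  agree k (run (find_last k x b c) env h) h /\
  na (run (find_last k x b c) env h) k 0 = last_index (ieval n env b) P.
Proof.
move=> H; rewrite /find_last run_PSeq run_PFor /last_index.
set h0 := run (setS k 0) env h; set m := ieval n env b in H *.
suff: forall t, t <= m -> let g := iteri t (fun i => run (when c (setS k (IAdd (IV x) 1))) (upd env x i)) h0 in
  agree k g h /\ na g k 0 = iteri t (fun i k => if P i then i.+1 else k) 0 by apply.
elim=> [|t IH] ht.
  by split; [apply: agree_setn | rewrite /= eqxx].
have [a1 a2] := IH (ltnW ht); move: a1 a2 => /=; set g := iteri t _ h0 => a1 a2.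
rewrite (H t g ht a1) -a2; case: (P t) => //; split; first exact: agree_setn.
by rewrite /= eqxx !updE !eqxx addn1.
Qed.

(** The premises keep the tested expression constant, even after [p] has run, so that exactly one
    round can fire. *)
Lemma run_at_index e x p env (h : store R) v :
  xeval env h e = v ->
  (forall i, xeval (upd env x i) h e = v) ->
  (forall i j, xeval (upd env x i) (run p (upd env x j) h) e = v) ->
  run (at_index e x p) env h =
  if 0 < v <= n then run p (upd env x v.-1) h else h.
Proof.
move=> e0 e1 e2; rewrite /at_index run_PFor /=.
have H t : t <= n -> iteri t (fun i => run (when (BE (IAdd (IV x) 1) e) p) (upd env x i)) h
  = if 0 < v <= t then run p (upd env x v.-1) h else h.
  elim: t => [|t IH] ht; first by case: (v).
  rewrite /= IH; last exact: ltnW.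
  rewrite !updE eqxx addn1.
  case: (ltngtP v t.+1) => [lt|gt|ev].
  - have -> : (v <= t) = true by []. rewrite andbT; have -> : xeval (upd env x t) (if 0 < v then run p (upd env x v.-1) h else h) e = v.
      by case: (0 < v); [apply: e2 | apply: e1].
    by rewrite gtn_eqF.
  - have -> : (v <= t) = false by rewrite leqNgt (ltnW gt). by rewrite andbF /= e1 ltn_eqF.
  - by rewrite ev ltnn andbF /= e1 ev eqxx.
exact: H.
Qed.

Lemma run_map k x b e env (h : store R) (f : nat -> nat) :
  (forall i g, i < ieval n env b -> agree k g h ->
     (forall j, i <= j -> na g k j = na h k j) -> xeval (upd env x i) g e = f i) ->
  agree k (run (PFor x b (PN k (IV x) e)) env h) h /\
  forall i, na (run (PFor x b (PN k (IV x) e)) env h) k i =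
    if i < ieval n env b then f i else na h k i.
Proof.
move=> H; rewrite run_PFor; set m := ieval n env b in H *.
apply: (@iteri_inv _ (fun t g => agree k g h /\
   forall i, na g k i = if i < t then f i else na h k i)) => // t g ht [g1 g2].
split; first exact: agree_setn.
move=> i; rewrite /= eqxx !updE eqxx ltnS leq_eqVlt.
case: eqP => [->|_] /=; last by rewrite g2.
by apply: H => // j hj; rewrite g2 ltnNge hj.
Qed.

End Frame.

Lemma nth_rows (T T1 T2 : Type) (x : T) (d1 : T1) (d2 : T2) (f : T1 -> T2 -> T) s r i j :
  i < size s -> j < size r ->
  nth x [seq f u v | u <- s, v <- r] (size r * i + j) = f (nth d1 s i) (nth d2 r j).
Proof.
elim: s i => [|u s IH] [|i] //= hi hj.
- by rewrite muln0 add0n nth_cat size_map hj (nth_map d2).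
- rewrite nth_cat size_map mulnS -addnA ltnNge leq_addr /= addKn.
  exact: IH.
Qed.

(** * Reading the input, the prelude and the final check *)

Section Reading.
Variables (R : realType) (I : instance R).
Local Notation n := (Defs.order I).
Local Notation inn := (inn_of I).
Local Notation inr := (inr_of I).
Local Notation U := (mincover I).
Local Notation run := (run n inn inr).

Lemma uinE (v : 'I_n) : uin n inn v = (v \in U).
Proof.
have hv := ltn_ord v; rewrite /uin (minn_idPl _); last by apply: leq_trans (leq_addl _ _).
by rewrite /inn_of /= nth_cat size_map size_enum_ord hv (nth_map v) ?size_enum_ord // nth_ord_enum.
Qed.

Lemma ainE (u v : 'I_n) : ain n inn u v = edge I u v.
Proof.
have hv := ltn_ord v; have hu := ltn_ord u.
have hm : n * u + v < n * n.
  have : n * u.+1 <= n * n by rewrite leq_mul2l hu orbT.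
  by rewrite mulnS; lia.
rewrite /ain (minn_idPl _); last lia.
have -> : n.+1 + n * u + v = (n + (n * u + v)).+1 by lia.
rewrite /inn_of /= nth_cat size_map size_enum_ord ltnNge leq_addr /= addKn.
have := @nth_rows _ _ _ 0 u v (fun a b => edge I a b : nat) (enum 'I_n) (enum 'I_n) u v.
by rewrite size_enum_ord !nth_ord_enum => ->.
Qed.

Lemma winE (v : 'I_n) : win n inr v = weight I v.
Proof.
have hv := ltn_ord v; rewrite /win (minn_idPl _); last by apply: leq_trans (leq_addl _ _).
by rewrite /inr_of /= (nth_map v) ?size_enum_ord // nth_ord_enum.
Qed.

Lemma innW : inr 0 = budget I. Proof. by []. Qed.

Definition cover_of (h : store R) : {set 'I_n} := [set v : 'I_n | na h aOUT v != 0].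

Definition covers (C : {set 'I_n}) : bool :=
  [forall u : 'I_n, forall v : 'I_n, edge I u v ==> (u \in C) || (v \in C)].

Lemma coversP C : reflect (vertex_cover (edge I) C) (covers C).
Proof.
apply: (iffP forallP) => [h u v e|h u]; first by move/forallP: (h u) => /(_ v) /implyP; apply.
by apply/forallP => v; apply/implyP; apply: h.
Qed.

Definition solved (h : store R) : bool :=
  covers (cover_of h) && (total_weight (cover_of h) <= budget I)%R.

Lemma sum_bool_eq0 (T : finType) (P : T -> bool) :
  (\sum_i (P i : nat) == 0) = [forall i, ~~ P i].
Proof.
rewrite sum_nat_eq0; apply: eq_forallb => i.
by rewrite eqb0.
Qed.

Lemma run_check env h : let h' := run p_check env h in
  [/\ na h' aC 0 = (na h aC 0).+1, na h' aOUT = na h aOUT,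
      na h' aFND 0 = solved h &
      na h' aGO 0 = ~~ solved h && ((na h aC 0).+1 < na h aNN 0)].
Proof.
move=> h'; rewrite /h' /p_check !run_PSeq.
set h1 := run (PFor 10 IN (PFor 11 IN _)) env (run (setS aDD 0) env h).
set h2 := run (PFor 10 IN _) env (run (PR rWT 0 YZ) env h1).
set h3 := run (when _ (setS aFND 1)) env _.
set h4 := run (incr aC) env h3.
have [[e1 r1] c1] : agree aDD h1 h /\ na h1 aDD 0 =
    \sum_(u < n) \sum_(v < n) (edge I u v && ~~ ((u \in cover_of h) || (v \in cover_of h)) : nat).
  set f : nat -> nat -> nat := fun u v => if [&& 0 < ain n inn u v, na h aOUT u == 0 & na h aOUT v == 0] then 1 else 0.
  have := @adds_for R n inn inr (PFor 11 IN (when (BConj (BN 1 (XA (IV 10) (IV 11)))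
      (BConj (BE (XRd aOUT (IV 10)) 0) (BE (XRd aOUT (IV 11)) 0))) (incr aDD))) aDD 10 IN env
      (run (setS aDD 0) env h) (fun u => \sum_(v < n) f u v) _ _ (agree_refl _ _).
  case=> [u hu|[a1 a2] ->].
    apply: (@adds_for R n inn inr _ aDD 11 IN (upd env 10 u) _ (f u)) => v hv.
    apply: adds_when => [g [ge _]|]; last exact: adds_incr.
    by rewrite /= !updE /= !ge.
  split; first by split=> // k hk; rewrite a1 // na_setn (negbTE hk).
  apply: eq_bigr => u _; apply: eq_bigr => v _.
  rewrite /f ainE !inE negb_or !negbK.
  by case: (edge I u v) => //=; case: ifP.
have e2 : na h2 = na h1.
  by apply: funext => k; rewrite /h2 frame_n //.
have c2 : ra h2 rWT 0 = total_weight (cover_of h).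
  rewrite /h2 run_PFor /total_weight big_mkcond /=.
  set w : nat -> R := fun v => if na h aOUT v != 0 then win n inr v else 0%R.
  have -> : (\sum_i (if i \in cover_of h then weight I i else 0) = \sum_(i < n) w i)%R.
    by apply: eq_bigr => v _; rewrite inE /w winE.
  have : forall t, t <= n -> let g := iteri t (fun i => run (when (BNeg (BE (XRd aOUT (IV 10)) 0))
      (PR rWT 0 (YAdd (ysc rWT) (YWt (IV 10))))) (upd env 10 i)) (run (PR rWT 0 YZ) env h1) in
      na g = na h1 /\ ra g rWT 0 = (\sum_(i < t) w i)%R.
    elim=> [|t IH] ht; first by rewrite big_ord0; split.
    have [g1 g2] := IH (ltnW ht); move: g1 g2 => /=; set g := iteri t _ _ => g1 g2.
    rewrite big_ord_recr /= updE /= /w g1 e1 // -g2 /=.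
    by case: (_ != 0); rewrite ?addr0 //=; split.
  by move=> /(_ n (leqnn n)) [].
have e3 k : k != aFND -> na h3 k = na h2 k.
  by move=> hk; have nk : k \notin [:: aFND]; [rewrite inE | rewrite /h3 [LHS]frame_n // [LHS]frame_n].
have c3 : na h3 aFND 0 = solved h.
  rewrite /h3 run_when /= e2 c1 c2 innW.
  have -> : (\sum_(u < n) \sum_(v < n) (edge I u v && ~~ ((u \in cover_of h) || (v \in cover_of h)) : nat) == 0) = covers (cover_of h).
    rewrite sum_nat_eq0; apply: eq_forallb => u.
    rewrite /= sum_bool_eq0; apply: eq_forallb => v.
    by rewrite negb_and negbK implybE.
  by rewrite -/(solved h); case: (solved h).
have e4 k : k != aC -> na h4 k = na h3 k.
  by move=> hk; have nk : k \notin [:: aC]; [rewrite inE | rewrite /h4 [LHS]frame_n].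
have c4 : na h4 aC 0 = (na h aC 0).+1.
  by rewrite /h4 /= !updE /= e3 // e2 e1 // addn1.
have o4 : na h4 aOUT = na h aOUT by rewrite e4 // e3 // e2 e1.
clearbody h4; split.
- by rewrite !frame_n.
- by rewrite !frame_n.
- by rewrite !frame_n // e4 // c3.
- rewrite run_when /= e4 // c3 c4 [na h4 aNN]e4 // e3 // e2 e1 // addn1 eqb0.
  by case: (~~ solved h) => //=; case: ifP.
Qed.

Definition prelude : prog := p_size ;; p_graph ;; p_maxdeg.

(** The last conjunct ties every leaf to the prelude run with counter 0: in the cubic case the
    elimination order has to be known before the counter value is chosen. *)
Definition start (c : nat) (h : store R) : Prop :=
  [/\ na h aC 0 = c, na h aT 0 = #|U|,
      forall u v : 'I_n, na h aS (n * u + v) = edge I u v,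
      forall k, k \notin [:: aC; aT; aD3; aDD; aS] -> na h k = fun _ => 0 &
      (forall k, ra h k = fun _ => 0%R) /\
      agree aC h (run prelude env0 (counter_store R 0))].

Definition small_degree : bool := [forall u, #|[set v | edge I u v]| <= 3].

Lemma run_p_size env h : na (run p_size env h) aT 0 = #|U|.
Proof.
rewrite /p_size run_PSeq run_PFor.
have -> : #|U| = \sum_(v < n) uin n inn v.
  rewrite -sum1_card big_mkcond; apply: eq_bigr => v _; rewrite uinE.
  by case: (v \in U).
apply: (@iteri_inv _ (fun t g => na g aT 0 = \sum_(v < t) uin n inn v)).
  by rewrite big_ord0.
by move=> t g ht; rewrite big_ord_recr /= !updE /= => ->.
Qed.

Lemma run_matrix k (e : nx) x y (env : nat -> nat) (h : store R) (f : 'I_n -> 'I_n -> nat) :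
  (forall (u v : 'I_n) g, agree k g h -> xeval n inn (upd (upd env x u) y v) g e = f u v) ->
  x != y ->
  let h' := run (PFor x IN (PFor y IN (PN k (cell2 (IV x) (IV y)) e))) env h in
  forall u v : 'I_n, na h' k (n * u + v) = f u v.
Proof.
move=> H xy h'.
suff [_ H2] : agree k h' h /\ forall u v : 'I_n, u < n -> na h' k (n * u + v) = f u v.
  by move=> u v; apply: H2.
rewrite /h' run_PFor; apply: (@iteri_inv _ (fun t g => agree k g h /\
  forall u v : 'I_n, u < t -> na g k (n * u + v) = f u v)) => // t g ht [g1 g2].
rewrite run_PFor.
suff: agree k (iteri n (fun i => run (PN k (cell2 (IV x) (IV y)) e) (upd (upd env x t) y i)) g) h /\
  (forall u v : 'I_n, u < t \/ u = t :> nat /\ v < n ->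
    na (iteri n (fun i => run (PN k (cell2 (IV x) (IV y)) e) (upd (upd env x t) y i)) g) k (n * u + v) = f u v).
  case=> a1 a2; split=> // u v; rewrite ltnS leq_eqVlt => /orP[/eqP e0|lt]; apply: a2; last by left.
  by right; rewrite ltn_ord.
apply: (@iteri_inv _ (fun s g' => agree k g' h /\
  forall u v : 'I_n, u < t \/ u = t :> nat /\ v < s -> na g' k (n * u + v) = f u v)).
  by split=> // u v [|[]] //; apply: g2.
move=> s g' hs [a1 a2]; split; first exact: agree_setn.
have He := H (Ordinal ht) (Ordinal hs) g' a1; rewrite /= in He.
move=> u v; rewrite /= eqxx !updE (negbTE xy) !eqxx He.
have inj : (n * u + v == n * t + s) = (u == t :> nat) && (v == s :> nat).
  apply/eqP/andP => [e0|[/eqP -> /eqP ->] //].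
  have := congr1 (divn^~ n) e0; have := congr1 (modn^~ n) e0.
  rewrite ![n * _]mulnC !modnMDl !divnMDl ?(leq_ltn_trans _ ht) //.
  by rewrite !modn_small // !divn_small // !addn0 => -> ->; rewrite !eqxx.
rewrite inj; case: (u =P t :> nat) => eu /=; last first.
  by case=> [lt|[]] //; apply: a2; left.
case: (v =P s :> nat) => ev /=.
  by move=> _; congr f; apply: val_inj.
case=> [lt|[_]]; first by move: lt; rewrite eu ltnn.
by rewrite ltnS leq_eqVlt => /orP[/eqP //|lt]; apply: a2; right.
Qed.

Lemma run_p_graph env h (u v : 'I_n) : na (run p_graph env h) aS (n * u + v) = edge I u v.
Proof.
apply: (@run_matrix aS _ 10 11 env h (fun u v => edge I u v : nat)) => // u' v' g _.
exact: ainE.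
Qed.

Lemma run_p_maxdeg env h : (na (run p_maxdeg env h) aD3 0 == 0) = small_degree.
Proof.
rewrite /p_maxdeg run_PSeq run_PFor.
pose deg u := \sum_(v < n) (0 < ain n inn u v : nat).
have -> : small_degree = [forall u : 'I_n, (u < n) ==> (deg u <= 3)].
  apply: eq_forallb => u; rewrite ltn_ord /= -sum1_card big_mkcond /=.
  congr (_ <= _); apply: eq_bigr => v _; rewrite inE ainE.
  by case: (edge I u v).
apply: (@iteri_inv _ (fun t g => (na g aD3 0 == 0) = [forall u : 'I_n, (u < t) ==> (deg u <= 3)])).
  by symmetry; apply/forallP.
move=> t g ht IH; rewrite run_PSeq.
have [//|[a1 _] a2] := @run_count R n inn inr 11 IN (BN 1 (XA (IV 10) (IV 11))) (upd env 10 t) g (fun v => 0 < ain n inn t v).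
set g' := run _ _ g in a1 a2 *; rewrite run_when.
have -> : bxeval n inn inr (upd env 10 t) g' (BN 4 (sc aDD)) = (3 < deg t).
  by rewrite /= a2.
have key : [forall u : 'I_n, (u < t.+1) ==> (deg u <= 3)] =
  [forall u : 'I_n, (u < t) ==> (deg u <= 3)] && (deg t <= 3).
  apply/forallP/andP => [h1|[/forallP h1 h2] u].
    split; last by have := h1 (Ordinal ht); rewrite /= ltnSn.
    by apply/forallP => u; apply/implyP => hu; apply: (implyP (h1 u)); rewrite ltnS ltnW.
  apply/implyP; rewrite ltnS leq_eqVlt => /orP[/eqP -> //|]; exact: (implyP (h1 u)).
rewrite key -IH [deg t <= 3]leqNgt; case: (3 < deg t); first by rewrite andbF.
by rewrite andbT a1.
Qed.

Lemma prelude_start c : let h := run prelude env0 (counter_store R c) in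
  start c h /\ (na h aD3 0 == 0) = small_degree.
Proof.
move=> h; have ag : agree aC h (run prelude env0 (counter_store R 0)).
  apply: run_agree => //; split=> // k ne.
  by rewrite /counter_store !na_setn (negbTE ne).
suff [[s1 s2 s3 s4 s5] s6] : [/\ na h aC 0 = c, na h aT 0 = #|U|,
      forall u v : 'I_n, na h aS (n * u + v) = edge I u v,
      forall k, k \notin [:: aC; aT; aD3; aDD; aS] -> na h k = fun _ => 0 &
      forall k, ra h k = fun _ => 0%R] /\ (na h aD3 0 == 0) = small_degree by [].
rewrite {ag}/h /prelude 2!run_PSeq; split; last exact: run_p_maxdeg.
set h0 := counter_store R c; set h1 := run p_size env0 h0.
set h2 := run p_graph env0 h1.
have e1 : na h1 aT 0 = #|U| by apply: run_p_size.
have e2 := run_p_graph env0 h1; rewrite -/h2 in e2.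
have f1 k : k \notin wn p_size -> na h1 k = na h0 k by move=> hk; rewrite /h1 [LHS]frame_n.
have f2 k : k \notin wn p_graph -> na h2 k = na h1 k by move=> hk; rewrite /h2 [LHS]frame_n.
have r2 k : ra h2 k = fun=> 0%R by rewrite /h2 /h1 !frame_r.
clearbody h2; clearbody h1.
split.
- by rewrite frame_n // f2 // f1.
- by rewrite frame_n // f2.
- by move=> u v; rewrite frame_n.
- move=> k; rewrite !inE !negb_or => /and5P[k0 k1 k2 k3 k4].
  rewrite frame_n; last by rewrite /= !inE !negb_or k2 k3.
  rewrite f2; last by rewrite /= inE.
  rewrite f1; last by rewrite /= !inE negb_or k1.
  by apply: funext => i; rewrite /= (negbTE k0).
- by move=> k; rewrite frame_r.
Qed.

(** No soundness is asked here, since [p_check] supplies it. The counter value [c] must not depend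
    on the store. *)
Definition branch_spec (p : prog) (N : nat) : Prop :=
  [/\ 0 < N <= 2 ^ n,
      forall c h, start c h -> na (run p env0 h) aNN 0 = N &
      (exists2 C : {set 'I_n}, vertex_cover (edge I) C &
         (total_weight C <= budget I)%R) ->
      exists2 c, c < N & forall h, start c h -> solved (run p env0 h)].

Lemma body_searches N :
  branch_spec (if small_degree then p_cubic else p_general) N -> searches body I N.
Proof.
set p := if _ then _ else _; case=> N2 hN hsol.
have cC : aC \notin wn p by rewrite /p; case: small_degree.
have resE c : body_result body I c = run p_check env0 (run p env0 (run prelude env0 (counter_store R c))).
  rewrite /body_result /body -/prelude 2!run_PSeq.
  have [_ e] := prelude_start c.
  by rewrite -[LHS]/(run p_check env0 (if na (run prelude env0 (counter_store R c)) aD3 0 == 0 then _ else _)) e /p; case: small_degree.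
have st c : start c (run prelude env0 (counter_store R c)) by case: (prelude_start c).
have fE c : found body I c = solved (run p env0 (run prelude env0 (counter_store R c))).
  rewrite /found resE.
  have [_ _ -> _] := run_check env0 (run p env0 (run prelude env0 (counter_store R c))).
  by case: solved.
have cE c : candidate body I c = cover_of (run p env0 (run prelude env0 (counter_store R c))).
  apply/setP => v; rewrite !inE resE.
  by have [_ -> _ _] := run_check env0 (run p env0 (run prelude env0 (counter_store R c))).
have aCE c : na (run p env0 (run prelude env0 (counter_store R c))) aC 0 = c.
  by rewrite frame_n //; case: (st c).
split=> //.
- move=> c hc; rewrite fE resE.
  have [-> _ _ ->] := run_check env0 (run p env0 (run prelude env0 (counter_store R c))).
  by rewrite aCE (hN c).
- by move=> c hc; rewrite fE cE => /andP[/coversP].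
- by case/hsol=> c hc hs; exists c => //; rewrite fE; apply: hs.
Qed.

End Reading.

(** * Maximal independent sets of the given cover *)

(** The recursion for [leaves] needs all earlier values; written as the table after [k] rounds it is
    structural and mirrors the loop of [p_leaves]. *)
Fixpoint leaf_table (k : nat) : nat -> nat :=
  if k is k'.+1 then
    fun i => if i == k'.+1 then \max_(m < k'.+1) (m.+1 * leaf_table k' (k' - m))
             else leaf_table k' i
  else fun i => i == 0.

(* [leaves k] bounds the number of leaves of the branching on [k] vertices. *)
Definition leaves (k : nat) : nat := leaf_table k k.

Lemma leaf_tableE k i : i <= k -> leaf_table k i = leaves i.
Proof.
elim: k => [|k IH]; first by case: i.
rewrite leq_eqVlt => /orP[/eqP -> //|hi]; rewrite /= ltn_eqF // IH //.
Qed.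

Lemma leaf_table_high k i : k < i -> leaf_table k i = 0.
Proof.
elim: k => [|k IH] hi /=; first by case: i hi.
by rewrite gtn_eqF // IH // ltnW.
Qed.

Lemma leavesS k : leaves k.+1 = \max_(m < k.+1) (m.+1 * leaves (k - m)).
Proof.
rewrite /leaves /= eqxx; apply: eq_bigr => m _.
by rewrite leaf_tableE // leq_subr.
Qed.

Lemma leaves_branch k m : m <= k -> m.+1 * leaves (k - m) <= leaves k.+1.
Proof.
move=> hm; rewrite leavesS.
exact: (@leq_bigmax _ (fun m : 'I_k.+1 => m.+1 * leaves (k - m)) (Ordinal (hm : m < k.+1))).
Qed.

Lemma leaves_leS k : leaves k <= leaves k.+1.
Proof. by have := @leaves_branch k 0 isT; rewrite mul1n subn0. Qed.

Lemma leaves_mono j k : j <= k -> leaves j <= leaves k.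
Proof.
move=> /subnK <-; elim: (k - j) => //= d IH; exact: leq_trans IH (leaves_leS _).
Qed.

Lemma leaves_gt0 k : 0 < leaves k.
Proof. exact: leq_trans (leaves_mono (leq0n k)). Qed.

(** This is $k^{1/k} \le 3^{1/3}$ for integers, with equality at $k = 3$: branching on triangles is
    the worst case. Small cases are computed, and then $(k+1)^3 \le 3k^3$ for $k \ge 3$. *)
Lemma cube_le_exp m : m.+1 ^ 3 <= 3 ^ m.+1.
Proof.
elim: m => [|[|[|m]] IH] //.
apply: leq_trans (_ : 3 * m.+3 ^ 3 <= _); last by rewrite [X in _ <= X]expnS leq_mul2l.
by rewrite !expnS !expn0; nia.
Qed.

(** Cubing avoids the third root in $3^{k/3}$; the factor for [m + 1] children is paid by the
    [m + 1] vertices that each of them loses. *)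
Lemma leaves_cube k : leaves k ^ 3 <= 3 ^ k.
Proof.
elim/ltn_ind: k => [[|k] IH] //.
pose f := fun m : 'I_k.+1 => m.+1 * leaves (k - m); rewrite leavesS -/f.
have [|m ->] := @bigop.eq_bigmax _ f; first by rewrite card_ord.
rewrite /f expnMn; have hm : m <= k by rewrite -ltnS.
apply: (@leq_trans (3 ^ m.+1 * 3 ^ (k - m))).
  by apply: leq_mul; [exact: cube_le_exp | apply: IH; rewrite ltnS leq_subr].
by rewrite -expnD leq_exp2l //; lia.
Qed.

Lemma leaves_le2 k : leaves k <= 2 ^ k.
Proof.
rewrite -(@leq_exp2r _ _ 3) //; apply: leq_trans (leaves_cube k) _.
by rewrite -expnM mulnC expnM; case: k => [|k] //; rewrite leq_exp2r.
Qed.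

Lemma iteriSr (T : Type) m (g : nat -> T -> T) x :
  iteri m.+1 g x = iteri m (fun i => g i.+1) (g 0 x).
Proof. by elim: m => [|m IH] //; rewrite -[LHS]/(g m.+1 (iteri m.+1 g x)) IH. Qed.

(** * Choice of a vertex of minimum degree *)

Section MinDegree.
Variables (R : realType) (n : nat) (inn : nat -> nat) (inr : nat -> R).
Local Notation run := (run n inn inr).

Definition alive_is (h : store R) (A : {set 'I_n}) : Prop :=
  forall v : 'I_n, na h aAL v = (v \in A).
Definition graph_is (h : store R) (s : rel 'I_n) : Prop :=
  forall u v : 'I_n, na h aS (n * u + v) = s u v.

Definition deg_in (s : rel 'I_n) (A : {set 'I_n}) (v : 'I_n) : nat :=
  #|[set u in A | s v u]|.

Lemma b2n_gt0 (b : bool) : (0 < b) = b. Proof. by case: b. Qed.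

Definition minsel (al : nat -> bool) (dg : nat -> nat) (t : nat) : nat * nat :=
  iteri t (fun i p => if al i && (dg i <= p.2) then (i.+1, dg i) else p) (0, n).

Lemma minselP (al : nat -> bool) (dg : nat -> nat) t : (forall i, i < t -> dg i <= n) ->
  (forall i, i < t -> al i -> (minsel al dg t).2 <= dg i) /\
  ((minsel al dg t) = (0, n) /\ (forall i, i < t -> ~~ al i) \/
   exists2 i, i < t /\ al i & minsel al dg t = (i.+1, dg i)).
Proof.
elim: t => [|t IH] hd; first by split=> //; left.
have [|h1 h2] := IH; first by move=> i hi; apply: hd; apply: ltnW.
rewrite /minsel /= -/(minsel al dg t); case: ifP => [/andP[at_ le]|no].
  split; last by right; exists t.
  move=> i; rewrite ltnS leq_eqVlt => /orP[/eqP ->//|lt] ai /=.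
  exact: leq_trans le (h1 i lt ai).
split.
  move=> i; rewrite ltnS leq_eqVlt => /orP[/eqP ->|lt] ai; last exact: h1.
  by apply: ltnW; move: no; rewrite ai /= leqNgt => /negbFE.
case: h2 => [[e h2]|[i [hi ai] e]]; last by right; exists i => //; rewrite ltnW.
left; split=> // i; rewrite ltnS leq_eqVlt => /orP[/eqP ->|lt]; last exact: h2.
by move: no; rewrite e /= hd // andbT => ->.
Qed.

(* The selected vertex depends on the alive set and the graph only. *)
Lemma mindegP (A : {set 'I_n}) (s : rel 'I_n) : exists mv md,
  (A = set0 /\ mv = 0 \/
   exists2 v, v \in A /\ (forall u, u \in A -> deg_in s A v <= deg_in s A u) &
     mv = v.+1 /\ md = deg_in s A v) /\
  forall env h, alive_is h A -> graph_is h s ->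
    na (run p_mindeg env h) aMV 0 = mv /\ na (run p_mindeg env h) aMD 0 = md.
Proof.
pose al i := if insub i is Some v then v \in A else false.
pose dg i := if insub i is Some v then deg_in s A v else 0.
have alE (v : 'I_n) : al v = (v \in A) by rewrite /al valK.
have dgE (v : 'I_n) : dg v = deg_in s A v by rewrite /dg valK.
exists (minsel al dg n).1, (minsel al dg n).2; split.
  have [|h1 h2] := @minselP al dg n.
    move=> i hi; rewrite -[i]/(val (Ordinal hi)) dgE.
    by apply: leq_trans (max_card _) _; rewrite card_ord.
  case: h2 => [[-> h2]|[i [hi ai] e]].
    left; split=> //; apply/setP => v; rewrite inE -alE.
    by apply/negbTE; apply: h2.
  right; exists (Ordinal hi); last by rewrite e -dgE.
  rewrite -alE; split=> // u uA; rewrite -!dgE.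
  by have := h1 u (ltn_ord u); rewrite e alE /=; apply.
move=> env h hA hs; rewrite /p_mindeg 2!run_PSeq.
set h1 := run (PFor 10 IN _) env h.
have [e1 d1] : (forall k, k \notin [:: aDD; aDG] -> na h1 k = na h k) /\
    forall v : 'I_n, na h1 aDG v = dg v.
  suff [H1 H] : (forall k, k \notin [:: aDD; aDG] -> na h1 k = na h k) /\
     forall v : 'I_n, v < n -> na h1 aDG v = dg v by split=> // v; apply: H.
  rewrite /h1 run_PFor.
  apply: (@iteri_inv _ (fun t g => (forall k, k \notin [:: aDD; aDG] -> na g k = na h k) /\
    forall v : 'I_n, v < t -> na g aDG v = dg v)) => // t g ht [g1 g2].
  rewrite run_PSeq.
  have [i g' hi [a1 a2]|[b1 b2] b3] := @run_count R n inn inr 11 IN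
     (BConj (x_alive (IV 11)) (x_edge (IV 10) (IV 11))) (upd env 10 t) g
     (fun j => (0 < na h aAL j) && (0 < na h aS (n * t + j))).
    by rewrite /= !a1 // !g1.
  set g' := run (p_count _ _ _) _ g in b1 b2 b3 *.
  split=> [k|v].
    rewrite !inE !negb_or => /andP[k1 k2].
    by rewrite na_setn (negbTE k2) b1 // g1 // !inE negb_or k1.
  rewrite na_setn /= updE b3; have -> : upd env 10 t 10 = t by [].
  rewrite ltnS leq_eqVlt; case: eqP => [ev _|_ /= lt].
    rewrite dgE /deg_in -sum1_card [RHS]big_mkcond; apply: eq_bigr => u _.
    by rewrite hA -ev hs !b2n_gt0 inE; case: (_ && _).
  by rewrite b1 // g2.
clearbody h1; set h2 := run (setS aMV 0 ;; setS aMD IN) env h1.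
have [f1 f2 f3] : [/\ forall k, k \notin [:: aMV; aMD] -> na h2 k = na h1 k,
    na h2 aMV 0 = 0 & na h2 aMD 0 = n].
  split=> //; by move=> k hk; rewrite /h2 [LHS]frame_n.
clearbody h2; rewrite run_PFor.
suff [_ [-> ->]] : let g := iteri (ieval n env IN) (fun i =>
    run (when (BConj (x_alive (IV 10)) (BN (XRd aDG (IV 10)) (sc aMD)))
    (setS aMD (XRd aDG (IV 10)) ;; setS aMV (IAdd (IV 10) 1))) (upd env 10 i)) h2 in
  (forall k, k \notin [:: aMV; aMD] -> na g k = na h1 k) /\
  na g aMV 0 = (minsel al dg n).1 /\ na g aMD 0 = (minsel al dg n).2 by [].
apply: (@iteri_inv _ (fun t g => (forall k, k \notin [:: aMV; aMD] -> na g k = na h1 k) /\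
  na g aMV 0 = (minsel al dg t).1 /\ na g aMD 0 = (minsel al dg t).2)).
  by split.
move=> t g ht [g1 [g2 g3]]; rewrite run_when /minsel /= -/(minsel al dg t).
rewrite !updE /= ![na g aAL]g1 // ![na g aDG]g1 // ![na h1 aAL]e1 // g3 -[t]/(val (Ordinal ht)) !d1 hA b2n_gt0 alE /=.
case: ifP => _ //=; split=> [k|].
  rewrite !inE !negb_or => /andP[k1 k2].
  by rewrite (negbTE k1) (negbTE k2) g1 // !inE negb_or k1.
by rewrite !updE /= addn1.
Qed.

End MinDegree.

(** * Decoding a maximal independent set *)

Section Mis.
Variables (R : realType) (I : instance R).
Hypothesis valid : valid_instance I.
Local Notation n := (Defs.order I).
Local Notation inn := (inn_of I).
Local Notation inr := (inr_of I).
Local Notation U := (mincover I).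
Local Notation run := (run n inn inr).
Local Notation s := (edge I).

Lemma run_p_leaves env (h : store R) : na h aL = (fun _ => 0) ->
  na (run p_leaves env h) aNN 0 = leaf_table n (na h aT 0) /\
  forall k, na (run p_leaves env h) aL k = leaf_table n k.
Proof.
move=> hL; rewrite /p_leaves 2!run_PSeq.
set h0 := run (PN aL 0 1) env h.
have [L0 T0] : (forall k, na h0 aL k = leaf_table 0 k) /\ na h0 aT = na h aT.
  by split=> // k; rewrite /h0 /= updE hL; case: k.
clearbody h0; set h1 := run (PFor 10 IN _) env h0.
have T1 : na h1 aT = na h0 aT by rewrite /h1 [LHS]frame_n.
suff L1 : forall k, na h1 aL k = leaf_table n k.
  split; last by move=> k; rewrite -L1 [LHS]/(na (setn h1 aNN 0 _) aL k).
  by rewrite /= updE /= L1 T1 T0.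
rewrite /h1 run_PFor.
apply: (@iteri_inv _ (fun t g => forall k, na g aL k = leaf_table t k)) => // t g ht hg.
rewrite run_PFor; have -> : ieval n (upd env 10 t) (IAdd (IV 10) 1) = t.+1.
  by rewrite /= updE addn1.
move=> k; rewrite -[RHS]/(if k == t.+1 then \max_(m < t.+1) (m.+1 * leaf_table t (t - m)) else leaf_table t k).
move: k; apply: (@iteri_inv _ (fun r g' => forall k, na g' aL k =
   if k == t.+1 then \max_(m < r) (m.+1 * leaf_table t (t - m)) else leaf_table t k)).
  move=> k; rewrite big_ord0 hg; case: eqP => // ->.
  by rewrite leaf_table_high.
move=> r g' hr hg' k; rewrite run_when big_ord_recr /=.
have e1 : na g' aL (t + 1) = \max_(m < r) (m.+1 * leaf_table t (t - m)).
  by rewrite hg' addn1 eqxx.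
have e2 : na g' aL (t - r) = leaf_table t (t - r).
  by rewrite hg' ltn_eqF // ltnS leq_subr.
rewrite !updE /= e1 e2 !addn1.
case: ltnP => hlt; rewrite /= ?updE ?e2 ?addn1 hg'; case: eqP => // _.
Qed.

Definition closed_nbr (A : {set 'I_n}) (v : 'I_n) : {set 'I_n} :=
  [set u in A | (u == v) || s v u].

Lemma irr v : s v v = false. Proof. by case: valid => [[_ h] _ _ _]; apply: h. Qed.
Lemma sym u v : s u v = s v u. Proof. by case: valid => [[h _] _ _ _]; apply: h. Qed.

Lemma card_closed_nbr (A : {set 'I_n}) (v : 'I_n) : v \in A -> #|closed_nbr A v| = (deg_in s A v).+1.
Proof.
move=> vA; have -> : closed_nbr A v = v |: [set u in A | s v u].
  by apply/setP => u; rewrite !inE; case: eqP => [->|]; rewrite ?vA //.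
by rewrite cardsU1 inE irr andbF.
Qed.

Definition rank_in (B : {set 'I_n}) (t : nat) : nat := #|[set x in B | x < t]|.

Lemma rank_inS (B : {set 'I_n}) (x : 'I_n) : rank_in B x.+1 = rank_in B x + (x \in B).
Proof.
rewrite /rank_in; case: (boolP (x \in B)) => xB.
  have -> : [set y in B | y < x.+1] = x |: [set y in B | y < x].
    by apply/setP => y; rewrite !inE ltnS leq_eqVlt -val_eqE; case: eqP => [e|]; rewrite ?andbF //= (val_inj e) xB.
  by rewrite cardsU1 inE ltnn andbF addnC.
rewrite addn0; apply: eq_card => y; rewrite !inE ltnS leq_eqVlt.
case: eqP => //= e; have -> : y = x by apply: val_inj.
by rewrite (negbTE xB).
Qed.

Lemma rank_in_lt (B : {set 'I_n}) (x : 'I_n) : x \in B -> rank_in B x < #|B|.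
Proof.
move=> xB; apply: leq_trans (_ : rank_in B x.+1 <= _).
  by rewrite rank_inS xB addn1.
by apply: subset_leq_card; apply/subsetP => y; rewrite inE => /andP[].
Qed.

Definition mis_state (h : store R) (A M : {set 'I_n}) (r : nat) : Prop :=
  [/\ alive_is h A, graph_is h s, forall v : 'I_n, na h aIM v = (v \in M),
      na h aR 0 = r & forall k, na h aL k = leaf_table n k].

Lemma x_aliveE env (h : store R) (A : {set 'I_n}) (v : 'I_n) e : alive_is h A -> ieval n env e = v ->
  bxeval n inn inr env h (x_alive e) = (v \in A).
Proof. by move=> hA he; rewrite /= he hA b2n_gt0. Qed.

Lemma x_edgeE env (h : store R) (u v : 'I_n) e f : graph_is h s ->
  xeval n inn env h e = u -> ieval n env f = v ->
  bxeval n inn inr env h (x_edge e f) = s u v.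
Proof. by move=> hs he hf; rewrite /= he hf hs b2n_gt0. Qed.

(* The child with index [r %/ l] of the chosen vertex [v] is selected. *)
Lemma run_p_pick env (h : store R) (A : {set 'I_n}) (v x : 'I_n) r l r' :
  alive_is h A -> graph_is h s -> na h aMV 0 = v.+1 -> na h aLL 0 = l ->
  na h aR 0 = r -> v \in A -> x \in closed_nbr A v ->
  r = rank_in (closed_nbr A v) x * l + r' -> r' < l ->
  let h' := run p_pick env h in
  [/\ forall k, k \notin [:: aSEL; aR] -> na h' k = na h k,
      na h' aSEL 0 = x.+1 & na h' aR 0 = r'].
Proof.
move=> hA hs hMV hLL hR vA xB er lr h'; rewrite /h' /p_pick run_PSeq run_PFor.
set B := closed_nbr A v in xB er *.
set h0 := run (setS aSEL 0) env h.
(* Before [x] is reached, one block of length [l] has gone for each member of [B] passed; once [x]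
   is selected nothing changes. *)
pose P t (g : store R) := [/\ forall k, k \notin [:: aSEL; aR] -> na g k = na h k,
      na g aSEL 0 = (if x < t then x.+1 else 0) &
      na g aR 0 = if x < t then r' else r - rank_in B t * l].
suff: P n (iteri n (fun i => run (when (BConj (BE (sc aSEL) 0) (BConj (x_alive (IV 10))
      (bor (BE (IAdd (IV 10) 1) (sc aMV)) (x_edge (XSub (sc aMV) 1) (IV 10)))))
    (PIf (BN (sc aLL) (sc aR)) (setS aR (XSub (sc aR) (sc aLL)))
      (setS aSEL (IAdd (IV 10) 1)))) (upd env 10 i)) h0).
  by rewrite /P ltn_ord.
apply: iteri_inv => [|t g ht [g1 g2 g3]]; rewrite {}/P.
  have -> : rank_in B 0 = 0 by apply: eq_card0 => y; rewrite inE ltn0 andbF.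
  split; [move=> k | by rewrite ltn0 | by rewrite ltn0 mul0n subn0]; rewrite !inE negb_or => /andP[k1 k2].
  by rewrite /= (negbTE k1).
pose tt := Ordinal ht; have et : t = tt by [].
have gA : alive_is g A by move=> w; rewrite g1.
have gs : graph_is g s by move=> w w'; rewrite g1.
rewrite run_when.
have -> : bxeval n inn inr (upd env 10 t) g (BConj (BE (sc aSEL) 0) (BConj (x_alive (IV 10))
      (bor (BE (IAdd (IV 10) 1) (sc aMV)) (x_edge (XSub (sc aMV) 1) (IV 10)))))
  = (t <= x) && (tt \in B).
  rewrite -[LHS]/((na g aSEL 0 == 0) && (bxeval n inn inr (upd env 10 t) g (x_alive (IV 10)) &&
    ~~ (~~ (t + 1 == na g aMV 0) && ~~ bxeval n inn inr (upd env 10 t) g (x_edge (XSub (sc aMV) 1) (IV 10))))).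
  rewrite (@x_aliveE _ _ A tt) // (@x_edgeE _ _ v tt) //; last by rewrite /= g1 // hMV subn1.
  rewrite [na g aMV]g1 // hMV addn1 eqSS g2 inE -negb_or negbK.
  by case: ltnP => //=; rewrite -val_eqE.
have rS : rank_in B t.+1 = rank_in B t + (tt \in B) by rewrite et rank_inS.
rewrite ltnS; case: (ltngtP x t) => [lt|gt|ext] /=.
- by split=> //; rewrite ?g2 ?g3 lt.
- have x1 : (x < t) = false by apply/negbTE; rewrite -leqNgt ltnW.
  rewrite x1 in g2 g3.
  have [tB|tB] := boolP (tt \in B); last by split=> //; rewrite ?g2 ?g3 // rS (negbTE tB) addn0.
  rewrite tB addn1 in rS.
  have le : rank_in B t.+1 <= rank_in B x.
    by apply: subset_leq_card; apply/subsetP => y; rewrite !inE => /andP[-> lt] /=; apply: leq_trans lt gt.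
  have hm : rank_in B t * l + l <= r.
    by rewrite addnC -mulSn -rS er; apply: leq_trans (leq_addr _ _); rewrite leq_mul2r le orbT.
  have -> : na g aLL 0 <= na g aR 0 by rewrite g3 g1 // hLL; lia.
  split=> [k||] /=.
  + by rewrite !inE negb_or => /andP[k1 k2]; rewrite (negbTE k2) g1 // !inE negb_or k1.
  + by rewrite g2.
  + by rewrite updE /= g3 g1 // hLL rS mulSn; lia.
- have tB : tt \in B by rewrite (_ : tt = x) //; apply: val_inj.
  rewrite ext ltnn in g2 g3; rewrite tB.
  have -> : (na g aLL 0 <= na g aR 0) = false.
    by rewrite g3 g1 // hLL er -ext; lia.
  split=> [k||] /=.
  + by rewrite !inE negb_or => /andP[k1 k2]; rewrite (negbTE k1) g1 // !inE negb_or k1.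
  + by rewrite updE /= addn1 ext.
  + by rewrite g3 er -ext; lia.
Qed.

Lemma run_p_pick0 env (h : store R) : alive_is h (set0 : {set 'I_n}) ->
  let h' := run p_pick env h in
  (forall k, k != aSEL -> na h' k = na h k) /\ na h' aSEL 0 = 0.
Proof.
move=> hA h'; rewrite /h' /p_pick run_PSeq run_PFor.
apply: (@iteri_inv _ (fun _ g => (forall k, k != aSEL -> na g k = na h k) /\ na g aSEL 0 = 0)).
  by split=> // k hk; rewrite /= (negbTE hk).
move=> t g ht [g1 g2]; rewrite run_when.
set c := bxeval _ _ _ _ _ _; suff -> : c = false by split.
rewrite /c -[bxeval _ _ _ _ _ _]/((na g aSEL 0 == 0) && (bxeval n inn inr (upd env 10 t) g (x_alive (IV 10)) && _)).
rewrite (@x_aliveE _ _ set0 (Ordinal ht)) ?inE ?andbF //.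
by move=> w; rewrite g1.
Qed.

Lemma run_p_take env (h : store R) (A M : {set 'I_n}) (x : 'I_n) :
  alive_is h A -> graph_is h s -> (forall v : 'I_n, na h aIM v = (v \in M)) ->
  na h aSEL 0 = x.+1 ->
  let h' := run p_take env h in
  [/\ forall k, k \notin [:: aIM; aAL] -> na h' k = na h k,
      alive_is h' (A :\: closed_nbr A x) & forall v : 'I_n, na h' aIM v = (v \in x |: M)].
Proof.
move=> hA hs hM hSEL h'; rewrite /h' /p_take.
rewrite (@run_at_index _ _ _ _ _ _ _ _ _ x.+1) //; last first.
  by move=> i j; rewrite -hSEL -[LHS]/(na (run _ _ _) aSEL 0) frame_n.
have -> : 0 < x.+1 <= n by exact: ltn_ord.
rewrite -[x.+1.-1]/(nat_of_ord x) run_PSeq run_PFor.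
set h0 := run (PN aIM _ _) _ h.
have iE : upd env 10 x 10 = x by [].
suff: let g := iteri (ieval n (upd env 10 x) IN) (fun i => run (when (bor (BE (IV 10) (IV 11)) (x_edge (IV 10) (IV 11))) (PN aAL (IV 11) 0)) (upd (upd env 10 x) 11 i)) h0 in
   agree aAL g h0 /\ forall v : 'I_n, na g aAL v = if v < n then (v \in A :\: closed_nbr A x) else (v \in A).
  move=> [[a1 a2] a3]; split.
  - by move=> k; rewrite !inE negb_or => /andP[k1 k2]; rewrite a1 // /h0 /= (negbTE k1).
  - by move=> v; rewrite a3 ltn_ord.
  - move=> v; rewrite a1 // /h0 /= updE iE hM !inE val_eqE.
    by case: eqP.
apply: (@iteri_inv _ (fun t g => agree aAL g h0 /\ forall v : 'I_n, na g aAL v = if v < t then (v \in A :\: closed_nbr A x) else (v \in A))).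
  by split=> // v; rewrite -hA.
move=> t g ht [[a1 a2] a3]; rewrite run_when.
pose tt := Ordinal ht.
have -> : bxeval n inn inr (upd (upd env 10 x) 11 t) g (bor (BE (IV 10) (IV 11)) (x_edge (IV 10) (IV 11)))
   = (tt == x) || s x tt.
  rewrite -[LHS]/(~~ (~~ (x == t :> nat) && ~~ bxeval n inn inr (upd (upd env 10 x) 11 t) g (x_edge (IV 10) (IV 11)))).
  rewrite -negb_or negbK (@x_edgeE _ _ x tt) //; first by rewrite eq_sym.
  by move=> u v; rewrite a1 // /h0 -hs.
have tE (v : 'I_n) : (v == t :> nat) = (v == tt) by rewrite -val_eqE.
case: ifP => c; split.
- exact: agree_setn.
- move=> v; rewrite /= updE /= tE ltnS leq_eqVlt tE; case: eqP => [->|_] /=; last exact: a3.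
  by rewrite !inE c andbT; case: (tt \in A).
- by split.
- move=> v; rewrite a3 [v < t.+1]ltnS [v <= t]leq_eqVlt tE; case: eqP => [->|_] //=.
  by rewrite ltnn !inE c andbF.
Qed.

Definition maximal_in (A M : {set 'I_n}) : Prop :=
  [/\ M \subset A, forall u v, u \in M -> v \in M -> ~~ s u v &
      forall v, v \in A -> v \in M \/ exists2 u, u \in M & s v u].

(** The loop has a fixed number of rounds; those left over when no vertex is alive must be idle. *)
Lemma mis_step0 env h M r : mis_state h set0 M r -> mis_state (run p_mis_step env h) set0 M r.
Proof.
move=> [hA hs hM hR hL].
have [mv [md [hmv hrun]]] := @mindegP R n inn inr set0 s.
have [e1 e2] := hrun env h hA hs.
have mv0 : mv = 0 by case: hmv => [[]|[v]] //; rewrite inE => [[]].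
rewrite /p_mis_step 3!run_PSeq.
set h1 := run p_mindeg env h in e1 e2 *.
have f1 k : k \notin wn p_mindeg -> na h1 k = na h k by move=> hk; rewrite /h1 [LHS]frame_n.
clearbody h1; set h2 := run (_ ;; _) env h1.
have f2 k : k \notin [:: aDD; aDD; aLL] -> na h2 k = na h1 k by move=> hk; rewrite /h2 [LHS]frame_n.
clearbody h2.
have A2 : alive_is h2 (set0 : {set 'I_n}) by move=> v; rewrite f2 // f1.
have [f3 s3] := run_p_pick0 env A2.
set h3 := run p_pick env h2 in f3 s3 *; clearbody h3.
have -> : run p_take env h3 = h3.
  rewrite /p_take (@run_at_index _ _ _ _ _ _ _ _ _ 0) //.
  by move=> i j; rewrite -s3 -[LHS]/(na (run _ _ _) aSEL 0) frame_n.
split.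
- by move=> v; rewrite f3 // A2.
- by move=> u v; rewrite f3 // f2 // f1.
- by move=> v; rewrite f3 // f2 // f1.
- by rewrite f3 // f2 // f1.
- by move=> k; rewrite f3 // f2 // f1.
Qed.

(** By maximality, [M] meets the closed neighbourhood of the chosen vertex [v] in some [x], and
    [M :\ x] is maximal in what is left after removing the closed neighbourhood of [x]. That
    neighbourhood is at least as large as the one of [v], whose degree is minimum, so the values of
    the child fit into its block. *)
Lemma mis_complete j : forall A M : {set 'I_n}, #|A| <= j -> maximal_in A M ->
  exists2 r, r < leaves #|A| & forall h (E : nat -> nat -> nat) M0,
    mis_state h A M0 r ->
    forall v : 'I_n, na (iteri j (fun i => run p_mis_step (E i)) h) aIM v = (v \in M0 :|: M).
Proof.
elim: j => [|j IH] A M hj hM.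
  have A0 : A = set0 by apply/eqP; rewrite -cards_eq0 -leqn0.
  exists 0; first exact: leaves_gt0.
  move=> h E M0 [_ _ hIM _ _] v /=.
  have -> : M = set0 by apply/eqP; rewrite -subset0 -A0; case: hM.
  by rewrite setU0.
have [mv [md [hmv hrun]]] := @mindegP R n inn inr A s.
case: hmv => [[A0 mv0]|[v [vA vmin] [mvE mdE]]].
  have M0 : M = set0 by apply/eqP; rewrite -subset0 -A0; case: hM.
  exists 0; first exact: leaves_gt0.
  rewrite M0 A0 => h E M1 hst w; rewrite setU0.
  suff: mis_state (iteri j.+1 (fun i => run p_mis_step (E i)) h) set0 M1 0 by case.
  apply: (@iteri_inv _ (fun _ g => mis_state g set0 M1 0)) => // i y _.
  exact: mis_step0.
have [x xB xM] : exists2 x, x \in closed_nbr A v & x \in M.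
  have [MA _ mx] := hM; case: (mx v vA) => [vM|[u uM vu]].
    by exists v => //; rewrite inE vA eqxx.
  by exists u => //; rewrite inE (subsetP MA) // vu orbT.
have xA : x \in A by move: xB; rewrite inE => /andP[].
set A' := A :\: closed_nbr A x; set M' := M :\ x.
have cardA' : #|A'| + (deg_in s A v).+1 <= #|A|.
  have sub : closed_nbr A x \subset A by apply/subsetP => y; rewrite inE => /andP[].
  have := cardsID (closed_nbr A x) A; rewrite (setIidPr sub) card_closed_nbr // -/A'.
  by have := vmin x xA; lia.
have maxM' : maximal_in A' M'.
  have [MA ind mx] := hM; split.
  - apply/subsetP => y; rewrite !inE => /andP[yx yM]; rewrite (subsetP MA) // andbT /=.
    by rewrite negb_or yx ind.
  - by move=> u w; rewrite !inE => /andP[_ uM] /andP[_ wM]; apply: ind.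
  - move=> w; rewrite !inE => /andP[]; case: (boolP (w \in A)) => //= wA.
    rewrite negb_or => /andP[wx xw] _.
    case: (mx w wA) => [wM|[u uM wu]]; first by left; rewrite wx.
    right; exists u => //; rewrite !inE uM andbT; apply/eqP => ux.
    by move: xw; rewrite sym -ux wu.
have [|r' lr' hr'] := IH A' M' _ maxM'; first by lia.
set m := (deg_in s A v).+1 in cardA'.
set l := leaves (#|A| - m).
have lr'l : r' < l by apply: leq_trans lr' _; apply: leaves_mono; lia.
have cB : #|closed_nbr A v| = m by rewrite card_closed_nbr.
(* The digit is the position of [x] among the children, the remainder is the value for the child. *)
exists (rank_in (closed_nbr A v) x * l + r').
  have rk := rank_in_lt xB; rewrite cB in rk.
  apply: (@leq_trans (m * l)).
    apply: (@leq_trans ((rank_in (closed_nbr A v) x).+1 * l)); first by rewrite mulSn; lia.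
    by rewrite leq_mul2r rk orbT.
  have m0 : 0 < m by [].
  have hb : m - 1 <= #|A| - 1 by lia.
  have := leaves_branch hb.
  have -> : #|A| - 1 - (m - 1) = #|A| - m by lia.
  by rewrite !subn1 !prednK //; lia.
move=> h E M0 [hA hs hIM hR hL] w; rewrite iteriSr.
suff: mis_state (run p_mis_step (E 0) h) A' (x |: M0) r'.
  move=> /(hr' _ (fun i => E i.+1)) -> .
  rewrite !inE; case: eqP => [->|_] //=; by rewrite xM orbT.
have [e1 e2] := hrun (E 0) h hA hs.
rewrite /p_mis_step 3!run_PSeq.
set h1 := run p_mindeg (E 0) h in e1 e2 *.
have f1 k : k \notin wn p_mindeg -> na h1 k = na h k by move=> hk; rewrite /h1 [LHS]frame_n.
clearbody h1; rewrite run_PSeq.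
have A1 : alive_is h1 A by move=> u; rewrite f1.
have [i g hi [g1 g2]|[b1 b2] b3] := @run_count R n inn inr 10 IN (x_alive (IV 10)) (E 0) h1 (fun i => 0 < na h1 aAL i).
  by rewrite /= g1.
set h2 := run (p_count _ _ _) _ h1 in b1 b2 b3 *.
have cnt : na h2 aDD 0 = #|A|.
  rewrite b3 -sum1_card [RHS]big_mkcond; apply: eq_bigr => u _.
  by rewrite A1; case: (u \in A).
clearbody h2; set h3 := run (setS aLL _) (E 0) h2.
have f3 k : k \notin [:: aLL] -> na h3 k = na h2 k by move=> hk; rewrite /h3 [LHS]frame_n.
have l3 : na h3 aLL 0 = l.
  rewrite /h3 /= [na h2 aL]b1 // cnt [na h2 aMD]b1 // e2 mdE f1 // hL addn1 -/m leaf_tableE //.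
  by apply: leq_trans (leq_subr _ _) _; apply: leq_trans (max_card _) _; rewrite card_ord.
clearbody h3.
have A3 : alive_is h3 A by move=> u; rewrite f3 // b1.
have s3 : graph_is h3 s by move=> u u'; rewrite f3 // b1 // f1.
have [||f4 sel4 r4] := @run_p_pick (E 0) h3 A v x _ l r' A3 s3 _ l3 erefl vA xB _ lr'l.
- by rewrite f3 // b1 // e1.
- by rewrite f3 // b1 // f1.
set h4 := run p_pick (E 0) h3 in f4 sel4 r4 *; clearbody h4.
have A4 : alive_is h4 A by move=> u; rewrite f4.
have s4 : graph_is h4 s by move=> u u'; rewrite f4.
have M4 (u : 'I_n) : na h4 aIM u = (u \in M0) by rewrite f4 // f3 // b1 // f1.
have [f5 A5 M5] := run_p_take (E 0) A4 s4 M4 sel4.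
split=> //.
- by move=> u u'; rewrite f5.
- by rewrite f5.
- by move=> k; rewrite f5 // f4 // f3 // b1 // f1.
Qed.

End Mis.

(** * Minimum weight covers of the bipartite remainder *)

(* Push-relabel without source and sink: the excess of a vertex on the cover
   side starts at its weight, that of a vertex outside at minus its weight, and
   vertices of negative excess, whose label is zero, play the role of the sink.
   [f l r] is the flow from [l] in [M] to [r] outside [U]. *)

Lemma ffun_upd_sum (R : realType) (T : finType) (g : T -> R) (a : T) (x : R) :
  (\sum_i (if i == a then g i + x else g i) = \sum_i g i + x)%R.
Proof.
rewrite (bigD1 a) //= eqxx [in RHS](bigD1 a) //= -addrA [(x + _)%R]addrC addrA.
congr (_ + _ + _)%R; by apply: eq_bigr => i /negbTE ->.
Qed.

Lemma saturating_decrease m A b e D D' : e < m -> D' <= e + D ->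
  m.+1 * (m.+1 * A + b) + D' < m.+1 * (m.+1 * A + b.+1) + D.
Proof. nia. Qed.

Section Flow.
Variables (R : realType) (I : instance R).
Hypothesis valid : valid_instance I.
Local Notation n := (Defs.order I).
Local Notation U := (mincover I).
Local Notation s := (edge I).
Local Notation w := (weight I).
Variable M : {set 'I_n}.
Hypothesis MU : M \subset U.
Hypothesis Mind : forall u v, u \in M -> v \in M -> ~~ s u v.

Definition inH (v : 'I_n) : bool := (v \in M) || (v \notin U).

(** [exc_ge0] confines deficits to label zero; [lab_lr] and [lab_rl] are the validity of the
    labelling, a drop of at most one along forward and backward residual arcs. *)
Record flow_inv (z : 'I_n -> R) (f : 'I_n -> 'I_n -> R) (d : 'I_n -> nat) : Prop := {
  flow_ge0 : forall l r, (0 <= f l r)%R;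
  flow_supp : forall l r, f l r != 0%R -> [/\ l \in M, r \notin U & s l r];
  exc_l : forall l, l \in M -> z l = (w l - \sum_r f l r)%R;
  exc_r : forall r, r \notin U -> z r = (\sum_l f l r - w r)%R;
  exc_l_ge0 : forall l, l \in M -> (0 <= z l)%R;
  exc_ge0 : forall v, inH v -> 0 < d v -> (0 <= z v)%R;
  lab_lr : forall l r, l \in M -> r \notin U -> s l r -> d l <= (d r).+1;
  lab_rl : forall l r, (0 < f l r)%R -> d r <= (d l).+1;
  lab_le : forall v, d v <= n }.

Definition res (f : 'I_n -> 'I_n -> R) (u v : 'I_n) : bool :=
  [&& inH u, inH v, s u v & (u \in U) || (0 < f v u)%R].

Definition active (z : 'I_n -> R) (d : 'I_n -> nat) (u : 'I_n) : bool :=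
  [&& inH u, (0 < z u)%R & d u < n].

Definition back_pairs (f : 'I_n -> 'I_n -> R) (d : 'I_n -> nat) : {set 'I_n * 'I_n} :=
  [set p | (0 < f p.1 p.2)%R && (d p.1 < d p.2)].

(** A lexicographic measure in one number, independent of the size of the reals. A relabelling
    lowers the first sum and creates at most [n] back pairs; a saturating push destroys a back pair
    and may activate one vertex, of label below [n]; any other push deactivates its source and
    activates at most a vertex of label one lower. *)
Definition potential z f d : nat :=
  n.+1 * (n.+1 * (\sum_v (n - d v)) + #|back_pairs f d|) +
  \sum_(v | active z d v) d v.

Lemma inU_H v : inH v -> v \in U -> v \in M.
Proof. by rewrite /inH => /orP[//|/negbTE ->]. Qed.

Lemma U_cover u v : s u v -> (u \in U) || (v \in U).
Proof. by case: valid => _ _ _ [h _]; apply: h. Qed.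

Lemma H_edge_l u v : u \in M -> inH v -> s u v -> v \notin U.
Proof.
move=> uM /orP[vM|//] e; by have := Mind uM vM; rewrite e.
Qed.

Lemma H_edge_r u v : u \notin U -> inH v -> s u v -> v \in M.
Proof.
move=> uU vH e; apply: inU_H => //.
by have := U_cover e; rewrite (negbTE uU).
Qed.

Definition relabel (d : 'I_n -> nat) (u v : 'I_n) : nat :=
  if v == u then (d u).+1 else d v.

Lemma relabel_inv z f d u : flow_inv z f d -> active z d u ->
  (forall v, ~~ (res f u v && (d u == (d v).+1))) ->
  flow_inv z f (relabel d u) /\ potential z f (relabel d u) < potential z f d.
Proof.
move=> inv /and3P[uH zu du] nores.
have lt v : res f u v -> d u != (d v).+1.
  by move=> rv; have := nores v; rewrite rv.
split.
  case: inv => f0 fs el er elp ep llr lrl ll; split=> //.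
  - move=> v vH; rewrite /relabel; case: eqP => [-> _|_]; [exact: ltW | exact: ep].
  - move=> l r lM rU e; rewrite /relabel.
    case: (l =P u) => [lu|_]; case: (r =P u) => [ru|_]; subst => //.
    + by rewrite ltn_neqAle llr // lt // /res uH e /inH rU orbT (subsetP MU).
    + by apply: ltnW; rewrite ltnS; apply: llr.
    + exact: llr.
  - move=> l r fp; rewrite /relabel.
    have [lM rU e] : [/\ l \in M, r \notin U & s l r] by apply: fs; rewrite gt_eqF.
    case: (l =P u) => [lu|_]; case: (r =P u) => [ru|_]; subst => //.
    + by apply: ltnW; rewrite ltnS; apply: lrl.
    + rewrite ltn_neqAle lrl // andbT lt // /res uH /inH lM /= fp orbT andbT.
      by rewrite sym.
    + exact: lrl.
  - by move=> v; rewrite /relabel; case: eqP.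
rewrite /potential.
have s1 : \sum_v (n - d v) = \sum_v (n - relabel d u v) + 1.
  rewrite (bigD1 u) //= [in RHS](bigD1 u) //= /relabel eqxx addnAC.
  congr (_ + _); first by lia.
  by apply: eq_bigr => v /negbTE ->.
(* A higher label of [u] can create back pairs only with [u] as the second component. *)
have s2 : #|back_pairs f (relabel d u)| <= #|back_pairs f d| + n.
  have sub : back_pairs f (relabel d u) \subset back_pairs f d :|: [set (l, u) | l in 'I_n].
    apply/subsetP => -[l r]; rewrite !inE /= /relabel => /andP[fp].
    case: (r =P u) => [->|_] lt'; first by rewrite imset_f ?orbT.
    by rewrite fp /=; move: lt'; case: (l =P u) => [->|_] h; rewrite ?h // ltnW.
  apply: leq_trans (subset_leq_card sub) _.
  apply: leq_trans (leq_card_setU _ _) _; rewrite leq_add2l.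
  by apply: leq_trans (leq_imset_card _ _) _; rewrite card_ord.
have s3 : \sum_(v | active z (relabel d u) v) relabel d u v <= \sum_(v | active z d v) d v + 1.
  have -> : \sum_(v | active z d v) d v = d u + \sum_(v | active z d v && (v != u)) d v.
    by rewrite (bigD1 u) // /active uH zu du.
  have e3 : \sum_(v | active z (relabel d u) v && (v != u)) relabel d u v =
     \sum_(v | active z d v && (v != u)) d v.
    by apply: eq_big => v; rewrite /active /relabel; case: eqP => //=; rewrite ?andbF ?andbT //.
  case: (boolP (active z (relabel d u) u)) => au.
    by rewrite (bigD1 u) //= e3 addnAC leq_add2r /relabel eqxx addn1.
  rewrite -e3 [X in X <= _](bigID (pred1 u)) /= big1 ?add0n; last first.
    by move=> v /andP[av /eqP ev]; move: au; rewrite -{2}ev av.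
  by rewrite addnAC leq_addl.
have n0 : 0 < n by apply: leq_ltn_trans du.
move: s1 s2 s3; set A := \sum_v (n - d v); set A' := \sum_v (n - relabel d u v).
set B := #|_|; set B' := #|_|; set D := \sum_(v | _) _; set D' := \sum_(v | _) _.
move: A A' B B' D D' n n0; clear => A A' B B' D D' m m0 -> hB hD; nia.
Qed.

Definition pushed (z : 'I_n -> R) (f : 'I_n -> 'I_n -> R) (u v : 'I_n) : R :=
  if (u \notin U) && (f v u <= z u)%R then f v u else z u.

Definition push_exc (z : 'I_n -> R) (u v : 'I_n) (a : R) (x : 'I_n) : R :=
  if x == u then (z x - a)%R else if x == v then (z x + a)%R else z x.

Definition push_flow (f : 'I_n -> 'I_n -> R) (u v : 'I_n) (a : R) (l r : 'I_n) : R :=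
  if u \in U then (if (l == u) && (r == v) then f l r + a else f l r)%R
  else (if (l == v) && (r == u) then f l r - a else f l r)%R.

Lemma push_inv z f d u v : flow_inv z f d -> active z d u ->
  res f u v -> d u = (d v).+1 ->
  let a := pushed z f u v in
  flow_inv (push_exc z u v a) (push_flow f u v a) d /\
  potential (push_exc z u v a) (push_flow f u v a) d < potential z f d.
Proof.
move=> inv /and3P[uH zu du] /and4P[_ vH e ruv] duv a.
have [f0 fs el er elp ep llr lrl ll] := inv.
have uv : u != v by apply/eqP => uv; move: e; rewrite uv irr.
have a0 : (0 < a)%R.
  rewrite /a /pushed; case: ifP => // /andP[uU _].
  by move: ruv; rewrite (negbTE uU).
have az : (a <= z u)%R by rewrite /a /pushed; case: ifP => // /andP[].
have [vx zv] : (v \in U) = (u \notin U) /\ (u \in U -> v \notin U).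
  split; last by move=> uU; apply: (H_edge_l (inU_H uH uU)).
  case: (boolP (u \in U)) => uU /=; first by apply/negbTE; apply: (H_edge_l (inU_H uH uU)).
  by apply: (subsetP MU); apply: (H_edge_r uU).
have zge : forall x, inH x -> (0 <= z x)%R -> (0 <= push_exc z u v a x)%R.
  move=> x xH zx; rewrite /push_exc; case: eqP => [->|_]; first by rewrite subr_ge0.
  by case: eqP => // _; apply: addr_ge0 => //; apply: ltW.
have fle : u \notin U -> (a <= f v u)%R.
  move=> uU; rewrite /a /pushed uU /=; case: ifP => // /negbT; rewrite -ltNge => /ltW //.
split; first split=> //.
- move=> l r; rewrite /push_flow; case: ifP => uU; case: ifP => // /andP[/eqP -> /eqP ->].
  + by apply: addr_ge0 => //; apply: ltW.
  + by rewrite subr_ge0 fle // uU.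
- move=> l r; rewrite /push_flow; case: ifP => uU; case: ifP => [|_]; try exact: fs.
  + by move=> /andP[/eqP -> /eqP ->] _; split=> //; [exact: inU_H | exact: zv].
  + move=> /andP[/eqP -> /eqP ->] _; split=> //; rewrite ?uU //; last by rewrite sym.
    by apply: (@H_edge_r u) => //; rewrite uU.
- move=> l lM; have lU := subsetP MU _ lM; rewrite /push_exc /push_flow.
  case: (boolP (u \in U)) => uU.
  + case: (l =P u) => [->|lu] /=.
      rewrite ffun_upd_sum el ?(inU_H uH) //; by rewrite opprD addrA.
    have lv : l == v = false by apply/eqP => lv; move: (zv uU); rewrite -lv lU.
    by rewrite lv el.
  + have lu : l == u = false by apply/eqP => lu; move: uU; rewrite -lu lU.
    rewrite lu; case: (l =P v) => [->|lv] /=; last by rewrite el.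
    have -> : (\sum_r (if r == u then f v r - a else f v r) = \sum_r f v r - a)%R.
      by rewrite -(ffun_upd_sum _ u).
    rewrite el //; last by apply: inU_H => //; rewrite vx.
    by rewrite opprB addrA addrAC.
- move=> r rU; rewrite /push_exc /push_flow.
  case: (boolP (u \in U)) => uU.
  + have ru : r == u = false by apply/eqP => ru; move: rU; rewrite ru uU.
    rewrite ru; case: (r =P v) => [->|rv] /=; last first.
      by rewrite er //; congr (_ - _)%R; apply: eq_bigr => l _; rewrite andbF.
    have -> : (\sum_l (if (l == u) && true then f l v + a else f l v) = \sum_l f l v + a)%R.
      by rewrite -(ffun_upd_sum _ u); apply: eq_bigr => l _; rewrite andbT.
    by rewrite er ?zv // addrAC.
  + have rv : r == v = false by apply/eqP => rv; move: rU; rewrite rv vx uU.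
    case: (r =P u) => [->|ru] /=; last first.
      by rewrite rv er //; congr (_ - _)%R; apply: eq_bigr => l _; rewrite andbF.
    have -> : (\sum_l (if (l == v) && true then f l u - a else f l u) = \sum_l f l u - a)%R.
      by rewrite -(ffun_upd_sum _ v); apply: eq_bigr => l _; rewrite andbT.
    by rewrite er // addrAC.
- by move=> l lM; apply: zge; [rewrite /inH lM | apply: elp].
- by move=> x xH dx; apply: zge => //; apply: ep.
- move=> l r; rewrite /push_flow; case: ifP => uU; case: ifP => [/andP[/eqP -> /eqP ->] _|_]; try exact: lrl.
  + by rewrite duv ltnW.
  + by rewrite duv.
have zle x : x != v -> (push_exc z u v a x <= z x)%R.
  move=> xv; rewrite /push_exc; case: eqP => [->|_]; first by rewrite gerBl ltW.
  by rewrite (negbTE xv).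
have dvn : d v < n by apply: leq_trans du; rewrite duv.
have Dle (P : pred 'I_n) : (forall x, x != v -> active (push_exc z u v a) d x -> P x) ->
  \sum_(x | active (push_exc z u v a) d x) d x <= d v + \sum_(x | P x) d x.
  move=> hP; case: (boolP (active (push_exc z u v a) d v)) => av.
    rewrite (bigD1 v) //= leq_add2l.
    rewrite big_mkcond [X in _ <= X]big_mkcond; apply: leq_sum => x _.
    by case: ifP => // /andP[ax xv]; rewrite hP.
  apply: leq_trans (leq_addl _ _).
  rewrite big_mkcond [X in _ <= X]big_mkcond; apply: leq_sum => x _.
  case: ifP => // ax; rewrite hP //; apply: contraNneq av => xv; move: ax; by rewrite xv.
have act x : x != v -> active (push_exc z u v a) d x -> active z d x.
  move=> xv /and3P[xH px dx]; rewrite /active xH dx andbT /=.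
  exact: lt_le_trans px (zle x xv).
rewrite /potential; set A := \sum_v (n - d v).
case: (boolP ((u \notin U) && (f v u <= z u)%R)) => sat.
(* Saturating: the flow from [v] to [u] drops to zero, so this pair leaves [back_pairs]. *)
- have [uU le] := andP sat.
  have av : a = f v u by rewrite /a /pushed sat.
  have bp : #|back_pairs f d| = #|back_pairs (push_flow f u v a) d|.+1.
    rewrite (cardsD1 (v, u)) inE /= duv ltnSn andbT.
    have -> : (0 < f v u)%R by rewrite -av.
    rewrite add1n; congr S; apply: eq_card => -[l r]; rewrite !inE /= /push_flow (negbTE uU).
    rewrite xpair_eqE; case: eqP => [->|_] /=; last by [].
    by case: eqP => [->|_] //=; rewrite av subrr ltxx.
  have D' := Dle _ act; rewrite bp.
  exact: saturating_decrease dvn D'.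
(* Not saturating: [u] has spent its excess. A forward push puts flow on a pair whose first label is
   the higher one, so the back pairs are unchanged. *)
- have av : a = z u by rewrite /a /pushed (negbTE sat).
  have bp : #|back_pairs (push_flow f u v a) d| = #|back_pairs f d|.
    apply: eq_card => -[l r]; rewrite !inE /= /push_flow; case: (boolP (u \in U)) => uU.
      case: ifP => // /andP[/eqP -> /eqP ->]; by rewrite duv ltnNge leqnSn !andbF.
    case: ifP => // /andP[/eqP -> /eqP ->]; rewrite duv ltnSn !andbT.
    move: sat; rewrite uU /= -ltNge => sat; rewrite av subr_gt0 sat.
    by rewrite (lt_trans zu sat).
  have D' : \sum_(x | active (push_exc z u v a) d x) d x <=
      d v + \sum_(x | active z d x && (x != u)) d x.
    apply: Dle => x xv ax; rewrite act //=; apply: contraTneq ax => ->.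
    by rewrite /active /push_exc eqxx av subrr ltxx andbF.
  rewrite bp ltn_add2l; apply: leq_ltn_trans D' _.
  rewrite [X in _ < X](bigD1 u) ?/active ?uH ?zu ?du //= ltn_add2r.
  by rewrite duv.
Qed.

Lemma total_weight_split (C : {set 'I_n}) : total_weight C =
  (\sum_(v | (v \in U) && (v \notin M) && (v \in C)) w v +
   (\sum_(v | (v \in M) && (v \in C)) w v + \sum_(v | (v \notin U) && (v \in C)) w v))%R.
Proof.
rewrite /total_weight (bigID (mem U)) /= (bigID (mem M)) /=.
rewrite -addrA addrCA; congr (_ + (_ + _))%R; apply: eq_bigl => v.
- by case: (v \in C); case: (v \in U); case: (v \in M).
- by case: (boolP (v \in M)) => [/(subsetP MU) ->|_]; case: (v \in C); rewrite ?andbF.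
- by rewrite andbC.
Qed.

(** * Optimality of the cut at a gap *)

Section Cut.
Variables (z : 'I_n -> R) (f : 'I_n -> 'I_n -> R) (d : 'I_n -> nat) (g : nat).
Hypothesis inv : flow_inv z f d.
Hypothesis done_ : forall v, ~~ active z d v.
Hypothesis gn : g <= n.
Hypothesis gap : forall v, inH v -> d v != g.

Definition cut_set : {set 'I_n} :=
  [set v | [|| (v \in U) && (v \notin M), (v \in M) && (d v < g) | (v \notin U) && (g < d v)]].

(** Only edges between [M] and the complement of [U] matter. If the end in [M] is not chosen, its
    label is above [g], as [g] itself is not taken; the other label is then at least [g], hence
    above it too. *)
Lemma cut_cover : vertex_cover s cut_set.
Proof.
have aux u v : s u v -> u \in U -> (u \in cut_set) || (v \in cut_set).
  move=> e uU; rewrite !inE uU /=; case: (boolP (u \in M)) => uM //=.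
  case: (boolP (v \in U)) => vU /=; rewrite ?orbF.
    case: (boolP (v \in M)) => vM /=; rewrite ?orbT //.
    by have := Mind uM vM; rewrite e.
  have uH : inH u by rewrite /inH uM.
  have vH : inH v by rewrite /inH vU orbT.
  have := lab_lr inv uM vU e; have := gap uH; have := gap vH.
  by rewrite [v \in M](_ : _ = false) /=; [lia | apply: contraNF vU; apply: (subsetP MU)].
move=> u v e; case/orP: (U_cover e) => h; first exact: aux.
by rewrite orbC; apply: aux => //; rewrite sym.
Qed.

(** A preflow need not be a flow: this much arrives outside [U] beyond the weights there. The total
    flow minus this loss is the dual value that separates the two sides of the duality. *)
Definition excess_loss : R := (\sum_(r | r \notin U) Num.max (z r) 0)%R.

(** Weak duality: a pair that carries flow is an edge, so [C] contains one of its ends; a vertex of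
    [M] sends at most its weight, and a vertex outside [U] absorbs at most its weight plus its
    positive excess. *)
Lemma flow_sum_le (C : {set 'I_n}) : vertex_cover s C ->
  (\sum_l \sum_r f l r - excess_loss <=
   \sum_(v | (v \in M) && (v \in C)) w v + \sum_(v | (v \notin U) && (v \in C)) w v)%R.
Proof.
move=> hC; have [f0 fs el er elp ep llr lrl ll] := inv.
have h1 : (\sum_(l | (l \in M) && (l \in C)) \sum_r f l r <= \sum_(v | (v \in M) && (v \in C)) w v)%R.
  apply: ler_sum => l /andP[lM _]; have := elp l lM; rewrite el // subr_ge0; exact.
have h2 : (\sum_(r | (r \notin U) && (r \in C)) \sum_l f l r - excess_loss
    <= \sum_(v | (v \notin U) && (v \in C)) w v)%R.
  rewrite lerBlDr /excess_loss [X in (_ <= _ + X)%R](bigID (mem C)) /= addrA -big_split /=.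
  apply: ler_wpDr; first by apply: sumr_ge0 => r _; rewrite le_max lexx orbT.
  apply: ler_sum => r /andP[rU _].
  have : (z r <= Num.max (z r) 0)%R by rewrite le_max lexx.
  by rewrite {1}er // lerBlDl.
have h3 : (\sum_l \sum_r f l r <= \sum_(l | (l \in M) && (l \in C)) \sum_r f l r +
   \sum_(r | (r \notin U) && (r \in C)) \sum_l f l r)%R.
  rewrite [X in (_ <= X + _)%R]big_mkcond [X in (_ <= _ + X)%R]big_mkcond /=.
  have -> : (\sum_i (if (i \notin U) && (i \in C) then \sum_l f l i else 0) =
     \sum_l \sum_r (if (r \notin U) && (r \in C) then f l r else 0))%R.
    rewrite exchange_big; apply: eq_bigr => r _; case: ifP => // _.
    by rewrite big1.
  rewrite -big_split /=; apply: ler_sum => l _.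
  have -> : ((if (l \in M) && (l \in C) then \sum_r f l r else 0) =
     \sum_r (if (l \in M) && (l \in C) then f l r else 0))%R.
    by case: ifP => // _; rewrite big1.
  rewrite -big_split /=; apply: ler_sum => r _.
  have [->|ne] := eqVneq (f l r) 0%R; first by rewrite !if_same addr0.
  have [lM rU e] := fs l r ne; rewrite lM rU /=.
  have := hC l r e; case: (l \in C) => /=; last by move=> ->; rewrite add0r.
  by move=> _; rewrite lerDl; case: ifP.
apply: le_trans (lerD h1 h2); rewrite addrA; exact: lerB h3 (lexx _).
Qed.

(** Complementary slackness. Below the gap no vertex is active: one in [M] has sent exactly its
    weight, one outside [U] has no loss. Above the gap labels are positive, so a vertex outside [U]
    has no deficit. No flow is counted twice, since it would jump over the gap, against [lab_rl]. *)
Lemma cut_sum_le :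
  (\sum_(v | (v \in M) && (v \in cut_set)) w v + \sum_(v | (v \notin U) && (v \in cut_set)) w v
   <= \sum_l \sum_r f l r - excess_loss)%R.
Proof.
have [f0 fs el er elp ep llr lrl ll] := inv.
have zle v : inH v -> d v < g -> (z v <= 0)%R.
  move=> vH dg; rewrite leNgt; apply: contra (done_ v) => zp.
  by rewrite /active vH zp (leq_trans dg).
have MnU v : v \in M -> (v \notin U) = false by move=> vM; rewrite (subsetP MU).
have h1 : (\sum_(v | (v \in M) && (v \in cut_set)) w v =
    \sum_l \sum_r (if (l \in M) && (d l < g)%N then f l r else 0))%R.
  rewrite big_mkcond; apply: eq_bigr => l _; rewrite inE.
  case: (boolP (l \in M)) => lM /=; last by rewrite big1.
  rewrite MnU //= andbF orbF /=; case: (boolP (d l < g)) => dg; last by rewrite big1.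
  have zl : z l = 0%R by apply/eqP; rewrite eq_le elp // zle // /inH lM.
  by move: (el l lM); rewrite zl => /eqP; rewrite eq_sym subr_eq0 => /eqP.
have h2 : (\sum_(v | (v \notin U) && (v \in cut_set)) w v =
    \sum_l \sum_r (if (r \notin U) && (g < d r)%N then f l r else 0) - excess_loss)%R.
  rewrite exchange_big /= /excess_loss.
  rewrite [X in (_ - X)%R]big_mkcond -sumrB big_mkcond.
  apply: eq_bigr => r _; rewrite inE.
  case: (boolP (r \in U)) => rU /=; first by rewrite big1 ?subr0.
  have rM : r \in M = false by apply: contraNF rU; apply: (subsetP MU).
  have rH : inH r by rewrite /inH rU orbT.
  rewrite rM /=; case: (boolP (g < d r)) => dg.
    have zr : (0 <= z r)%R by apply: ep => //; apply: leq_ltn_trans dg.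
    rewrite (max_idPl zr) er //; by rewrite opprB addrCA subrr addr0.
  have dg' : d r < g by have := gap rH; lia.
  by rewrite (max_idPr (zle r rH dg')) subr0 big1.
rewrite h1 h2 addrA lerB // -big_split /=; apply: ler_sum => l _.
rewrite -big_split /=; apply: ler_sum => r _.
have [->|ne] := eqVneq (f l r) 0%R; first by rewrite !if_same addr0.
have [lM rU e] := fs l r ne; rewrite lM rU /=.
have := lrl l r; rewrite lt0r ne f0 => /(_ isT) drl.
case: ifP => dl; case: ifP => dr; rewrite ?addr0 ?add0r //.
by move: dl dr drl; lia.
Qed.

Lemma cut_optimal (C : {set 'I_n}) : vertex_cover s C ->
  (forall v, v \in U -> v \notin M -> v \in C) ->
  (total_weight cut_set <= total_weight C)%R.
Proof.
move=> hC hUM; rewrite !total_weight_split; apply: lerD.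
  rewrite le_eqVlt; apply/orP; left; apply/eqP; apply: eq_bigl => v; rewrite !inE.
  by case: (boolP (v \in U)) => //= vU; case: (boolP (v \in M)) => //= vM; rewrite hUM.
exact: le_trans cut_sum_le (flow_sum_le hC).
Qed.

End Cut.

(** Pigeonhole: [n] vertices cannot take all of the [n + 1] values up to [n]. *)
Lemma gap_exists (d : 'I_n -> nat) :
  exists2 g, g <= n & forall v, inH v -> d v != g.
Proof.
pose B := [set (inord (d v) : 'I_n.+1) | v : 'I_n].
have : #|B| < #|'I_n.+1|.
  by apply: leq_ltn_trans (leq_imset_card _ _) _; rewrite !card_ord.
rewrite -cardsT => lt; have : exists g, g \notin B.
  apply/existsP; apply: contraLR lt; rewrite negb_exists => /forallP h.
  rewrite -leqNgt; apply: subset_leq_card; apply/subsetP => g _.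
  by have := h g; rewrite negbK.
case=> g gB; exists g; first by rewrite -ltnS.
move=> v _; apply: contraNneq gB => e; apply/imsetP; exists v => //.
by apply: val_inj; rewrite /= e inord_val.
Qed.

End Flow.

Lemma cell_eq m (u v l r : 'I_m) : (m * u + v == m * l + r) = (u == l) && (v == r).
Proof.
apply/eqP/andP => [e0|[/eqP -> /eqP ->] //].
have m0 : 0 < m by apply: leq_ltn_trans (ltn_ord u).
have := congr1 (divn^~ m) e0; have := congr1 (modn^~ m) e0.
rewrite ![m * _]mulnC !modnMDl !divnMDl // !modn_small // !divn_small // !addn0.
by move=> ev eu; split; apply/eqP; apply: val_inj.
Qed.

(** * Correctness of the flow program *)

Section FlowProgram.
Variables (R : realType) (I : instance R).
Hypothesis valid : valid_instance I.
Local Notation n := (Defs.order I).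
Local Notation inn := (inn_of I).
Local Notation inr := (inr_of I).
Local Notation U := (mincover I).
Local Notation run := (run n inn inr).
Local Notation bxeval := (bxeval n inn inr).
Local Notation s := (edge I).
Local Notation w := (weight I).
Variable M : {set 'I_n}.
Hypothesis MU : M \subset U.
Hypothesis Mind : forall u v, u \in M -> v \in M -> ~~ s u v.

Definition zf (h : store R) (v : 'I_n) : R := ra h rZ v.
Definition ff (h : store R) (l r : 'I_n) : R := ra h rF (n * l + r).
Definition df (h : store R) (v : 'I_n) : nat := na h aD v.

Definition marks (h : store R) : Prop :=
  (forall v : 'I_n, na h aHH v = inH M v) /\ (forall v : 'I_n, na h aIM v = (v \in M)).

Lemma run_p_flow_init env h : (forall v : 'I_n, na h aIM v = (v \in M)) ->
  na h aHH = (fun _ => 0) -> na h aD = (fun _ => 0) -> ra h rF = (fun _ => 0%R) ->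
  let h' := run p_flow_init env h in
  marks h' /\ flow_inv M (zf h') (ff h') (df h').
Proof.
move=> hM hH hD hF h'.
have fD : na h' aD = na h aD by rewrite /h' frame_n.
have fM : na h' aIM = na h aIM by rewrite /h' frame_n.
have fF : ra h' rF = ra h rF by rewrite /h' frame_r.
have [H1 [H2 H3]] : (forall v : 'I_n, na h' aHH v = (v < n) && inH M v) /\
   ((forall v : 'I_n, v < n -> v \in M -> ra h' rZ v = w v) /\
    (forall v : 'I_n, v < n -> v \notin U -> ra h' rZ v = (- w v)%R)).
  clear fD fM fF; rewrite /h' /p_flow_init run_PFor.
  suff [] : (forall v : 'I_n, na h' aIM v = (v \in M)) /\
    ((forall v : 'I_n, na h' aHH v = (v < n) && inH M v) /\
     ((forall v : 'I_n, v < n -> v \in M -> ra h' rZ v = w v) /\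
      (forall v : 'I_n, v < n -> v \notin U -> ra h' rZ v = (- w v)%R))) by [].
  rewrite /h' /p_flow_init run_PFor.
  apply: (@iteri_inv _ (fun t g => (forall v : 'I_n, na g aIM v = (v \in M)) /\
    ((forall v : 'I_n, na g aHH v = (v < t) && inH M v) /\
     ((forall v : 'I_n, v < t -> v \in M -> ra g rZ v = w v) /\
      (forall v : 'I_n, v < t -> v \notin U -> ra g rZ v = (- w v)%R))))).
    by split=> //; split=> // v; rewrite hH.
  move=> t g ht [g0 [g1 [g2 g3]]]; pose tt := Ordinal ht.
  have tE (v : 'I_n) : (v == t :> nat) = (v == tt) by rewrite -val_eqE.
  have ltE (v : 'I_n) : (v < t.+1) = (v == tt) || (v < t) by rewrite ltnS leq_eqVlt tE.
  have ute := uinE tt; have wte := winE tt; have mte := g0 tt; rewrite /= in ute wte mte.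
  rewrite /= ?updE /= ute mte b2n_gt0 wte.
  case: (boolP (tt \in U)) => tU /=; last first.
    split=> //; split=> [v|].
      by rewrite updE tE ltE; case: eqP => [->|_] /=; rewrite ?g1 // /inH tU orbT.
    split=> v; rewrite ltE !updE tE; case: eqP => [->|_] /=; [|exact: g2| |exact: g3].
      by move=> _ /(subsetP MU); rewrite (negbTE tU).
    by rewrite sub0r.
  case: (boolP (tt \in M)) => tM /=.
    split=> //; split=> [v|].
      by rewrite updE tE ltE; case: eqP => [->|_] /=; rewrite ?g1 // /inH tM.
    split=> v; rewrite ltE !updE tE; case: eqP => [->|_] /=; [by []|exact: g2| |exact: g3].
    by rewrite tU.
  split=> //; split=> [v|].
    by rewrite g1 ltE; case: eqP => [->|_] //=; rewrite ltnn /inH (negbTE tM) tU.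
  split=> v; rewrite ltE; case: eqP => [->|_] /=; [|exact: g2| |exact: g3].
    by rewrite (negbTE tM).
  by rewrite tU.
clearbody h'; have ff0 l r : ff h' l r = 0%R by rewrite /ff fF hF.
have df0 v : df h' v = 0 by rewrite /df fD hD.
split; first by split=> v; [rewrite H1 ltn_ord | rewrite fM].
split=> //.
- by move=> l r; rewrite ff0.
- by move=> l r; rewrite ff0 eqxx.
- by move=> l lM; rewrite /zf H2 // big1 ?subr0.
- by move=> r rU; rewrite /zf H3 // big1 ?sub0r.
- by move=> l lM; rewrite /zf H2 //; apply: weight_ge0.
- by move=> v _; rewrite df0.
- by move=> l r _ _ _; rewrite df0.
- by move=> l r; rewrite ff0 ltxx.
- by move=> v; rewrite df0.
Qed.

Lemma x_resE env h (u v : 'I_n) e1 e2 : marks h ->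
  ieval n env e1 = u -> ieval n env e2 = v ->
  bxeval env h (x_res e1 e2) = res M (ff h) u v.
Proof.
move=> [hH _] h1 h2.
rewrite -[LHS]/(((0 < na h aHH (ieval n env e1)) && (0 < na h aHH (ieval n env e2))) &&
  ((0 < ain n inn (ieval n env e1) (ieval n env e2)) &&
   ~~ (~~ (0 < uin n inn (ieval n env e1)) &&
       ~~ ~~ (ra h rF (n * ieval n env e2 + ieval n env e1) <= 0)%R))).
rewrite h1 h2 !hH ainE uinE !b2n_gt0 /res -negb_or negbK -ltNge -/(ff h v u).
by rewrite -andbA.
Qed.

Lemma run_p_push env h (u v : 'I_n) e1 e2 :
  ieval n env e1 = u -> ieval n env e2 = v -> u != v -> (v \in U) = (u \notin U) ->
  let h' := run (p_push e1 e2) env h in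
  let a := pushed (zf h) (ff h) u v in
  [/\ na h' = na h, zf h' = push_exc (zf h) u v a & ff h' = push_flow (ff h) u v a].
Proof.
move=> h1 h2 uv vU h' a.
have nah : na h' = na h by apply: funext => k; rewrite /h' frame_n //.
suff [] : zf h' = push_exc (zf h) u v a /\ ff h' = push_flow (ff h) u v a by split.
rewrite /h' /p_push 4!run_PSeq.
set g1 := run (when _ _) env _.
have [e0 ea] : (forall k, k != rAMT -> ra g1 k = ra h k) /\ ra g1 rAMT 0 = a.
  split=> [k hk|]; first by rewrite /g1 !frame_r // ?inE //= inE.
  rewrite /g1 run_when /= h1 h2 uinE /a /pushed -/(zf h u) -/(ff h v u) eqb0.
  by case: ifP.
clearbody g1; set g2 := run (PR rZ e1 _) env g1.
have [e02 ea2 z2] : [/\ forall k, k != rZ -> ra g2 k = ra g1 k, ra g2 rAMT 0 = a &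
   ra g2 rZ = upd (ra h rZ) u (zf h u - a)%R].
  split=> [k hk||]; first by rewrite /g2 frame_r // inE.
  - by rewrite /g2 /= ea.
  - by rewrite /g2 /= h1 ea e0.
clearbody g2; set g3 := run (PR rZ e2 _) env g2.
have [e03 ea3 z3] : [/\ forall k, k != rZ -> ra g3 k = ra g2 k, ra g3 rAMT 0 = a &
   ra g3 rZ = upd (ra g2 rZ) v (zf h v + a)%R].
  split=> [k hk||]; first by rewrite /g3 frame_r // inE.
  - by rewrite /g3 /= ea2.
  - rewrite /g3 /= h2 ea2 z2 updE.
    have -> : (v == u :> nat) = false by apply/negbTE; rewrite val_eqE eq_sym.
    by [].
clearbody g3.
have f3 : ra g3 rF = ra h rF by rewrite e03 // e02 // e0.
split.
- apply: funext => x; rewrite /zf frame_r // z3 z2 !updE !val_eqE /push_exc.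
  case: (x =P v) => [->|_]; first by rewrite eq_sym (negbTE uv).
  by case: eqP => [->|].
- apply: funext => l; apply: funext => r; rewrite /push_flow /ff.
  rewrite -[run _ _ _]/(if 0 < uin n inn (ieval n env e1)
    then setr g3 rF (n * ieval n env e1 + ieval n env e2) (ra g3 rF (n * ieval n env e1 + ieval n env e2) + ra g3 rAMT 0)%R
    else setr g3 rF (n * ieval n env e2 + ieval n env e1) (ra g3 rF (n * ieval n env e2 + ieval n env e1) - ra g3 rAMT 0)%R).
  rewrite h1 h2 uinE b2n_gt0 ea3 f3.
  case: (u \in U); rewrite ra_setr eqxx updE cell_eq f3.
  + by case: (boolP (_ && _)) => // /andP[/eqP -> /eqP ->].
  + by case: (boolP (_ && _)) => // /andP[/eqP -> /eqP ->].
Qed.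

Lemma run_p_flow_step env h : marks h -> flow_inv M (zf h) (ff h) (df h) ->
  let h' := run p_flow_step env h in
  [/\ marks h', flow_inv M (zf h') (ff h') (df h') &
      (forall v, ~~ active M (zf h') (df h') v)
      \/ (exists v, active M (zf h) (df h) v) /\
         potential M (zf h') (ff h') (df h') < potential M (zf h) (ff h) (df h)].
Proof.
move=> hm inv h'.
have hm' : marks h'.
  by case: hm => m1 m2; split=> v; rewrite /h' frame_n.
rewrite /h' /p_flow_step run_PSeq.
have [i g hi [g1 g2]|[b1 b2] b3] := @run_find_last R n inn inr aAU 10 IN
   (BConj (BN 1 (XRd aHH (IV 10))) (BConj (ypos (YRd rZ (IV 10))) (xlt (XRd aD (IV 10)) IN))) env h
   (fun i => [&& 0 < na h aHH i, ~~ (ra h rZ i <= 0)%R & na h aD i + 1 <= n]).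
  by rewrite /= !g1 // g2.
set h1 := run (find_last _ _ _ _) env h in b1 b2 b3 *; clearbody h1.
have PE (v : 'I_n) : [&& 0 < na h aHH v, ~~ (ra h rZ v <= 0)%R & na h aD v + 1 <= n] = active M (zf h) (df h) v.
  by case: hm => m1 _; rewrite m1 b2n_gt0 -ltNge addn1.
have fh1 : [/\ zf h1 = zf h, ff h1 = ff h & df h1 = df h].
  by split; rewrite /zf /ff /df ?b2 ?b1.
have m1 : marks h1 by case: hm => q1 q2; split=> v; rewrite b1.
have rest v : na h1 aAU 0 = v -> run (at_index (sc aAU) 10
    (find_last aAV 11 IN (BConj (x_res (IV 10) (IV 11))
       (BE (XRd aD (IV 10)) (XAdd (XRd aD (IV 11)) 1))) ;;
     PIf (BE (sc aAV) 0)
       (PN aD (IV 10) (XAdd (XRd aD (IV 10)) 1))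
       (at_index (sc aAV) 11 (p_push (IV 10) (IV 11))))) env h1 =
   if 0 < v <= n then run (find_last aAV 11 IN (BConj (x_res (IV 10) (IV 11))
       (BE (XRd aD (IV 10)) (XAdd (XRd aD (IV 11)) 1))) ;;
     PIf (BE (sc aAV) 0)
       (PN aD (IV 10) (XAdd (XRd aD (IV 10)) 1))
       (at_index (sc aAV) 11 (p_push (IV 10) (IV 11)))) (upd env 10 v.-1) h1 else h1.
  move=> hv; apply: run_at_index => // i j.
  by rewrite -[LHS]/(na (run _ _ _) aAU 0) frame_n.
case: (last_indexP (ieval n env IN) (fun i => [&& 0 < na h aHH i, ~~ (ra h rZ i <= 0)%R & na h aD i + 1 <= n]))
  => [[e0 none]|[u0 [hu0 Pu0] e0]]; rewrite e0 in b3.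
  rewrite (rest 0 b3); case: fh1 => -> -> ->; split=> //.
  have na0 v : ~~ active M (zf h) (df h) v by rewrite -PE; apply: none.
  by left.
pose u : 'I_n := Ordinal (hu0 : u0 < n).
have au : active M (zf h) (df h) u by rewrite -PE.
have u0n : 0 < u0.+1 <= n by exact: hu0.
rewrite (rest _ b3) u0n.
rewrite -[u0.+1.-1]/(nat_of_ord u) run_PSeq; set env1 := upd env 10 u.
have [zh fh dh] := fh1.
have [i g hi [g1 g2]|[c1 c2] c3] := @run_find_last R n inn inr aAV 11 IN
   (BConj (x_res (IV 10) (IV 11)) (BE (XRd aD (IV 10)) (XAdd (XRd aD (IV 11)) 1))) env1 h1
   (fun i => if insub i is Some v then res M (ff h) u v && (df h u == (df h v).+1) else false).
  have mg : marks g by case: m1 => q1 q2; split=> v; rewrite g1.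
  have hi' : i < n := hi.
  rewrite -[LHS]/(bxeval (upd env1 11 i) g (x_res (IV 10) (IV 11)) && (na g aD u0 == na g aD i + 1)).
  rewrite (@x_resE _ _ u (Ordinal hi')) // insubT; congr (_ && _).
    by rewrite (_ : ff g = ff h) // -fh /ff g2.
  by rewrite !g1 // addn1 !b1.
set h2 := run (find_last _ _ _ _) env1 h1 in c1 c2 c3 *; clearbody h2.
have fh2 : [/\ zf h2 = zf h, ff h2 = ff h & df h2 = df h].
  by rewrite -zh -fh -dh; split; rewrite /zf /ff /df ?c2 ?c1.
have m2 : marks h2 by case: m1 => q1 q2; split=> v; rewrite c1.
have [zh2 fh2' dh2] := fh2.
rewrite -[run (PIf _ _ _) _ _]/(if na h2 aAV 0 == 0 then run (PN aD (IV 10) (XAdd (XRd aD (IV 10)) 1)) env1 h2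
   else run (at_index (sc aAV) 11 (p_push (IV 10) (IV 11))) env1 h2).
case: (last_indexP (ieval n env1 IN) (fun i => if insub i is Some v then res M (ff h) u v && (df h u == (df h v).+1) else false))
  => [[e1 none]|[v0 [hv0 Pv0] e1]]; rewrite e1 in c3; rewrite c3.
  rewrite [0 == 0]eqxx [run _ _ _]/=.
  have := @relabel_inv R I valid M MU (zf h) (ff h) (df h) u inv au.
  case=> [v|i1 i2]; first by have := none v (ltn_ord v); rewrite valK.
  set h3 := setn h2 aD _ _.
  have [-> -> ->] : [/\ zf h3 = zf h, ff h3 = ff h & df h3 = relabel (df h) u].
    split; [by rewrite -zh2 | by rewrite -fh2' | apply: funext => v].
    by rewrite /relabel -dh2 /df /h3 /= updE val_eqE addn1.
  by split=> //; right; split=> //; exists u.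
pose v : 'I_n := Ordinal (hv0 : v0 < n).
rewrite [v0.+1 == 0]/=.
rewrite (insubT (fun x => x < n) (hv0 : v0 < n)) -/v in Pv0.
case/andP: Pv0 => ruv /eqP duv.
have uv : u != v by apply/eqP => uv; move: ruv; rewrite uv /res irr // !andbF.
have [uH vH e ruv'] := and4P ruv.
have vx : (v \in U) = (u \notin U).
  case: (boolP (u \in U)) => uU /=.
    by apply/negbTE; apply: (H_edge_l Mind (inU_H uH uU)).
  by apply: (subsetP MU); apply: (H_edge_r valid uU).
rewrite (@run_at_index _ _ _ _ _ _ _ _ _ v0.+1) //; last first.
  by move=> i j; rewrite -c3 -[LHS]/(na (run _ _ _) aAV 0) frame_n.
have -> : 0 < v0.+1 <= n by exact: hv0.
rewrite -[v0.+1.-1]/(nat_of_ord v).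
have [n3 z3 f3] := @run_p_push (upd env1 11 v) h2 u v (IV 10) (IV 11) erefl erefl uv vx.
set h3 := run _ _ _ in n3 z3 f3 *.
have d3 : df h3 = df h by rewrite -dh2 /df n3.
rewrite z3 f3 d3 zh2 fh2'.
have [i1 i2] := @push_inv R I valid M MU Mind (zf h) (ff h) (df h) u v inv au ruv duv.
split=> //; last by right; split=> //; exists u.
by case: m2 => q1 q2; split=> x; rewrite n3.
Qed.

Lemma potential_bound h : (forall v, df h v = 0) -> (forall l r, ff h l r = 0%R) ->
  potential M (zf h) (ff h) (df h) <= n.+1 ^ 4.
Proof.
move=> d0 f0; rewrite /potential.
have -> : back_pairs (ff h) (df h) = set0.
  by apply/setP => p; rewrite !inE f0 ltxx.
rewrite cards0 addn0 [X in _ + X]big1 ?addn0; last by move=> v _.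
have -> : \sum_v (n - df h v) = n * n.
  rewrite (eq_bigr (fun _ => n)) ?sum_nat_const ?card_ord // => v _.
  by rewrite d0 subn0.
rewrite !expnS expn0 muln1; do 2![apply: leq_mul; first by []]; by apply: leq_mul; apply: leqnSn.
Qed.

Lemma run_p_flow env h : marks h -> flow_inv M (zf h) (ff h) (df h) ->
  (forall v, df h v = 0) -> (forall l r, ff h l r = 0%R) ->
  let h' := run p_flow env h in
  [/\ marks h', flow_inv M (zf h') (ff h') (df h') & forall v, ~~ active M (zf h') (df h') v].
Proof.
move=> hm inv d0 f0 h'; rewrite /h' /p_flow run_PFor ieval_ixpow.
have -> : ieval n env (IAdd IN 1) = n.+1 by rewrite /= addn1.
have pb := potential_bound d0 f0; set T := n.+1 ^ 4 in pb *.
pose P t (g : store R) := [/\ marks g, flow_inv M (zf g) (ff g) (df g) &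
  (forall v, ~~ active M (zf g) (df g) v) \/ potential M (zf g) (ff g) (df g) + t <= T].
have [||m1 m2 m3] := @iteri_inv _ P T (fun i => run p_flow_step (upd env 9 i)) h.
- by split=> //; right; rewrite addn0.
- move=> t g ht [g1 g2 g3].
  have [k1 k2 k3] := run_p_flow_step (upd env 9 t) g1 g2.
  split=> //; case: k3 => [|[[v av] lt]]; first by left.
  case: g3 => [/(_ v)|le]; first by rewrite av.
  by right; apply: leq_trans le; rewrite addnS -addSn leq_add2r.
split=> //; case: m3 => // le v.
have : potential M (zf (iteri T (fun i => run p_flow_step (upd env 9 i)) h))
   (ff (iteri T (fun i => run p_flow_step (upd env 9 i)) h))
   (df (iteri T (fun i => run p_flow_step (upd env 9 i)) h)) == 0.
  by rewrite -leqn0 -(leq_add2r T) add0n.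
(* A vanishing potential forces all labels up to [n], and such vertices are inactive. *)
rewrite /potential addn_eq0 muln_eq0 /= addn_eq0 muln_eq0 /= sum_nat_eq0.
move=> /andP[/andP[/forallP /(_ v) + _] _]; rewrite /= subn_eq0 => dn.
by rewrite /active [_ < n]ltnNge dn !andbF.
Qed.

Lemma run_p_gap env h : marks h ->
  let h' := run p_gap env h in
  (forall k, k \notin [:: aDD; aG] -> na h' k = na h k) /\ (ra h' = ra h) /\
  exists g, [/\ na h' aG 0 = g, g <= n & forall v, inH M v -> df h v != g].
Proof.
move=> hm h'; rewrite /h' /p_gap run_PFor.
have -> : ieval n env (IAdd IN 1) = n.+1 by rewrite /= addn1.
pose isgap g := [forall v, inH M v ==> (df h v != g)].
set F := fun i => _.
pose P T (y : store R) := [/\ forall k, k \notin [:: aDD; aG] -> na y k = na h k, ra y = ra h &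
   (forall g, g < T -> ~~ isgap g) \/ exists g, [/\ na y aG 0 = g, g < T & isgap g]].
have [||p1 p2 p3] := @iteri_inv _ P n.+1 F h; last first.
- split=> //; split=> //.
  case: p3 => [no|[g [e1 lt /forallP gp]]].
    have [g gn hg] := @gap_exists R I M (df h).
    have /negP[] := no g gn; apply/forallP => v; apply/implyP; exact: hg.
  by exists g; split=> // v; apply: (implyP (gp v)).
- move=> t y ht [y1 y2 y3]; rewrite /F run_PSeq.
  have [i g hi [g1 g2]|[b1 b2] b3] := @run_count R n inn inr 11 IN
    (BConj (BN 1 (XRd aHH (IV 11))) (BE (XRd aD (IV 11)) (IV 10))) (upd env 10 t) y
    (fun i => (0 < na h aHH i) && (na h aD i == t)).
    by rewrite /= !g1 // !y1.
  set y' := run (p_count _ _ _) _ y in b1 b2 b3 *; clearbody y'.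
  have gE : (na y' aDD 0 == 0) = isgap t.
    rewrite b3 sum_bool_eq0; apply: eq_forallb => v.
    by case: hm => m1 _; rewrite m1 b2n_gt0 negb_and -implybE.
  rewrite run_when -[bxeval _ _ _]/(na y' aDD 0 == 0) gE.
  case: ifP => gt; split.
  + move=> k; rewrite !inE !negb_or => /andP[k1 k2].
    by rewrite na_setn (negbTE k2) b1 // y1 // !inE negb_or k1.
  + by rewrite -y2 -b2.
  + by right; exists t; split.
  + by move=> k kk; rewrite b1 ?y1 //; move: kk; rewrite !inE negb_or => /andP[].
  + by rewrite b2.
  + case: y3 => [no|[g [e1 lt gp]]].
      left=> g; rewrite ltnS leq_eqVlt => /orP[/eqP ->|]; [by rewrite gt | exact: no].
    by right; exists g; split=> //; [rewrite b1 | rewrite ltnW].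
- by split=> //; left.
Qed.

Lemma run_p_cut env h g : marks h -> na h aG 0 = g ->
  cover_of I (run p_cut env h) = cut_set M (df h) g.
Proof.
move=> hm hG; rewrite /p_cut run_PFor; set F := fun i => _.
pose P T (y : store R) := [/\ forall k, k != aOUT -> na y k = na h k, ra y = ra h &
  forall v : 'I_n, v < T -> na y aOUT v = (v \in cut_set M (df h) g)].
have [||p1 p2 p3] := @iteri_inv _ P n F h; last first.
- by apply/setP => v; rewrite inE p3 // eqb0 negbK.
- move=> t y ht [y1 y2 y3]; pose tt := Ordinal ht; rewrite /F.
  rewrite -[run _ _ _]/(if bxeval (upd env 10 t) y (x_chosen (IV 10)) then setn y aOUT t 1 else setn y aOUT t 0).
  have -> : bxeval (upd env 10 t) y (x_chosen (IV 10)) = (tt \in cut_set M (df h) g).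
    case: hm => _ m2.
    rewrite -[LHS]/(~~ (~~ ((0 < uin n inn tt) && (na y aIM tt == 0)) && ~~
      ~~ (~~ ((0 < na y aIM tt) && (na y aD tt + 1 <= na y aG 0)) && ~~ ((uin n inn tt == 0) && (na y aG 0 + 1 <= na y aD tt))))).
    rewrite !y1 // !m2 uinE hG !b2n_gt0 !eqb0 !addn1 inE /df.
    by rewrite !negb_and !negbK !negb_or !negbK.
  have tE (v : 'I_n) : (v == t :> nat) = (v == tt) by rewrite -val_eqE.
  split.
  + by move=> k kk; case: ifP => _; rewrite na_setn (negbTE kk) y1.
  + by case: ifP.
  + move=> v; rewrite ltnS leq_eqVlt tE => lt.
    have [e|ne] := eqVneq v tt.
      by case: ifP => cc; rewrite na_setn eqxx updE tE e eqxx cc.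
    by case: ifP => cc; rewrite na_setn eqxx updE tE (negbTE ne) y3 //; move: lt; rewrite (negbTE ne).
- by split.
Qed.

End FlowProgram.

(** * Completeness of the branching on independent sets *)

Section General.
Variables (R : realType) (I : instance R).
Hypothesis valid : valid_instance I.
Local Notation n := (Defs.order I).
Local Notation inn := (inn_of I).
Local Notation inr := (inr_of I).
Local Notation U := (mincover I).
Local Notation run := (run n inn inr).
Local Notation s := (edge I).

Lemma maximal_extension (A : {set 'I_n}) : A \subset U ->
  (forall u v, u \in A -> v \in A -> ~~ s u v) ->
  exists2 M : {set 'I_n}, A \subset M & maximal_in U M.
Proof.
move=> AU ind.
pose P (B : {set 'I_n}) := (B \subset U) && [forall u in B, forall v in B, ~~ s u v].
have indP B : P B -> forall u v, u \in B -> v \in B -> ~~ s u v.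
  by case/andP=> _ /forall_inP h u v uB vB; move/forall_inP: (h u uB) => /(_ v vB).
have PA : P A.
  by rewrite /P AU; apply/forall_inP => u uA; apply/forall_inP => v vA; apply: ind.
have [M /maxsetP[PM mx] AM] := maxset_exists PA.
exists M => //; have MU : M \subset U by case/andP: PM.
split=> //; first exact: indP.
move=> v vU; case: (boolP (v \in M)) => vM; [by left | right].
have [/exists_inP[u uM vu]|no] := boolP [exists u in M, s v u]; first by exists u.
have nos u : u \in M -> ~~ s v u.
  by move=> uM; apply: contra no => vu; apply/exists_inP; exists u.
have : P (v |: M).
  rewrite /P subUset sub1set vU MU; apply/forall_inP => x; rewrite !inE => xM.
  apply/forall_inP => y; rewrite !inE => yM.
  case/orP: xM => [/eqP ->|xM]; case/orP: yM => [/eqP ->|yM].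
  - by rewrite irr.
  - exact: nos.
  - by rewrite sym //; apply: nos.
  - exact: indP PM _ _ xM yM.
move=> /mx /(_ (subsetUr _ _)) e; case/negP: vM.
by rewrite -e !inE eqxx.
Qed.

Lemma general_spec : branch_spec I p_general (leaves #|U|).
Proof.
have Un : #|U| <= n by apply: leq_trans (max_card _) _; rewrite card_ord.
split.
- rewrite leaves_gt0 /=; apply: leq_trans (leaves_le2 _) _; by rewrite leq_exp2l.
- move=> c h [h1 h2 h3 h4 [h5 _]]; rewrite /p_general run_PSeq frame_n //.
  have hL : na h aL = fun=> 0 by apply: h4.
  have [-> _] := run_p_leaves I env0 hL.
  by rewrite h2 leaf_tableE.
case=> C hC wC.
have [||M CM maxM] := @maximal_extension (U :\: C).
- exact: subsetDl.
- move=> u v; rewrite !inE => /andP[uC _] /andP[vC _]; apply/negP => e.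
  by have := hC u v e; rewrite (negbTE uC) (negbTE vC).
have [r lr hr] := mis_complete valid Un maxM.
exists r => // h [h1 h2 h3 h4 [h5 _]].
have [MU Mind _] := maxM.
rewrite /p_general 5!run_PSeq.
have hL : na h aL = fun=> 0 by apply: h4.
set g1 := run p_leaves env0 h.
have [_ L1] := run_p_leaves I env0 hL; rewrite -/g1 in L1.
have n1 k : k \notin wn p_leaves -> na g1 k = na h k by move=> hk; rewrite /g1 [LHS]frame_n.
have r1 k : ra g1 k = fun=> 0%R by rewrite /g1 [LHS]frame_r.
clearbody g1; set g2 := run p_mis env0 g1.
have M2 (v : 'I_n) : na g2 aIM v = (v \in M).
  rewrite /g2 /p_mis 2!run_PSeq.
  have [|[b1 b2] b3] := @run_map R n inn inr aAL 10 IN (XU (IV 10)) env0 g1 (uin n inn).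
    by [].
  set q1 := run (PFor 10 IN _) env0 g1 in b1 b2 b3 *; clearbody q1.
  set q2 := run (setS aR (sc aC)) env0 q1.
  have f2 k : k != aR -> na q2 k = na q1 k by move=> hk; rewrite /q2 /= (negbTE hk).
  have R2 : na q2 aR 0 = r by rewrite /q2 /= updE /= b1 // n1 // h1.
  clearbody q2; rewrite run_PFor.
  have -> := hr q2 (fun i => upd env0 9 i) set0; first by rewrite set0U.
  split=> //.
  - by move=> x; rewrite f2 // b3 /= ltn_ord uinE.
  - by move=> x y; rewrite f2 // b1 // n1 // h3.
  - by move=> x; rewrite f2 // b1 // n1 // h4 // inE.
  - by move=> k; rewrite f2 // b1.
have n2 k : k \notin wn p_mis -> na g2 k = na g1 k by move=> hk; rewrite /g2 [LHS]frame_n.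
have r2 k : ra g2 k = fun=> 0%R by rewrite /g2 frame_r.
clearbody g2.
have [||| m3 inv3] := @run_p_flow_init R I valid M MU env0 g2 M2.
- by rewrite n2 // n1 // h4.
- by rewrite n2 // n1 // h4.
- exact: r2.
set g3 := run p_flow_init env0 g2 in m3 inv3 *.
have d3 (v : 'I_n) : df g3 v = 0 by rewrite /df /g3 frame_n // n2 // n1 // h4.
have f3 (l q : 'I_n) : ff g3 l q = 0%R by rewrite /ff /g3 frame_r // r2.
clearbody g3.
have [m4 inv4 act4] := @run_p_flow R I valid M MU Mind env0 g3 m3 inv3 d3 f3.
set g4 := run p_flow env0 g3 in m4 inv4 act4 *; clearbody g4.
have [n5 [r5 [g [G5 gn gp]]]] := @run_p_gap R I M env0 g4 m4.
set g5 := run p_gap env0 g4 in n5 r5 G5 *; clearbody g5.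
have m5 : marks M g5 by case: m4 => q1 q2; split=> v; rewrite n5.
have d5 : @df R I g5 = df g4 by apply: funext => v; rewrite /df n5.
rewrite /solved (run_p_cut env0 m5 G5) d5; apply/andP; split.
  apply/coversP; exact: (@cut_cover R I valid M MU Mind (zf g4) (ff g4) (df g4) g inv4 gn gp).
apply: le_trans wC.
apply: (@cut_optimal R I M MU (zf g4) (ff g4) (df g4) g inv4 act4 gn gp C hC).
move=> v vU vM; apply: contraR vM => vC.
by apply: (subsetP CM); rewrite inE vC.
Qed.

End General.

(** * Elimination orders of graphs of maximum degree three *)

Section Elimination.
Variables (R : realType) (I : instance R).
Hypothesis valid : valid_instance I.
Hypothesis small : forall v, #|[set u | edge I v u]| <= 3.
Local Notation n := (Defs.order I).
Local Notation inn := (inn_of I).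
Local Notation inr := (inr_of I).
Local Notation U := (mincover I).
Local Notation run := (run n inn inr).
Local Notation bxeval := (bxeval n inn inr).
Local Notation s := (edge I).

(* [S] is the graph filled so far and [rk] the elimination time. *)
Definition later (A : {set 'I_n}) (S : rel 'I_n) (rk : 'I_n -> nat) (v : 'I_n) : {set 'I_n} :=
  [set u | S v u && ((u \in A) || (rk v < rk u))].

Definition cubic_in (S : rel 'I_n) (A : {set 'I_n}) : {set 'I_n} :=
  [set v in A | deg_in S A v == 3].

(** Ranks mean nothing on alive vertices, which is why [later] also looks at [A]. By [ei_later] the
    later neighbours of a minimised vertex are at most two and form a clique, so its message goes
    into a table that exists already; [ei_bi] and [ei_bi_inj] give each branching a bit of its own.
    [ei_count] is the amortised count of branchings. *)
Record elim_inv (k : nat) (A : {set 'I_n}) (S : rel 'I_n) (NB : nat)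
    (rk : 'I_n -> nat) (bf : 'I_n -> bool) (bi : 'I_n -> nat) : Prop := {
  ei_card : #|A| + k = n;
  ei_sym : symmetric S;
  ei_irr : irreflexive S;
  ei_sub : subrel s S;
  ei_deg : forall v, v \in A -> deg_in S A v <= 3;
  ei_bfA : forall v, v \in A -> bf v = false;
  ei_rk : forall v, v \notin A -> rk v < k;
  ei_inj : forall u v, u \notin A -> v \notin A -> rk u = rk v -> u = v;
  ei_later : forall v, v \notin A -> ~~ bf v ->
    #|later A S rk v| <= 2 /\
    forall u w, u \in later A S rk v -> w \in later A S rk v -> u != w -> S u w;
  ei_bi : forall v, bf v -> bi v < NB;
  ei_bi_inj : forall u v, bf u -> bf v -> bi u = bi v -> u = v;
  ei_count : 4 * NB + #|cubic_in S A| <= 2 * #|U| }.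

(* Every vertex of degree three outside the cover uses three of the at most
   [3 * #|U|] edges leaving the cover. *)
Lemma cubic_count : #|cubic_in s setT| <= 2 * #|U|.
Proof.
have sumE (v : 'I_n) (B : {set 'I_n}) : \sum_(u in B) s v u = #|[set u in B | s v u]|.
  rewrite -sum1_card [RHS]big_mkcond [LHS]big_mkcond; apply: eq_bigr => u _.
  by rewrite inE; case: (u \in B); case: (s v u).
rewrite -(cardsID U) mul2n -addnn; apply: leq_add.
  by apply: subset_leq_card; apply: subsetIr.
set X := _ :\: U; rewrite -(@leq_pmul2l 3) //.
have -> : 3 * #|X| = \sum_(v in X) \sum_(u in U) s v u.
  rewrite mulnC -sum_nat_const; apply: eq_bigr => v; rewrite !inE => /andP[vU /eqP <-].
  rewrite sumE; apply: eq_card => u; rewrite !inE.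
  case: (boolP (s v u)) => vu; rewrite ?andbF // !andbT.
  by have := U_cover valid vu; rewrite (negbTE vU).
rewrite exchange_big mulnC -sum_nat_const; apply: leq_sum => u _.
rewrite (eq_bigr (fun v => nat_of_bool (s u v))) => [|v _]; last by rewrite sym.
rewrite sumE; apply: leq_trans (small u); apply: subset_leq_card.
by apply/subsetP => v; rewrite !inE => /andP[].
Qed.

Lemma deg_in_leq (S : rel 'I_n) (A B : {set 'I_n}) v : A \subset B -> deg_in S A v <= deg_in S B v.
Proof.
move=> AB; apply: subset_leq_card; apply/subsetP => u; rewrite !inE => /andP[uA ->].
by rewrite (subsetP AB).
Qed.

Lemma elim_init rk bf bi : (forall v, bf v = false) ->
  #|cubic_in s setT| <= 2 * #|U| -> elim_inv 0 setT s 0 rk bf bi.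
Proof.
move=> hbf hc; split=> //.
- by rewrite cardsT card_ord addn0.
- by move=> u v; apply: sym.
- by move=> v; apply: irr.
- move=> v _; apply: leq_trans (small v); apply: subset_leq_card.
  by apply/subsetP => u; rewrite !inE.
- by move=> v; rewrite inE.
- by move=> u v; rewrite inE.
- by move=> v; rewrite inE.
- by move=> v; rewrite hbf.
- by move=> v u; rewrite hbf.
Qed.

Definition set_at (T : Type) (f : 'I_n -> T) (v : 'I_n) (x : T) (u : 'I_n) : T :=
  if u == v then x else f u.

(** When [v] leaves [A] it receives a rank above all earlier ones, so it stays a later neighbour of
    the vertices eliminated before. *)
Lemma later_old k (A : {set 'I_n}) (S : rel 'I_n) (rk : 'I_n -> nat) (v w x : 'I_n) : v \in A -> w \notin A -> rk w < k ->
  (x \in later (A :\ v) S (set_at rk v k) w) = (x \in later A S rk w).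
Proof.
move=> vA wA rw; have wv : w == v = false by apply: contraNF wA => /eqP ->.
rewrite !inE /set_at wv; case: eqP => [->|_] //=.
by rewrite vA rw.
Qed.

(** Minimum and maximum degree are both three, so every alive vertex is counted in [cubic_in]; [v]
    disappears and its three neighbours lose an edge, which pays for the 4 in [ei_count]. *)
Lemma elim_branch k A S NB rk bf bi v : elim_inv k A S NB rk bf bi ->
  v \in A -> (forall u, u \in A -> deg_in S A v <= deg_in S A u) -> 3 <= deg_in S A v ->
  elim_inv k.+1 (A :\ v) S NB.+1 (set_at rk v k) (set_at bf v true) (set_at bi v NB).
Proof.
move=> [e1 e2 e3 e4 e5 e6 e7 e8 e9 e10 e11 e12] vA vmin deg3.
have all3 u : u \in A -> deg_in S A u = 3.
  by move=> uA; apply/eqP; rewrite eqn_leq e5 //; apply: leq_trans deg3 (vmin u uA).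
split=> //.
- by have := cardsD1 v A; rewrite vA; lia.
- move=> u; rewrite !inE => /andP[_ uA]; apply: leq_trans (e5 u uA).
  by apply: deg_in_leq; apply: subsetDl.
- by move=> u; rewrite !inE /set_at => /andP[/negbTE -> uA]; apply: e6.
- move=> u; rewrite !inE negb_and negbK /set_at; case: eqP => //= _ uA.
  by apply: ltnW; rewrite ltnS; apply: e7.
- move=> u w; rewrite !inE !negb_and !negbK /set_at.
  case: eqP => [->|_] /=; case: eqP => [->|_] //= h1 h2 e.
  + by have := e7 w h2; rewrite -e ltnn.
  + by have := e7 u h1; rewrite e ltnn.
  + exact: e8.
- move=> u; rewrite !inE negb_and negbK /set_at; case: eqP => //= uv uA bu.
  have [c1 c2] := e9 u uA bu; have lo x := @later_old k A S rk v u x vA uA (e7 u uA).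
  split; first by rewrite (eq_card lo).
  by move=> x y; rewrite !lo; apply: c2.
- by move=> u; rewrite /set_at; case: eqP => // _ /e10 h; apply: ltnW.
- move=> u w; rewrite /set_at; case: eqP => [->|_]; case: eqP => [->|_] // h1 h2 e.
  + by have := e10 w h2; rewrite -e ltnn.
  + by have := e10 u h1; rewrite e ltnn.
  + exact: e11.
- have cA : cubic_in S A = A.
    by apply/setP => u; rewrite inE; case: (boolP (u \in A)) => //= uA; rewrite all3.
  rewrite cA in e12.
  have nbr : #|v |: [set u in A | S v u]| = 4.
    by rewrite cardsU1 inE e3 andbF /= -/(deg_in S A v) all3.
  have sub : cubic_in S (A :\ v) \subset A :\: (v |: [set u in A | S v u]).
    apply/subsetP => u; rewrite !inE => /andP[/andP[uv uA] /eqP d3].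
    rewrite uA (negbTE uv) /= andbT; apply/negP => vu.
    have lt : deg_in S (A :\ v) u < deg_in S A u.
      apply: proper_card; apply/properP; split.
        by apply/subsetP => x; rewrite !inE => /andP[/andP[_ ->] ->].
      by exists v; rewrite !inE ?vA ?eqxx //= e2.
    by move: lt; rewrite d3 all3.
  have subA : v |: [set u in A | S v u] \subset A.
    by rewrite subUset sub1set vA; apply/subsetP => u; rewrite inE => /andP[].
  have := subset_leq_card sub; rewrite cardsDS // nbr.
  by have := subset_leq_card subA; rewrite nbr; lia.
Qed.

Definition filled (A : {set 'I_n}) (S : rel 'I_n) (v : 'I_n) : rel 'I_n :=
  fun u w => S u w || [&& u != w, (u \in A :\ v) && S v u & (w \in A :\ v) && S v w].

(** A neighbour of [v] loses [v] and gains at most the other neighbour of [v]. No degree grows, so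
    no vertex of degree three arises. *)
Lemma elim_fill k A S NB rk bf bi v : elim_inv k A S NB rk bf bi ->
  v \in A -> deg_in S A v <= 2 ->
  elim_inv k.+1 (A :\ v) (filled A S v) NB (set_at rk v k) bf bi.
Proof.
move=> [e1 e2 e3 e4 e5 e6 e7 e8 e9 e10 e11 e12] vA deg2.
have deg' u : u \in A :\ v -> deg_in (filled A S v) (A :\ v) u <= deg_in S A u.
  move=> uA'; have := uA'; rewrite !inE => /andP[uv uA].
  case: (boolP (S v u)) => vu; last first.
    apply: subset_leq_card; apply/subsetP => x; rewrite !inE /filled.
    by rewrite (negbTE vu) !andbF orbF => /andP[/andP[_ ->] ->].
  have sub : [set x in A :\ v | filled A S v u x] \subset
      ([set x in A | S u x] :\ v) :|: ([set x in A | S v x] :\ u).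
    apply/subsetP => x; rewrite !inE /filled !inE => /andP[/andP[xv xA]].
    rewrite xv xA /= => /orP[->//|/and3P[ux _ ->]].
    by rewrite eq_sym ux orbT.
  apply: leq_trans (subset_leq_card sub) _.
  apply: leq_trans (leq_card_setU _ _) _.
  have c1 := cardsD1 v [set x in A | S u x]; have c2 := cardsD1 u [set x in A | S v x].
  rewrite !inE vA e2 vu in c1; rewrite !inE uA vu in c2.
  by move: deg2; rewrite /deg_in c1 c2; lia.
have lv x : (x \in later (A :\ v) (filled A S v) (set_at rk v k) v) = (x \in [set u in A | S v u]).
  rewrite !inE /filled !inE eqxx /= andbF orbF /set_at eqxx.
  case: (x =P v) => [->|_] /=; first by rewrite e3 andbF.
  case: (boolP (x \in A)) => xA /=; first by rewrite andbT.
  by rewrite andbC ltnNge ltnW ?e7 // ltnW // ltnS e7.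
have lo w x : w \notin A -> (x \in later (A :\ v) (filled A S v) (set_at rk v k) w) = (x \in later A S rk w).
  move=> wA; rewrite -(@later_old k A S rk v w x vA wA (e7 w wA)) !inE /filled !inE.
  by rewrite (negbTE wA) !andbF orbF.
split=> //.
- by have := cardsD1 v A; rewrite vA; lia.
- by move=> u w; rewrite /filled e2 eq_sym andbCA andbC -!andbA; congr (_ || _); rewrite !andbA; do !bool_congr.
- by move=> u; rewrite /filled e3 eqxx.
- by move=> u w uw; rewrite /filled e4.
- move=> u uA'; apply: leq_trans (deg' u uA') _; apply: e5.
  by move: uA'; rewrite !inE => /andP[].
- by move=> u; rewrite !inE => /andP[_ uA]; apply: e6.
- move=> u; rewrite !inE negb_and negbK /set_at; case: eqP => //= _ uA.
  by apply: ltnW; rewrite ltnS; apply: e7.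
- move=> u w; rewrite !inE !negb_and !negbK /set_at.
  case: eqP => [->|_] /=; case: eqP => [->|_] //= h1 h2 e.
  + by have := e7 w h2; rewrite -e ltnn.
  + by have := e7 u h1; rewrite e ltnn.
  + exact: e8.
- move=> u; rewrite !inE negb_and negbK; case: eqP => [->|_] /= uA bu.
    split; first by rewrite (eq_card lv).
    move=> x y; rewrite !lv !inE => /andP[xA vx] /andP[yA vy] xy.
    have xv : x != v by apply: contraTneq vx => ->; rewrite e3.
    have yv : y != v by apply: contraTneq vy => ->; rewrite e3.
    by rewrite /filled !inE xy xv yv xA yA vx vy orbT.
  have [c1 c2] := e9 u uA bu.
  split; first by rewrite (eq_card (fun x => lo u x uA)).
  by move=> x y; rewrite !lo // => hx hy xy; rewrite /filled c2.
- apply: leq_trans e12; rewrite leq_add2l; apply: subset_leq_card.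
  apply/subsetP => u; rewrite inE => /andP[uA' /eqP d3].
  have uA : u \in A by move: uA'; rewrite !inE => /andP[].
  by rewrite inE uA eqn_leq e5 //= -d3 deg'.
Qed.

End Elimination.

(** * Correctness of the elimination program *)

Section EliminationProgram.
Variables (R : realType) (I : instance R).
Hypothesis valid : valid_instance I.
Hypothesis small : forall v, #|[set u | edge I v u]| <= 3.
Local Notation n := (Defs.order I).
Local Notation inn := (inn_of I).
Local Notation inr := (inr_of I).
Local Notation U := (mincover I).
Local Notation run := (run n inn inr).
Local Notation bxeval := (bxeval n inn inr).
Local Notation s := (edge I).

Record elim_store (g : store R) (A : {set 'I_n}) (S : rel 'I_n) (NB : nat)
    (rk : 'I_n -> nat) (bf : 'I_n -> bool) (bi : 'I_n -> nat) : Prop := {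
  es_alive : alive_is g A;
  es_graph : graph_is g S;
  es_nb : na g aNB 0 = NB;
  es_rk : forall v : 'I_n, na g aRK v = rk v;
  es_bf : forall v : 'I_n, na g aBF v = bf v;
  es_bi : forall v : 'I_n, na g aBI v = bi v }.

Lemma run_p_fill (env : nat -> nat) h A S (v : 'I_n) : alive_is h (A :\ v) -> graph_is h S ->
  env 10 = v :> nat ->
  agree aS (run (p_fill (IV 10)) env h) h /\
  graph_is (run (p_fill (IV 10)) env h) (filled A S v).
Proof.
move=> hA hs hv; rewrite /p_fill run_PFor; set F := (X in iteri _ X _).
pose c (u w : 'I_n) := [&& u != w, (u \in A :\ v) && S v u & (w \in A :\ v) && S v w].
pose P T (y : store R) := agree aS y h /\
  forall u w : 'I_n, na y aS (n * u + w) = S u w || ((u < T) && c u w).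
have [||p1 p2] := @iteri_inv _ P n F h; last first.
- by split=> // u w; rewrite p2 ltn_ord.
- move=> t y ht [y1 y2]; rewrite /F run_PFor; set G := (X in iteri _ X _).
  pose tt := Ordinal ht.
  have tE (x : 'I_n) : (x == t :> nat) = (x == tt) by rewrite -val_eqE.
  pose Q T (z : store R) := agree aS z h /\
    forall u w : 'I_n, na z aS (n * u + w) = S u w || (((u < t) || (u == tt) && (w < T)) && c u w).
  have [||q1 q2] := @iteri_inv _ Q n G y; last first.
  + split=> // u w; rewrite q2 ltn_ord andbT [u < t.+1]ltnS [u <= t]leq_eqVlt tE.
    by rewrite [(u == tt) || _]orbC.
  + move=> r z hr [z1 z2]; pose rr := Ordinal hr.
    have rE (x : 'I_n) : (x == r :> nat) = (x == rr) by rewrite -val_eqE.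
    have zA : alive_is z (A :\ v) by move=> x; case: z1 => z1 _; rewrite z1.
    (* The matrix is changed while it is being tested, but never in row [v], because [c] requires
       both ends to differ from [v]. *)
    have row (u : 'I_n) : na z aS (n * v + u) = S v u.
      by rewrite z2 /c !inE eqxx /= !andbF orbF.
    rewrite /G run_when.
    have -> : bxeval (upd (upd env 11 t) 12 r) z (BConj (BNeg (BE (IV 11) (IV 12)))
       (BConj (x_live_nbr (IV 10) (IV 11)) (x_live_nbr (IV 10) (IV 12)))) = c tt rr.
      rewrite -[LHS]/((t != r) && (((0 < na z aAL tt) && (0 < na z aS (n * env 10 + tt))) &&
         ((0 < na z aAL rr) && (0 < na z aS (n * env 10 + rr))))).
      by rewrite hv !zA !row !b2n_gt0 /c -val_eqE.
    case: (boolP (c tt rr)) => cc; split=> //.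
    * exact: agree_setn.
    * move=> u w; rewrite /= !updE /= (cell_eq u w tt rr) z2 [w < r.+1]ltnS [w <= r]leq_eqVlt rE.
      case: (u =P tt) => [->|_] /=; last by [].
      by case: (w =P rr) => [->|_] //=; rewrite cc orbT andbT orbT.
    * move=> u w; rewrite z2 [w < r.+1]ltnS [w <= r]leq_eqVlt rE.
      case: (u =P tt) => [->|_] //=.
      by case: (w =P rr) => [->|_] //=; rewrite (negbTE cc) !andbF.
  + by split=> // u w; rewrite y2 andbF orbF.
- by split=> // u w; rewrite hs orbF.
Qed.

Lemma run_p_elim_step (env : nat -> nat) h k A S NB rk bf bi : env 9 = k -> k < n ->
  elim_store h A S NB rk bf bi -> elim_inv k A S NB rk bf bi ->
  exists A' S' NB' rk' bf' bi', elim_store (run p_elim_step env h) A' S' NB' rk' bf' bi' /\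
    elim_inv k.+1 A' S' NB' rk' bf' bi'.
Proof.
move=> e9 kn [hA hs hNB hRK hBF hBI] inv.
have [mv [md [hmv hrun]]] := @mindegP R n inn inr A S.
have [m1 m2] := hrun env h hA hs.
case: hmv => [[A0 _]|[v [vA vmin] [mvE mdE]]].
  by have := ei_card inv; rewrite A0 cards0 add0n => e; move: kn; rewrite e ltnn.
rewrite /p_elim_step run_PSeq; set h1 := run p_mindeg env h in m1 m2 *.
have f1 k' : k' \notin wn p_mindeg -> na h1 k' = na h k' by move=> hk; rewrite /h1 [LHS]frame_n.
clearbody h1; rewrite mvE in m1; rewrite mdE in m2.
rewrite (@run_at_index _ _ _ _ _ _ _ _ _ v.+1) //; last first.
  by move=> i j; rewrite -m1 -[LHS]/(na (run _ _ _) aMV 0) frame_n.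
have -> : 0 < v.+1 <= n by exact: ltn_ord.
rewrite -[v.+1.-1]/(nat_of_ord v) 2!run_PSeq.
set env1 := upd env 10 v.
set h2 := run (PN aAL _ _) env1 _.
have [f2 A2 R2] : [/\ forall k', k' \notin [:: aRK; aAL] -> na h2 k' = na h1 k',
    alive_is h2 (A :\ v) & forall u : 'I_n, na h2 aRK u = set_at rk v k u].
  split=> [k'|u|u].
  - by rewrite !inE negb_or /h2 => /andP[k1 k2]; rewrite /= (negbTE k1) (negbTE k2).
  - rewrite /h2 /= updE -[env1 10]/(nat_of_ord v) val_eqE f1 // hA !inE.
    by case: eqP.
  - rewrite /h2 /= updE -[env1 10]/(nat_of_ord v) val_eqE f1 // hRK /set_at.
    by rewrite /env1 -[upd env 10 v 9]/(env 9) e9.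
clearbody h2.
have s2 : graph_is h2 S by move=> u w; rewrite f2 // f1.
rewrite -[run (PIf _ _ _) _ _]/(if 3 <= na h2 aMD 0 then
   run (PN aBF (IV 10) 1 ;; PN aBI (IV 10) (sc aNB) ;; incr aNB) env1 h2
   else run (p_fill (IV 10)) env1 h2) f2 // m2.
case: (leqP 3 (deg_in S A v)) => deg.
  exists (A :\ v), S, NB.+1, (set_at rk v k), (set_at bf v true), (set_at bi v NB).
  split; last exact: elim_branch.
  split=> //.
  - by rewrite /= updE /= f2 // f1 // hNB addn1.
  - move=> u; rewrite /= updE -[env1 10]/(nat_of_ord v) val_eqE f2 // f1 // hBF /set_at.
    by case: eqP.
  - move=> u; rewrite /= updE -[env1 10]/(nat_of_ord v) val_eqE /set_at.
    by case: eqP => _; rewrite f2 // f1.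
have [[g1 _] g2] := @run_p_fill env1 h2 A S v A2 s2 erefl.
exists (A :\ v), (filled A S v), NB, (set_at rk v k), bf, bi.
split; last by apply: elim_fill => //; rewrite -ltnS.
split=> //.
- by move=> u; rewrite g1.
- by rewrite g1 // f2 // f1.
- by move=> u; rewrite g1.
- by move=> u; rewrite g1 // f2 // f1.
- by move=> u; rewrite g1 // f2 // f1.
Qed.

Lemma run_p_elim h : graph_is h s -> na h aNB 0 = 0 -> na h aRK = (fun _ => 0) ->
  na h aBF = (fun _ => 0) -> na h aBI = (fun _ => 0) ->
  exists S NB rk bf bi, elim_store (run p_elim env0 h) set0 S NB rk bf bi /\
    elim_inv n set0 S NB rk bf bi.
Proof.
move=> hs hNB hRK hBF hBI; rewrite /p_elim run_PSeq.
have [|[b1 b2] b3] := @run_map R n inn inr aAL 10 IN 1 env0 h (fun _ => 1).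
  by [].
set h1 := run (PFor 10 IN _) env0 h in b1 b2 b3 *; clearbody h1.
rewrite run_PFor; set F := (X in iteri _ X _).
pose P t (y : store R) := exists A S NB rk bf bi, elim_store y A S NB rk bf bi /\
  elim_inv t A S NB rk bf bi.
have [||A [S [NB [rk [bf [bi [p1 p2]]]]]]] := @iteri_inv _ P n F h1; last first.
- have A0 : A = set0 by apply/eqP; rewrite -cards_eq0; have := ei_card p2; lia.
  by exists S, NB, rk, bf, bi; rewrite -A0.
- move=> t y ht [A [S [NB [rk [bf [bi [y1 y2]]]]]]].
  exact: run_p_elim_step y1 y2.
- exists setT, s, 0, (fun _ => 0), (fun _ => false), (fun _ => 0); split.
    split=> //.
    + by move=> v; rewrite b3 /= ltn_ord inE.
    + by move=> u v; rewrite b1.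
    + by rewrite b1.
    + by move=> v; rewrite b1 // hRK.
    + by move=> v; rewrite b1 // hBF.
    + by move=> v; rewrite b1 // hBI.
  apply: elim_init => //; exact: cubic_count.
Qed.

End EliminationProgram.

(** * Decoding the branching bits *)

Section Bits.
Variables (R : realType) (n : nat) (inn : nat -> nat) (inr : nat -> R).
Local Notation run := (run n inn inr).

Definition bits_value (b : nat -> bool) (m : nat) : nat := \sum_(i < m) b i * 2 ^ i.

Lemma bits_value_lt b m : bits_value b m < 2 ^ m.
Proof.
elim: m => [|m IH]; first by rewrite /bits_value big_ord0.
rewrite /bits_value big_ord_recr /= -/(bits_value b m) expnS mul2n -addnn.
by case: (b m) => /=; lia.
Qed.

Lemma run_p_bits env (h : store R) (b : nat -> bool) :
  na h aC 0 = bits_value b n -> na h aBT = (fun _ => 0) ->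
  let h' := run p_bits env h in forall i, i < n -> na h' aBT i = b i.
Proof.
move=> hC hBT h'; rewrite /h' /p_bits 5!run_PSeq.
set g1 := run (PFor 10 IN (when _ (setS aNN _))) env _.
have f1 k : k \notin [:: aNN] -> na g1 k = na h k.
  by move=> hk; rewrite /g1 frame_n // frame_n.
clearbody g1; set g2 := run (PFor 10 IN (PN aP _ _)) env _.
have [f2 P2] : (forall k, k != aP -> na g2 k = na g1 k) /\
    forall i, i < n.+1 -> na g2 aP i = 2 ^ i.
  rewrite /g2 run_PFor; set F := (X in iteri _ X _).
  apply: (@iteri_inv _ (fun t (y : store R) => (forall k, k != aP -> na y k = na g1 k) /\
    forall i, i < t.+1 -> na y aP i = 2 ^ i)).
    split=> [k hk|[|i] //]; by rewrite /= (negbTE hk).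
  move=> t y ht [y1 y2]; split=> [k hk|i].
    by rewrite /F /= (negbTE hk) y1.
  rewrite ltnS leq_eqVlt /F /= !updE /= addn1; case: eqP => [-> _|_ /= lt]; last exact: y2.
  by rewrite y2 // expnS.
clearbody g2; set g3 := run (setS aR (sc aC)) env g2.
have [f3 R3] : (forall k, k != aR -> na g3 k = na g2 k) /\ na g3 aR 0 = bits_value b n.
  split=> [k hk|]; first by rewrite /g3 /= (negbTE hk).
  by rewrite /g3 /= updE /= f2 // f1.
clearbody g3; rewrite run_PFor; set F := (X in iteri _ X _).
(* After [t] rounds the remainder is the value of the lowest [n - t] bits, and the bits above them
   are known. The lower bits sum to less than [2 ^ m], so comparing with it reveals bit [m]. *)
pose P t (y : store R) := [/\ forall k, k != aR -> k != aBT -> na y k = na g3 k,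
   na y aR 0 = bits_value b (n - t) & forall i, i < n -> na y aBT i = (n - t <= i) && b i].
have [||p1 p2 p3] := @iteri_inv _ P n F g3; last first.
- by move=> i hi; rewrite p3 // subnn.
- move=> t y ht [y1 y2 y3]; rewrite /F run_when.
  have tn : t < n by [].
  set m := n - 1 - t; have em : n - t = m.+1 by rewrite /m; clear -tn; lia.
  have em' : n - t.+1 = m by rewrite /m; clear -tn; lia.
  have mn : m < n by rewrite /m; clear -tn; lia.
  have em2 : ieval n (upd env 10 t) (ISub (ISub IN 1) (IV 10)) = m by [].
  have Pm : na y aP m = 2 ^ m by rewrite y1 // f3 // P2 // ltnW.
  rewrite em {1}/bits_value big_ord_recr /= -/(bits_value b m) in y2.
  rewrite -[bxeval _ _ _ _ _ _]/(na y aP m <= na y aR 0) Pm y2.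
  have lt := bits_value_lt b m.
  have -> : (2 ^ m <= bits_value b m + b m * 2 ^ m) = b m.
    by case: (b m); rewrite ?mul1n ?leq_addl // mul0n addn0 leqNgt lt.
  have bi i : i < n -> (n - t.+1 <= i) && b i = (i == m) && b m || ((n - t <= i) && b i).
    move=> hi; rewrite em em' leq_eqVlt eq_sym; case: eqP => [->|_] //=.
    by rewrite ltnn orbF.
  case: ifP => bm; split.
  + move=> k k1 k2.
    rewrite -[run _ _ _]/(setn (setn y aBT m 1) aR 0 (na y aR 0 - na y aP m)).
    by rewrite !na_setn (negbTE k1) (negbTE k2) y1.
  + rewrite -[run _ _ _]/(setn (setn y aBT m 1) aR 0 (na y aR 0 - na y aP m)).
    by rewrite na_setn eqxx updE eqxx Pm y2 bm mul1n addnK em'.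
  + move=> i hi; rewrite -[run _ _ _]/(setn (setn y aBT m 1) aR 0 (na y aR 0 - na y aP m)).
    rewrite !na_setn /= updE bi // bm andbT; case: eqP => // _; by rewrite y3.
  + by move=> k k1 k2; rewrite y1.
  + by rewrite em' y2 bm addn0.
  + by move=> i hi; rewrite bi // bm andbF y3.
- split=> //; first by rewrite subn0.
  move=> i hi; rewrite f3 // f2 // f1 // hBT subn0 leqNgt hi //.
Qed.

Lemma run_p_bits_NN env (h : store R) : na h aT 0 <= n ->
  na (run p_bits env h) aNN 0 = 2 ^ (na h aT 0)./2.
Proof.
move=> hT; rewrite /p_bits run_PSeq run_PSeq frame_n //.
rewrite run_PFor; set F := (X in iteri _ X _).
pose P t (y : store R) := na y aT = na h aT /\ na y aNN 0 = 2 ^ (minn t (na h aT 0)./2).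
have [||p1 p2] := @iteri_inv _ P n F (run (setS aNN 1) env h); last first.
- by rewrite p2; congr (2 ^ _); lia.
- move=> t y ht [y1 y2]; rewrite /F run_when.
  rewrite -[bxeval _ _ _ _ _ _]/(2 * (t + 1) <= na y aT 0) y1.
  case: leqP => le; split=> //.
  + by rewrite /= updE /= y2 -expnS; congr (2 ^ _); lia.
  + by rewrite y2; congr (2 ^ _); lia.
- by split=> //; rewrite min0n.
Qed.

End Bits.

(** * Tables of the variable elimination *)

Section RealUpdates.
Variables (R : realType) (n : nat) (inn : nat -> nat) (inr : nat -> R).
Local Notation run := (run n inn inr).
Local Notation bxeval := (bxeval n inn inr).
Local Notation yeval := (yeval n inn inr).

(** [Pr] marks cells of [k] that must not change during the accumulation. A message adds to the
    array from which it also reads the row of the eliminated vertex. *)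
Definition sim (k : nat) (Pr : pred nat) (g h : store R) : Prop :=
  [/\ na g = na h, forall k', k' != k -> ra g k' = ra h k' &
      forall i, Pr i -> ra g k i = ra h k i].

Definition radds (p : prog) (k : nat) (Pr : pred nat) (env : nat -> nat) (h : store R)
    (dl : nat -> R) : Prop :=
  forall g, sim k Pr g h ->
    sim k Pr (run p env g) h /\ forall i, ra (run p env g) k i = (ra g k i + dl i)%R.

Lemma sim_refl k Pr h : sim k Pr h h. Proof. by []. Qed.

Lemma radds_for p k Pr x b env h (dl : nat -> nat -> R) :
  (forall j, j < ieval n env b -> radds p k Pr (upd env x j) h (dl j)) ->
  radds (PFor x b p) k Pr env h (fun i => \sum_(j < ieval n env b) dl j i)%R.
Proof.
move=> H g gh; rewrite run_PFor.
apply: (@iteri_inv _ (fun t y => sim k Pr y h /\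
  forall i, ra y k i = (ra g k i + \sum_(j < t) dl j i)%R)).
  by split=> // i; rewrite big_ord0 addr0.
move=> t y ht [y1 y2]; have [z1 z2] := H t ht y y1; split=> // i.
by rewrite z2 y2 big_ord_recr /= addrA.
Qed.

Lemma radds_when c p k Pr env h (b : bool) dl :
  (forall g, sim k Pr g h -> bxeval env g c = b) ->
  (b -> radds p k Pr env h dl) ->
  radds (when c p) k Pr env h (fun i => if b then dl i else 0%R).
Proof.
move=> hc hp g gh; rewrite run_when hc //; case: b hp {hc} => hp; first exact: hp.
by split=> // i; rewrite addr0.
Qed.

Lemma radds_add k Pr a e env h v :
  (forall g, sim k Pr g h -> yeval env g e = v) -> ~~ Pr (ieval n env a) ->
  radds (y_add k a e) k Pr env h (fun i => if i == ieval n env a then v else 0%R).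
Proof.
move=> he ha g gh; have [g1 g2 g3] := gh.
rewrite -[run _ _ _]/(setr g k (ieval n env a) (ra g k (ieval n env a) + yeval env g e)%R) he //.
split; first split=> //.
- by move=> k' ne; rewrite ra_setr (negbTE ne) g2.
- move=> i Pi; rewrite ra_setr eqxx updE; case: eqP => [ei|_]; last exact: g3.
  by move: ha; rewrite -ei Pi.
- move=> i; rewrite ra_setr eqxx updE; case: eqP => [->|_] //.
  by rewrite addr0.
Qed.

Lemma radds_min k Pr a e1 e2 env h v1 v2 :
  (forall g, sim k Pr g h -> yeval env g e1 = v1) ->
  (forall g, sim k Pr g h -> yeval env g e2 = v2) -> ~~ Pr (ieval n env a) ->
  radds (y_add_min k a e1 e2) k Pr env h
    (fun i => if i == ieval n env a then Num.min v1 v2 else 0%R).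
Proof.
move=> h1 h2 ha g gh.
rewrite -[run _ _ _]/(if (yeval env g e1 <= yeval env g e2)%R then run (y_add k a e1) env g
  else run (y_add k a e2) env g) h1 // h2 //.
case: leP => le.
- exact: radds_add h1 ha g gh.
- exact: radds_add h2 ha g gh.
Qed.

Lemma u_cell_eq (v u : nat) (x y : nat) : x < 2 -> y < 2 ->
  (2 * v + x == 2 * u + y) = (v == u) && (x == y).
Proof. by move=> hx hy; apply/eqP/andP => [e|[/eqP -> /eqP ->]] //; split; apply/eqP; lia. Qed.

Lemma b_cell_eq (i j : nat) (x y x' y' : nat) : x < 2 -> y < 2 -> x' < 2 -> y' < 2 ->
  (4 * i + (2 * x + y) == 4 * j + (2 * x' + y')) = [&& i == j, x == x' & y == y'].
Proof.
move=> h1 h2 h3 h4; apply/eqP/and3P => [e|[/eqP -> /eqP -> /eqP ->]] //.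
by split; apply/eqP; lia.
Qed.

Lemma sum_pick (m : nat) (F : nat -> R) i : i < m ->
  (\sum_(j < m) (if i == j then F j else 0) = F i)%R.
Proof.
move=> hi; rewrite (bigD1 (Ordinal hi)) //= eqxx big1 ?addr0 // => j.
by rewrite -val_eqE /= eq_sym => /negbTE ->.
Qed.

Lemma sum_u_cell (m : nat) (P : nat -> bool) (F : nat -> nat -> R) u y : u < m -> y < 2 ->
  (\sum_(u' < m) \sum_(y' < 2) (if P u' then if (2 * u + y == 2 * u' + y')%N then F u' y' else 0 else 0)
   = if P u then F u y else 0)%R.
Proof.
move=> hu hy; rewrite -[RHS](@sum_pick m (fun u => if P u then F u y else 0)%R u hu).
apply: eq_bigr => u' _; rewrite -[F u' y](@sum_pick 2 (F u') y hy).
case: eqP => [<-|/eqP ne]; last first.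
  by rewrite big1 // => y' _; rewrite u_cell_eq // (negbTE ne) if_same.
by case: ifP => Pu; [apply: eq_bigr => y' _; rewrite u_cell_eq // eqxx | rewrite big1].
Qed.

End RealUpdates.

(* Costs of boolean assignments: [ua v x] is the unary cost of [v], and
   [bb v u x y] the cost of the pair [v], [u] with [u] eliminated after [v];
   the pairs are charged to the vertex eliminated first. *)
Section Energy.
Variables (R : realType) (T : finType) (L : T -> {set T}) (rk : T -> nat) (bf : T -> bool).
Hypothesis rk_inj : injective rk.

Definition local (ua : T -> bool -> R) (bb : T -> T -> bool -> bool -> R)
    (v : T) (c : bool) (x : T -> bool) : R :=
  (ua v c + \sum_(u in L v) bb v u c (x u))%R.

Definition local_min ua bb v x : R := Num.min (local ua bb v false x) (local ua bb v true x).

(** What [v] still contributes when all ranks below [k] are done. A minimised vertex has passed on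
    its minimum and retains the loss of [x v] against it; a branched vertex has passed on its pair
    costs and retains its unary cost. *)
Definition term (k : nat) ua bb (x : T -> bool) (v : T) : R :=
  if rk v < k then (if bf v then ua v (x v) else (local ua bb v (x v) x - local_min ua bb v x)%R)
  else local ua bb v (x v) x.

(** Eliminating [v] splits its cost into the new term of [v], the part [De] handed to later
    vertices, in portions [dl], and a constant [ka]. Tables of rank up to [k] must stay as they
    are. *)
Lemma term_step k ua bb ua' bb' v x (dl : T -> R) (De ka : R) :
  rk v = k ->
  (forall u c, rk u <= k -> ua' u c = ua u c) ->
  (forall u w c d, rk u <= k -> bb' u w c d = bb u w c d) ->
  (forall u, k < rk u -> local ua' bb' u (x u) x = (local ua bb u (x u) x + dl u)%R) ->
  (\sum_(u | (k < rk u)%N) dl u = De)%R ->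
  (local ua bb v (x v) x = term k.+1 ua' bb' x v + De + ka)%R ->
  (\sum_u term k ua bb x u = ka + \sum_u term k.+1 ua' bb' x u)%R.
Proof.
move=> rv hu hb hl hD hv.
have loc u c : rk u <= k -> local ua' bb' u c x = local ua bb u c x.
  by move=> le; rewrite /local hu //; congr (_ + _)%R; apply: eq_bigr => w _; rewrite hb.
have tv : term k ua bb x v = local ua bb v (x v) x by rewrite /term rv ltnn.
rewrite (bigD1 v) //= [in RHS](bigD1 v) //= tv hv.
have -> : (\sum_(u | u != v) term k.+1 ua' bb' x u = \sum_(u | u != v) term k ua bb x u + De)%R.
  have -> : De = (\sum_(u | u != v) if (k < rk u)%N then dl u else 0)%R.
    rewrite -hD big_mkcond (bigD1 v) //= rv ltnn add0r.
    by apply: eq_bigr.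
  rewrite -big_split /=; apply: eq_bigr => u uv; rewrite /term ltnS.
  have ne : rk u != k by apply: contra uv => /eqP e; apply/eqP; apply: rk_inj; rewrite e rv.
  case: (ltngtP (rk u) k) ne => // lt _.
  - by rewrite addr0 hu ?(ltnW lt) // /local_min !loc // ltnW.
  - exact: hl.
set X := (\sum_(u | u != v) _)%R; set Y := term _ _ _ _ _; clearbody X Y; ring.
Qed.

End Energy.

(** * Effect of one elimination on the tables *)

Section Forward.
Variables (R : realType) (I : instance R).
Hypothesis valid : valid_instance I.
Local Notation n := (Defs.order I).
Local Notation inn := (inn_of I).
Local Notation inr := (inr_of I).
Local Notation U := (mincover I).
Local Notation run := (run n inn inr).
Local Notation bxeval := (bxeval n inn inr).
Local Notation yeval := (yeval n inn inr).
Local Notation s := (edge I).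
Local Notation w := (weight I).

Variables (S : rel 'I_n) (NB : nat) (rk : 'I_n -> nat) (bf : 'I_n -> bool) (bi : 'I_n -> nat).
Hypothesis inv : elim_inv n set0 S NB rk bf bi.
Variable b : nat -> bool.

Definition Lset (v : 'I_n) : {set 'I_n} := later set0 S rk v.

Lemma in_Lset u v : (u \in Lset v) = S v u && (rk v < rk u).
Proof. by rewrite !inE. Qed.

Lemma rk_injective : injective rk.
Proof. by move=> u v; apply: (ei_inj inv); rewrite inE. Qed.

Lemma rk_lt v : rk v < n.
Proof. by apply: (ei_rk inv); rewrite inE. Qed.

Lemma Lset_rk v u : u \in Lset v -> rk v < rk u.
Proof. by rewrite in_Lset => /andP[]. Qed.

Lemma NB_le : NB <= #|U|./2.
Proof. by have := ei_count inv; clear; lia. Qed.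

Lemma bi_lt v : bf v -> bi v < n.
Proof.
move=> /(ei_bi inv) lt; apply: leq_trans lt _; apply: leq_trans NB_le _.
apply: (@leq_trans #|U|); first by clear; lia.
by apply: leq_trans (max_card _) _; rewrite card_ord.
Qed.

Record fixed (g : store R) : Prop := {
  fx_graph : graph_is g S;
  fx_rk : forall v : 'I_n, na g aRK v = rk v;
  fx_bf : forall v : 'I_n, na g aBF v = bf v;
  fx_bi : forall v : 'I_n, na g aBI v = bi v;
  fx_bt : forall i, i < n -> na g aBT i = b i }.

Definition uaf (g : store R) (v : 'I_n) (c : bool) : R := ra g rUA (2 * v + c).
Definition bbf (g : store R) (v u : 'I_n) (c d : bool) : R :=
  ra g rBB (4 * (n * v + u) + (2 * c + d)).

Lemma x_laterE (env : nat -> nat) g (v u : 'I_n) e f : fixed g -> env 9 = rk v ->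
  ieval n env e = v -> ieval n env f = u -> bxeval env g (x_later e f) = (u \in Lset v).
Proof.
move=> hg h9 he hf.
rewrite -[LHS]/((0 < na g aS (n * ieval n env e + ieval n env f)) && (env 9 + 1 <= na g aRK (ieval n env f))).
by rewrite he hf (fx_graph hg) (fx_rk hg) h9 b2n_gt0 addn1 in_Lset.
Qed.

Lemma fixed_na g h : na g = na h -> fixed h -> fixed g.
Proof. by move=> e [h1 h2 h3 h4 h5]; split; rewrite /graph_is e. Qed.

Lemma b2n_lt2 (c : bool) : c < 2. Proof. by case: c. Qed.

(** Loop variables are natural numbers, so predicates on vertices are extended by [false]. *)
Definition ext_pred (P : 'I_n -> bool) (i : nat) : bool :=
  if insub i is Some u then P u else false.

Lemma ext_predE P (u : 'I_n) : ext_pred P u = P u.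
Proof. by rewrite /ext_pred valK. Qed.

Lemma ext_pred_ord P i (hi : i < n) : ext_pred P i = P (Ordinal hi).
Proof. by rewrite -[i in LHS]/(val (Ordinal hi)) ext_predE. Qed.

Lemma run_p_assign_branch (env : nat -> nat) h (v : 'I_n) : fixed h -> env 10 = v -> env 9 = rk v -> bf v ->
  let h' := run (p_assign_branch (IV 10)) env h in
  [/\ forall k, k != aVL -> na h' k = na h k, na h' aVL = upd (na h aVL) v (b (bi v)),
      forall u c, uaf h' u c = (uaf h u c + if u \in Lset v then bbf h v u (b (bi v)) c else 0)%R &
      forall u u' c d, bbf h' u u' c d = bbf h u u' c d].
Proof.
move=> hf h10 h9 bv h'; rewrite /h' /p_assign_branch run_PSeq.
set h1 := run (PN aVL _ _) env h.
have V1 : na h1 aVL = upd (na h aVL) v (b (bi v)).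
  by rewrite /h1 /= h10 (fx_bi hf) (fx_bt hf) // bi_lt.
have n1 k : k != aVL -> na h1 k = na h k by move=> hk; rewrite /h1 /= (negbTE hk).
have r1 : ra h1 = ra h by [].
have hf1 : fixed h1.
  case: hf => q1 q2 q3 q4 q5; split; rewrite /graph_is ?n1 //.
clearbody h1; set p := PFor 11 IN _.
pose F (u y : nat) : R := ra h rBB (4 * (n * v + u) + (2 * b (bi v) + y)).
have ad : radds n inn inr p rUA pred0 env h1
    (fun i => \sum_(u < n) \sum_(y < 2) if ext_pred (fun u => u \in Lset v) u then
       if (i == 2 * u + y)%N then F u y else 0 else 0)%R.
  apply: (@radds_for R n inn inr _ _ _ 11 IN _ _ (fun u i => \sum_(y < 2) if ext_pred (fun u => u \in Lset v) u then
       if (i == 2 * u + y)%N then F u y else 0 else 0)%R) => u hu.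
  apply: (@radds_for R n inn inr _ _ _ 12 2 _ _ (fun y i => if ext_pred (fun u => u \in Lset v) u then
       if (i == 2 * u + y)%N then F u y else 0 else 0)%R) => y hy.
  apply: radds_when => [g [g1 _ _]|_].
    by rewrite (@x_laterE _ _ v (Ordinal hu)) ?ext_pred_ord //; apply: fixed_na hf1.
  apply: radds_add => // g [g1 g2 g3].
  rewrite -[LHS]/(ra g rBB (4 * (n * env 10 + u) + (2 * na g aVL (env 10) + y)))%R.
  by rewrite g1 h10 V1 updE eqxx g2 // r1.
have [[a1 a2 a3] a4] := ad h1 (sim_refl _ _ _); split.
- by move=> k hk; rewrite a1 n1.
- by rewrite a1.
- move=> u c; rewrite /uaf a4 r1; congr (_ + _)%R.
  rewrite (@sum_u_cell R n (ext_pred (fun u => u \in Lset v)) F u c) ?b2n_lt2 // ext_predE.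
  by case: ifP.
- by move=> u u' c d; rewrite /bbf a2 // r1.
Qed.

Lemma run_p_message1 (env : nat -> nat) h (v : 'I_n) : fixed h -> env 10 = v -> env 9 = rk v ->
  let h' := run (p_message1 (IV 10)) env h in
  [/\ na h' = na h,
      forall u c, uaf h' u c = (uaf h u c + if u \in Lset v then
        Num.min (uaf h v false + bbf h v u false c) (uaf h v true + bbf h v u true c) else 0)%R &
      forall u u' c d, bbf h' u u' c d = bbf h u u' c d].
Proof.
move=> hf h10 h9 h'; rewrite /h' /p_message1; set p := PFor 11 IN _.
pose F (u y : nat) : R := Num.min
   (ra h rUA (2 * v + 0) + ra h rBB (4 * (n * v + u) + (2 * 0 + y)))%R
   (ra h rUA (2 * v + 1) + ra h rBB (4 * (n * v + u) + (2 * 1 + y)))%R.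
(* The protected cells are the two unary entries of [v]; the message goes to later neighbours, which
   differ from [v]. *)
have ad : radds n inn inr p rUA (fun i => i./2 == v) env h
    (fun i => \sum_(u < n) \sum_(y < 2) if ext_pred (fun u => u \in Lset v) u then
       if (i == 2 * u + y)%N then F u y else 0 else 0)%R.
  apply: (@radds_for R n inn inr _ _ _ 11 IN _ _ (fun u i => \sum_(y < 2) if ext_pred (fun u => u \in Lset v) u then
       if (i == 2 * u + y)%N then F u y else 0 else 0)%R) => u hu.
  apply: (@radds_for R n inn inr _ _ _ 12 2 _ _ (fun y i => if ext_pred (fun u => u \in Lset v) u then
       if (i == 2 * u + y)%N then F u y else 0 else 0)%R) => y hy.
  apply: radds_when => [g [g1 _ _]|].
    by rewrite (@x_laterE _ _ v (Ordinal hu)) ?ext_pred_ord //; apply: fixed_na hf.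
  rewrite ext_pred_ord => uL.
  apply: radds_min => [g [g1 g2 g3]|g [g1 g2 g3]|].
  - rewrite -[LHS]/(ra g rUA (2 * env 10 + 0) + ra g rBB (4 * (n * env 10 + u) + (2 * 0 + y)))%R.
    by rewrite h10 g3 ?g2 // addn0 mul2n doubleK.
  - rewrite -[LHS]/(ra g rUA (2 * env 10 + 1) + ra g rBB (4 * (n * env 10 + u) + (2 * 1 + y)))%R.
    by rewrite h10 g3 ?g2 // addn1 mul2n /= uphalf_double.
  - rewrite -[ieval _ _ _]/(2 * u + y); apply/eqP => e.
    have {}e : u = v by move: hy e; rewrite -[ieval _ _ 2]/2; clear; lia.
    by have := Lset_rk uL; rewrite (_ : Ordinal hu = v) ?ltnn //; apply: val_inj.
have [[a1 a2 a3] a4] := ad h (sim_refl _ _ _); split=> //.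
- move=> u c; rewrite /uaf a4; congr (_ + _)%R.
  rewrite (@sum_u_cell R n (ext_pred (fun u => u \in Lset v)) F u c) ?b2n_lt2 // ext_predE.
  by case: ifP.
- by move=> u u' c d; rewrite /bbf a2.
Qed.

Lemma sum_if (m : nat) (P : bool) (F : 'I_m -> R) :
  (\sum_(i < m) (if P then F i else 0) = if P then \sum_(i < m) F i else 0)%R.
Proof. by case: P => //; rewrite big1. Qed.

Lemma run_p_message2 (env : nat -> nat) h (v : 'I_n) : fixed h -> env 10 = v -> env 9 = rk v ->
  let h' := run (p_message2 (IV 10)) env h in
  [/\ na h' = na h, forall u c, uaf h' u c = uaf h u c &
      forall u u' c d, bbf h' u u' c d = (bbf h u u' c d +
        if [&& (rk u < rk u')%N, u \in Lset v & u' \in Lset v] then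
          Num.min (uaf h v false + bbf h v u false c + bbf h v u' false d)
                  (uaf h v true + bbf h v u true c + bbf h v u' true d) else 0)%R].
Proof.
move=> hf h10 h9 h'; rewrite /h' /p_message2; set p := PFor 11 IN _.
pose F (u u' y z : nat) : R := Num.min
   (ra h rUA (2 * v + 0) + ra h rBB (4 * (n * v + u) + (2 * 0 + y)) + ra h rBB (4 * (n * v + u') + (2 * 0 + z)))%R
   (ra h rUA (2 * v + 1) + ra h rBB (4 * (n * v + u) + (2 * 1 + y)) + ra h rBB (4 * (n * v + u') + (2 * 1 + z)))%R.
pose C (u u' : nat) := ext_pred (fun u => ext_pred (fun u' => [&& rk u < rk u', u \in Lset v & u' \in Lset v]) u') u.
(* The binary tables whose first vertex is [v]: they are read, whereas the message goes to those of
   a later neighbour. *)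
pose Pr (i : nat) := i %/ 4 %/ n == v.
have rowP (x : 'I_n) y : y < 4 -> Pr (4 * (n * v + x) + y).
  move=> hy; rewrite /Pr [4 * _]mulnC divnMDl // [y %/ 4]divn_small // addn0.
  by rewrite mulnC divnMDl ?divn_small ?addn0 // (leq_trans _ (ltn_ord x)).
have ad : radds n inn inr p rBB Pr env h
    (fun i => \sum_(u < n) \sum_(u' < n) if C u u' then \sum_(y < 2) \sum_(z < 2)
       (if (i == 4 * (n * u + u') + (2 * y + z))%N then F u u' y z else 0) else 0)%R.
  apply: (@radds_for R n inn inr _ _ _ 11 IN _ _ (fun u i => \sum_(u' < n) if C u u' then
      \sum_(y < 2) \sum_(z < 2) (if (i == 4 * (n * u + u') + (2 * y + z))%N then F u u' y z else 0) else 0)%R) => u hu.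
  apply: (@radds_for R n inn inr _ _ _ 12 IN _ _ (fun u' i => if C u u' then
      \sum_(y < 2) \sum_(z < 2) (if (i == 4 * (n * u + u') + (2 * y + z))%N then F u u' y z else 0) else 0)%R) => u' hu'.
  set env2 := upd (upd env 11 u) 12 u'.
  have CE : C u u' = [&& rk (Ordinal hu) < rk (Ordinal hu'), Ordinal hu \in Lset v & Ordinal hu' \in Lset v].
    by rewrite /C ext_pred_ord ext_pred_ord.
  apply: radds_when => [g [g1 _ _]|].
    have hg : fixed g by apply: fixed_na hf.
    rewrite -[LHS]/((na g aRK (Ordinal hu) + 1 <= na g aRK (Ordinal hu')) &&
      (bxeval env2 g (x_later (IV 10) (IV 11)) && bxeval env2 g (x_later (IV 10) (IV 12)))).
    rewrite (@x_laterE _ _ v (Ordinal hu)) // (@x_laterE _ _ v (Ordinal hu')) //.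
    by rewrite !(fx_rk hg) addn1 CE.
  rewrite CE => /and3P[_ uL u'L].
  apply: (@radds_for R n inn inr _ _ _ 13 2 _ _ (fun y i => \sum_(z < 2)
      (if (i == 4 * (n * u + u') + (2 * y + z))%N then F u u' y z else 0))%R) => y hy.
  apply: (@radds_for R n inn inr _ _ _ 14 2 _ _ (fun z i => if (i == 4 * (n * u + u') + (2 * y + z))%N then F u u' y z else 0)%R) => z hz.
  have {}hy : y < 2 by []. have {}hz : z < 2 by [].
  apply: radds_min => [g [g1 g2 g3]|g [g1 g2 g3]|].
  - rewrite -[LHS]/(ra g rUA (2 * env 10 + 0) + ra g rBB (4 * (n * env 10 + Ordinal hu) + (2 * 0 + y))
        + ra g rBB (4 * (n * env 10 + Ordinal hu') + (2 * 0 + z)))%R.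
    by rewrite h10 g2 // !g3 //; apply: rowP; move: hy hz; clear; lia.
  - rewrite -[LHS]/(ra g rUA (2 * env 10 + 1) + ra g rBB (4 * (n * env 10 + Ordinal hu) + (2 * 1 + y))
        + ra g rBB (4 * (n * env 10 + Ordinal hu') + (2 * 1 + z)))%R.
    by rewrite h10 g2 // !g3 //; apply: rowP; move: hy hz; clear; lia.
  - rewrite -[ieval _ _ _]/(4 * (n * u + u') + (2 * y + z)) /Pr.
    rewrite [4 * _]mulnC divnMDl // [(2 * y + z) %/ 4]divn_small; last by move: hy hz; clear; lia.
    have n0 : 0 < n by exact: leq_ltn_trans (leq0n u) hu.
    rewrite addn0 mulnC divnMDl ?divn_small ?addn0 //.
    apply/eqP => e; have := Lset_rk uL; rewrite (_ : Ordinal hu = v) ?ltnn //.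
    exact: val_inj.
have [[a1 a2 a3] a4] := ad h (sim_refl _ _ _); split=> //.
  by move=> u c; rewrite /uaf a2.
move=> u u' c d; rewrite /bbf a4; congr (_ + _)%R.
have CE : C u u' = [&& rk u < rk u', u \in Lset v & u' \in Lset v].
  by rewrite /C !ext_predE.
rewrite -CE; have h2 := b2n_lt2.
pose G (x x' : nat) : R := if C x x' then F x x' c d else 0%R.
transitivity (G u u'); last by rewrite /G; case: ifP.
rewrite -(@sum_pick R n (fun x => G x u') u) //; apply: eq_bigr => x _.
rewrite -(@sum_pick R n (fun x' => G x x') u') // -sum_if; apply: eq_bigr => x' _.
rewrite /G; case: (C x x'); last by rewrite !if_same.
rewrite -(@sum_pick R 2 (fun y => F x x' y d) c) // -2!sum_if; apply: eq_bigr => y _.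
rewrite -(@sum_pick R 2 (fun z => F x x' y z) d) // -3!sum_if; apply: eq_bigr => z _.
rewrite b_cell_eq // (cell_eq u u' x x').
rewrite val_eqE val_eqE.
by case: (u == x); case: (u' == x'); case: (nat_of_bool c == y); case: (nat_of_bool d == z).
Qed.

End Forward.

Lemma run_select (R : realType) n inn inr x p c env (h : store R) v : v < n ->
  (forall i, i < n -> bxeval n inn inr (upd env x i) h c = (i == v)) ->
  (forall i, i < n -> bxeval n inn inr (upd env x i) (run n inn inr p (upd env x v) h) c = (i == v)) ->
  run n inn inr (PFor x IN (when c p)) env h = run n inn inr p (upd env x v) h.
Proof.
move=> hv h1 h2; rewrite run_PFor; set F := (X in iteri _ X _).
pose P t (y : store R) := y = if v < t then run n inn inr p (upd env x v) h else h.
suff : P n (iteri n F h) by rewrite /P hv.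
apply: iteri_inv => // t y ht ->; rewrite /F run_when.
case: (ltngtP v t) => [lt|gt|e].
- by rewrite h2 // gtn_eqF // /P ltnS ltnW.
- by rewrite h1 // ltn_eqF // /P ltnS leqNgt gt.
- by rewrite h1 // -e eqxx /P ltnSn.
Qed.

(** * The forward pass *)

Section Cubic.
Variables (R : realType) (I : instance R).
Hypothesis valid : valid_instance I.
Local Notation n := (Defs.order I).
Local Notation inn := (inn_of I).
Local Notation inr := (inr_of I).
Local Notation U := (mincover I).
Local Notation run := (run n inn inr).
Local Notation bxeval := (bxeval n inn inr).
Local Notation yeval := (yeval n inn inr).
Local Notation s := (edge I).
Local Notation w := (weight I).

Variables (S : rel 'I_n) (NB : nat) (rk : 'I_n -> nat) (bf : 'I_n -> bool) (bi : 'I_n -> nat).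
Hypothesis inv : elim_inv n set0 S NB rk bf bi.
Variable b : nat -> bool.
Local Notation L := (Lset S rk).
Local Notation fixed := (fixed S rk bf bi b).
Local Notation local := (local L).
Local Notation local_min := (local_min L).
Local Notation term := (term L rk bf).
Local Notation uaf := (@uaf R I).
Local Notation bbf := (@bbf R I).

Lemma rk_surj k : k < n -> exists v, rk v = k.
Proof.
move=> hk; pose f v := Ordinal (rk_lt inv v).
have fi : injective f by move=> u v /(congr1 val) /= /(rk_injective inv).
have [g _ gK] := injF_bij fi; exists (g (Ordinal hk)).
by have := congr1 val (gK (Ordinal hk)).
Qed.

Lemma local_row ua bb ua' bb' v c (x : 'I_n -> bool) :
  (forall c, ua' v c = ua v c) -> (forall u c d, bb' v u c d = bb v u c d) ->
  local ua' bb' v c x = local ua bb v c x :> R.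
Proof.
by move=> h1 h2; rewrite /local h1; congr (_ + _)%R; apply: eq_bigr => u _; rewrite h2.
Qed.

Definition bits_agree (x : 'I_n -> bool) : Prop := forall v, bf v -> x v = b (bi v).

Variable E0 : ('I_n -> bool) -> R.

(** The original energy is preserved up to a constant [K], the sum of the minima of vertices without
    later neighbours. It is claimed only for assignments that take the branching bits of the present
    leaf. *)
Definition forward_inv (k : nat) (g : store R) : Prop :=
  [/\ fixed g, forall v : 'I_n, na g aVL v = (bf v && (rk v < k)) && b (bi v) &
    exists K, forall x, bits_agree x ->
      E0 x = (K + \sum_v term k (uaf g) (bbf g) x v)%R].

Lemma vl_step k v : rk v = k -> forall u, ~~ bf v || (u != v) ->
  (bf u && (rk u < k.+1)) = (bf u && (rk u < k)).
Proof.
move=> rv u; rewrite ltnS leq_eqVlt.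
case: (rk u =P k) => [e|_] //=.
have -> : u = v by apply: (rk_injective inv); rewrite e rv.
by rewrite eqxx orbF => /negbTE ->.
Qed.

Lemma run_p_forward_step env k g : env 9 = k -> k < n -> forward_inv k g ->
  forward_inv k.+1 (run p_forward_step env g).
Proof.
move=> h9 kn [hf hV [K hK]].
have [v rv] := rk_surj kn.
have vL : (v \in L v) = false by apply/negP => /(Lset_rk); rewrite ltnn.
have selE env' g' i : env' 9 = k -> (forall u : 'I_n, na g' aRK u = rk u) -> i < n ->
    bxeval (upd env' 10 i) g' (BE (XRd aRK (IV 10)) (IV 9)) = (i == v).
  move=> h9' hr hi; rewrite -[LHS]/(na g' aRK (Ordinal hi) == env' 9) hr h9' -rv.
  rewrite (inj_eq (rk_injective inv)) -val_eqE //.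
rewrite /p_forward_step (@run_select R n inn inr 10 _ _ env g v) //; first last.
- move=> i hi; apply: selE => // u; rewrite frame_n //; exact: fx_rk hf u.
- by move=> i hi; apply: selE => //; apply: fx_rk hf.
set env1 := upd env 10 v.
have e10 : env1 10 = v by [].
have e9 : env1 9 = rk v by rewrite rv.
rewrite -[run _ env1 g]/(if 0 < na g aBF v then run (p_assign_branch (IV 10)) env1 g
  else run (p_count 11 IN (x_later (IV 10) (IV 11)) ;;
        PIf (BE (sc aDD) 1) (p_message1 (IV 10))
          (PIf (BE (sc aDD) 2) (p_message2 (IV 10)) PSkip)) env1 g) (fx_bf hf) b2n_gt0.
have le_notL u : rk u <= k -> (u \in L v) = false.
  by move=> le; apply/negP => /(Lset_rk); rewrite rv ltnNge le.
have sumL (X : 'I_n -> R) : (\sum_(u | (k < rk u)%N) (if u \in L v then X u else 0) = \sum_(u in L v) X u)%R.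
  rewrite -big_mkcondr; apply: eq_bigl => u; case: (boolP (u \in L v)) => uL; last by rewrite andbF.
  by rewrite -rv (Lset_rk uL).
case: (boolP (bf v)) => bv.
  have [n1 V1 u1 b1] := @run_p_assign_branch R I S NB rk bf bi inv b env1 g v hf e10 e9 bv.
  set g' := run _ env1 g in n1 V1 u1 b1 *; clearbody g'.
  split.
  - by case: hf => q1 q2 q3 q4 q5; split; rewrite /graph_is ?n1.
  - move=> u; rewrite V1 updE val_eqE; case: (u =P v) => [->|/eqP uv].
      by rewrite bv rv ltnSn.
    by rewrite hV (@vl_step k v rv u) // uv orbT.
  - exists K => x hx; rewrite hK //; congr (_ + _)%R.
    rewrite -[RHS]add0r.
    apply: (@term_step _ _ L rk bf (rk_injective inv) k (uaf g) (bbf g) (uaf g') (bbf g') v x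
      (fun u => if u \in L v then bbf g v u (x v) (x u) else 0)%R
      (\sum_(u in L v) bbf g v u (x v) (x u))%R) => //.
    + by move=> u c le; rewrite u1 le_notL // addr0.
    + move=> u _; rewrite /local u1 (hx v bv) -!addrA; congr (_ + _)%R; rewrite addrC; congr (_ + _)%R.
      by apply: eq_bigr => u' _; rewrite b1.
    + by rewrite /local /term rv ltnSn bv u1 vL !addr0.
have [cl clique] := ei_later inv (negbT (in_set0 v)) bv.
rewrite -/(L v) in cl clique.
rewrite run_PSeq.
have [i g' hi [g1 _]|[c1 c2] c3] := @run_count R n inn inr 11 IN (x_later (IV 10) (IV 11)) env1 g
    (ext_pred (fun u => u \in L v)).
  have hg' : fixed g' by case: hf => q1 q2 q3 q4 q5; split; rewrite /graph_is ?g1.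
  by rewrite (@x_laterE R I S rk bf bi b (upd env1 11 i) g' v (Ordinal (hi : i < n)) (IV 10) (IV 11) hg') ?ext_pred_ord.
set g1 := run (p_count _ _ _) env1 g in c1 c2 c3 *; clearbody g1.
have DD : na g1 aDD 0 = #|L v|.
  rewrite c3 -sum1_card [RHS]big_mkcond; apply: eq_bigr => u _.
  by rewrite ext_predE; case: (u \in L v).
have hf1 : fixed g1 by case: hf => q1 q2 q3 q4 q5; split; rewrite /graph_is ?c1.
have ug1 : uaf g1 = uaf g by apply: funext => u; apply: funext => c; rewrite /uaf c2.
have bg1 : bbf g1 = bbf g.
  by do 4!apply: funext => ?; rewrite /bbf c2.
rewrite -[run _ env1 g1]/(if na g1 aDD 0 == 1 then run (p_message1 (IV 10)) env1 g1
   else if na g1 aDD 0 == 2 then run (p_message2 (IV 10)) env1 g1 else g1) DD.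
have V' (g2 : store R) : na g2 = na g1 -> forall u : 'I_n, na g2 aVL u = (bf u && (rk u < k.+1)) && b (bi u).
  by move=> e u; rewrite e c1 // hV (@vl_step k v rv u) // bv.
have tv (g2 : store R) x ka : (forall c, uaf g2 v c = uaf g v c) -> (forall u c d, bbf g2 v u c d = bbf g v u c d) ->
    (local_min (uaf g) (bbf g) v x = ka)%R ->
    (local (uaf g) (bbf g) v (x v) x = term k.+1 (uaf g2) (bbf g2) x v + ka)%R.
  move=> r1 r2 <-; rewrite /term rv ltnSn (negbTE bv) /local_min.
  by rewrite !(local_row _ _ r1 r2) subrK.
(* The minimum does not depend on other vertices and joins the constant. *)
have [L0|Lpos] := eqVneq #|L v| 0.
  rewrite L0 /=; split; [exact: hf1 | exact: V' |].
  move/eqP: L0; rewrite cards_eq0 => /eqP L0.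
  exists (K + Num.min (uaf g v false) (uaf g v true))%R => x hx.
  rewrite hK // -addrA; congr (_ + _)%R; rewrite ug1 bg1.
  apply: (@term_step _ _ L rk bf (rk_injective inv) k (uaf g) (bbf g) (uaf g) (bbf g) v x
      (fun u => 0)%R 0%R) => //.
  - by move=> u _; rewrite addr0.
  - by rewrite big1.
  - by rewrite addr0; apply: tv => //; rewrite /local_min /local L0 !big_set0 !addr0.
case: eqP => [L1|ne1].
  have [p Lp] : exists p, L v = [set p] by apply/cards1P; rewrite L1.
  have [n2 u2 b2] := @run_p_message1 R I S rk bf bi b env1 g1 v hf1 e10 e9.
  set g2 := run _ env1 g1 in n2 u2 b2 *; clearbody g2.
  rewrite ug1 bg1 in u2 b2.
  split; [exact: fixed_na n2 hf1 | exact: V' |].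
  exists K => x hx; rewrite hK //; congr (_ + _)%R; rewrite -[RHS]add0r.
  apply: (@term_step _ _ L rk bf (rk_injective inv) k (uaf g) (bbf g) (uaf g2) (bbf g2) v x
      (fun u => if u \in L v then Num.min (uaf g v false + bbf g v u false (x u)) (uaf g v true + bbf g v u true (x u)) else 0)%R
      (local_min (uaf g) (bbf g) v x)) => //.
  - by move=> u c le; rewrite u2 le_notL // addr0.
  - move=> u _; rewrite /local u2 -!addrA; congr (_ + _)%R; rewrite addrC; congr (_ + _)%R.
    by apply: eq_bigr => u' _; rewrite b2.
  - by rewrite sumL Lp big_set1 /local_min /local Lp !big_set1.
  - rewrite addr0; apply: tv => // c; by rewrite u2 vL addr0.
have L2 : #|L v| = 2 by clear -cl Lpos ne1; lia.
rewrite L2 eqxx.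
have [p [q [pq Lpq rpq]]] : exists p q, [/\ p != q, L v = [set p; q] & rk p < rk q].
  have /cards2P [p [q [pq Lpq]]] : #|L v| == 2 by rewrite L2.
  case: (ltngtP (rk p) (rk q)) => [lt|gt|e].
  - by exists p, q.
  - by exists q, p; rewrite eq_sym pq gt setUC.
  - by move: pq; rewrite (rk_injective inv e) eqxx.
have pL : p \in L v by rewrite Lpq !inE eqxx.
have qL : q \in L v by rewrite Lpq !inE eqxx orbT.
(* Here the filling pays off: [p] and [q] are adjacent in [S], so the message lands in a table that
   the local cost of [p] already sums. *)
have qLp : q \in L p by rewrite in_Lset rpq andbT; apply: clique.
have [n2 u2 b2] := @run_p_message2 R I S rk bf bi b env1 g1 v hf1 e10 e9.
set g2 := run _ env1 g1 in n2 u2 b2 *; clearbody g2.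
rewrite ug1 bg1 in u2 b2.
split; [exact: fixed_na n2 hf1 | exact: V' |].
exists K => x hx; rewrite hK //; congr (_ + _)%R; rewrite -[RHS]add0r.
pose m (u u' : 'I_n) : R := Num.min (uaf g v false + bbf g v u false (x u) + bbf g v u' false (x u'))%R
    (uaf g v true + bbf g v u true (x u) + bbf g v u' true (x u'))%R.
apply: (@term_step _ _ L rk bf (rk_injective inv) k (uaf g) (bbf g) (uaf g2) (bbf g2) v x
    (fun u => \sum_(u' in L u) if [&& (rk u < rk u')%N, u \in L v & u' \in L v] then m u u' else 0)%R
    (local_min (uaf g) (bbf g) v x)) => //.
- by move=> u u' c d le; rewrite b2 le_notL // andbF addr0.
- move=> u _; rewrite /local u2 -addrA -big_split /=; congr (_ + _)%R.
  by apply: eq_bigr => u' _; rewrite b2.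
- have kp : k < rk p by rewrite -rv (Lset_rk pL).
  rewrite (bigD1 p) //= [X in (_ + X)%R]big1 ?addr0.
    rewrite (bigD1 q) //= rpq pL qL /= [X in (_ + X)%R]big1 ?addr0.
      rewrite /m /local_min /local Lpq !big_setU1 ?inE //= !big_set1.
      by rewrite !addrA.
    move=> u /andP[uLp uq]; case: ifP => // /andP[_]; rewrite Lpq !inE (negbTE uq) orbF => /eqP up.
    by move: (Lset_rk uLp); rewrite up ltnn.
  move=> u /andP[_ up]; rewrite big1 // => u' _; case: ifP => // /and3P[lt].
  rewrite Lpq !inE (negbTE up) /= => /eqP uq /orP[/eqP e|/eqP e]; move: lt; rewrite uq e ?ltnn //.
  by rewrite ltnNge ltnW.
- rewrite addr0; apply: tv => // u c d.
  by rewrite b2 vL /= andbF addr0.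
Qed.

End Cubic.

(** * The penalty and the backward pass *)

Section Backward.
Variables (R : realType) (I : instance R).
Hypothesis valid : valid_instance I.
Local Notation n := (Defs.order I).
Local Notation inn := (inn_of I).
Local Notation inr := (inr_of I).
Local Notation U := (mincover I).
Local Notation run := (run n inn inr).
Local Notation bxeval := (bxeval n inn inr).
Local Notation yeval := (yeval n inn inr).
Local Notation s := (edge I).
Local Notation w := (weight I).
Local Notation uaf := (@uaf R I).
Local Notation bbf := (@bbf R I).

Definition penalty : R := (budget I + \sum_v w v)%R.

Lemma run_p_tables env h : (forall k, ra h k = fun _ => 0%R) ->
  let h' := run p_tables env h in
  [/\ na h' = na h, forall v (c : bool), uaf h' v c = if c then w v else 0%R &
      forall v u (c d : bool), bbf h' v u c d =
        if [&& s v u, ~~ c & ~~ d] then penalty else 0%R].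
Proof.
move=> h0 h'; rewrite /h' /p_tables 3!run_PSeq.
set h1 := run (PR rBIG 0 YW) env h.
have n1 : na h1 = na h by [].
have b1 : ra h1 rBIG 0 = budget I by rewrite /h1 /= updE eqxx.
have r1 k : k != rBIG -> ra h1 k = fun _ => 0%R by move=> hk; rewrite /h1 /= (negbTE hk).
clearbody h1.
have ad2 : radds n inn inr (PFor 10 IN (y_add rBIG 0 (YWt (IV 10)))) rBIG pred0 env h1
    (fun i => \sum_(j < n) if i == 0%N then win n inr j else 0)%R.
  apply: (@radds_for R n inn inr _ _ _ 10 IN _ _ (fun j i => if i == 0%N then win n inr j else 0)%R) => j hj.
  exact: radds_add.
have [[n2 r2 _] b2] := ad2 h1 (sim_refl _ _ _).
set h2 := run (PFor 10 IN _) env h1 in n2 r2 b2 *; clearbody h2.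
have {}b2 : ra h2 rBIG 0 = penalty.
  by rewrite b2 b1 eqxx; congr (_ + _)%R; apply: eq_bigr => j _; rewrite winE.
have ad3 : radds n inn inr (PFor 10 IN (y_add rUA (u_cell (IV 10) 1) (YWt (IV 10)))) rUA pred0 env h2
    (fun i => \sum_(j < n) if (i == 2 * j + 1)%N then win n inr j else 0)%R.
  apply: (@radds_for R n inn inr _ _ _ 10 IN _ _ (fun j i => if (i == 2 * j + 1)%N then win n inr j else 0)%R) => j hj.
  exact: radds_add.
have [[n3 r3 _] u3] := ad3 h2 (sim_refl _ _ _).
set h3 := run (PFor 10 IN _) env h2 in n3 r3 u3 *; clearbody h3.
have ad4 : radds n inn inr (PFor 10 IN (PFor 11 IN (when (BN 1 (XA (IV 10) (IV 11)))
    (y_add rBB (b_cell (IV 10) (IV 11) 0 0) (ysc rBIG))))) rBB pred0 env h3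
    (fun i => \sum_(j < n) \sum_(l < n) if (0 < ain n inn j l)%N then
       if (i == 4 * (n * j + l) + (2 * 0 + 0))%N then penalty else 0 else 0)%R.
  apply: (@radds_for R n inn inr _ _ _ 10 IN _ _ (fun j i => \sum_(l < n) if (0 < ain n inn j l)%N then
       if (i == 4 * (n * j + l) + (2 * 0 + 0))%N then penalty else 0 else 0)%R) => j hj.
  apply: (@radds_for R n inn inr _ _ _ 11 IN _ _ (fun l i => if (0 < ain n inn j l)%N then
       if (i == 4 * (n * j + l) + (2 * 0 + 0))%N then penalty else 0 else 0)%R) => l hl.
  apply: radds_when => [g _|_] //.
  apply: radds_add => // g [_ g2 _].
  by rewrite -[LHS]/(ra g rBIG 0) g2 // r3.
have [[n4 r4 _] u4] := ad4 h3 (sim_refl _ _ _).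
split.
- by rewrite n4 n3 n2.
- move=> v c; rewrite /uaf r4 // u3 r2 // r1 // add0r.
  rewrite -(winE v) -(@sum_pick R n (fun j => if c then win n inr j else 0)%R v) //.
  apply: eq_bigr => j _; rewrite u_cell_eq ?b2n_lt2 //; case: c => /=; first by rewrite andbT.
  by rewrite andbF if_same.
- move=> v u c d; have -> : s v u = (0 < ain n inn v u) by rewrite ainE b2n_gt0.
  rewrite /bbf u4 r3 // r2 // r1 // add0r.
  rewrite -(@sum_pick R n (fun j => if [&& (0 < ain n inn j u)%N, ~~ c & ~~ d] then penalty else 0)%R v) //.
  apply: eq_bigr => j _.
  rewrite -(@sum_pick R n (fun l => if [&& (0 < ain n inn j l)%N, ~~ c & ~~ d] then penalty else 0)%R u) // -sum_if.
  apply: eq_bigr => l _; rewrite b_cell_eq ?b2n_lt2 // (cell_eq v u j l) !val_eqE.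
  by case: (0 < _); case: (v == j); case: (u == l); case: c; case: d.
Qed.

Variables (S : rel 'I_n) (NB : nat) (rk : 'I_n -> nat) (bf : 'I_n -> bool) (bi : 'I_n -> nat).
Hypothesis inv : elim_inv n set0 S NB rk bf bi.
Variable b : nat -> bool.
Local Notation L := (Lset S rk).
Local Notation fixed := (fixed S rk bf bi b).
Local Notation local := (local L).
Local Notation local_min := (local_min L).
Local Notation bits_agree := (bits_agree bf bi b).

Section Tables.
Variables (ua : 'I_n -> bool -> R) (bb : 'I_n -> 'I_n -> bool -> bool -> R).
Hypothesis uaE : forall v (c : bool), ua v c = if c then w v else 0%R.
Hypothesis bbE : forall v u (c d : bool), bb v u c d =
  if [&& s v u, ~~ c & ~~ d] then penalty else 0%R.

Definition energy (x : 'I_n -> bool) : R := (\sum_v local ua bb v (x v) x)%R.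

Lemma energyE x : energy x = (\sum_v (if x v then w v else 0) +
  \sum_v \sum_(u in L v) if [&& s v u, ~~ x v & ~~ x u] then penalty else 0)%R.
Proof.
rewrite /energy /local big_split /=; congr (_ + _)%R.
  by apply: eq_bigr => v _; rewrite uaE.
by apply: eq_bigr => v _; apply: eq_bigr => u _; rewrite bbE.
Qed.

Lemma energy_cover (C : {set 'I_n}) : vertex_cover s C ->
  energy (fun v => v \in C) = total_weight C.
Proof.
move=> hC; rewrite energyE /total_weight [in RHS]big_mkcond [X in (_ + X)%R]big1 ?addr0 // => v _.
rewrite big1 // => u _; case: and3P => // -[e]; have := hC v u e.
by case: (v \in C) => //= ->.
Qed.

(** An uncovered edge lies in [S] and is charged to its end eliminated first; the penalty alone
    exceeds the budget, since it includes a positive weight. The unary costs are the weight of the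
    set. *)
Lemma energy_le_budget x : (energy x <= budget I)%R ->
  vertex_cover s [set v | x v] /\ (total_weight [set v | x v] <= budget I)%R.
Proof.
have [[_ _] w1 W1 _] := valid.
have w0 v : (0 <= w v)%R by apply: le_trans (w1 v); exact: ler01.
have s0 : (0 <= \sum_v w v)%R by apply: sumr_ge0.
have p0 : (0 <= penalty)%R by apply: addr_ge0 => //; apply: le_trans W1; exact: ler01.
have a0 : (0 <= \sum_v (if x v then w v else 0))%R by apply: sumr_ge0 => v _; case: (x v).
have q0 v u : (0 <= if [&& s v u, ~~ x v & ~~ x u] then penalty else 0)%R by case: ifP.
have c0 v : (0 <= \sum_(u in L v) if [&& s v u, ~~ x v & ~~ x u] then penalty else 0)%R by apply: sumr_ge0.
rewrite energyE => le; split; last first.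
  rewrite /total_weight big_mkcond; apply: le_trans le.
  under eq_bigr do rewrite inE.
  by rewrite lerDl sumr_ge0.
move=> u v; rewrite !inE => e; apply: contraTT le; rewrite negb_or -ltNge => /andP[xu xv].
have pos y z : s y z -> ~~ x y -> ~~ x z -> rk y < rk z ->
    (budget I < \sum_v (if x v then w v else 0) +
     \sum_v \sum_(u in L v) if [&& s v u, ~~ x v & ~~ x u] then penalty else 0)%R.
  move=> e1 xy xz lt; have zL : z \in L y by rewrite in_Lset lt andbT (ei_sub inv).
  apply: (@lt_le_trans _ _ penalty).
    rewrite /penalty ltrDl (bigD1 y) //=; apply: ltr_wpDr; first exact: sumr_ge0.
    exact: lt_le_trans (w1 y).
  apply: ler_wpDl => //; rewrite (bigD1 y) //=; apply: ler_wpDr; first exact: sumr_ge0.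
  rewrite (bigD1 z) //= e1 xy xz /=; apply: ler_wpDr => //.
  by apply: sumr_ge0 => i _; case: ifP.
case: (ltngtP (rk u) (rk v)) => [lt|gt|er].
- exact: pos lt.
- by apply: (pos v u) => //; have [[sy _] _ _ _] := valid; rewrite sy.
- have [[_ ir] _ _ _] := valid.
  by move: e; rewrite (rk_injective inv er) ir.
Qed.

End Tables.

Lemma run_never x p c env (h : store R) :
  (forall i, i < n -> bxeval (upd env x i) h c = false) ->
  run (PFor x IN (when c p)) env h = h.
Proof.
move=> hc; rewrite run_PFor; apply: (@iteri_inv _ (fun _ y => y = h)) => // t y ht ->.
by rewrite run_when hc.
Qed.

(** The last [k] ranks are settled: their minimised vertices attain the local minimum given the
    later values. Values of lower rank are provisional, except for the branching bits. *)
Definition backward_inv (ua : 'I_n -> bool -> R) (bb : 'I_n -> 'I_n -> bool -> bool -> R)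
    (k : nat) (g : store R) : Prop :=
  [/\ fixed g, uaf g = ua, bbf g = bb &
    exists y : 'I_n -> bool, [/\ forall v : 'I_n, na g aVL v = y v, bits_agree y &
      forall v, ~~ bf v -> n - k <= rk v -> local ua bb v (y v) y = local_min ua bb v y]].

Lemma run_p_backward_step ua bb (env : nat -> nat) k g : env 9 = k -> k < n ->
  backward_inv ua bb k g -> backward_inv ua bb k.+1 (run p_backward_step env g).
Proof.
move=> h9 kn [hf hu hb [y [hV hy hmin]]].
have kn' : n - 1 - k < n by move: kn; clear; lia.
have [v rv] := rk_surj inv kn'.
have vL u : rk u <= rk v -> (u \in L v) = false.
  by move=> le; apply/negP => /(Lset_rk); rewrite ltnNge le.
have vL' u : rk v <= rk u -> (v \in L u) = false.
  by move=> le; apply/negP => /(Lset_rk); rewrite ltnNge le.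
have late u : n - k.+1 <= rk u -> u != v -> n - k <= rk u.
  move=> le uv; have ne : rk u != rk v by apply: contra uv => /eqP /(rk_injective inv) ->.
  by move: ne le; rewrite rv; move: kn; clear; lia.
pose cnd := BConj (BE (XRd aRK (IV 10)) (ISub (ISub IN 1) (IV 9))) (BE (XRd aBF (IV 10)) 0).
have selE env' g' i : env' 9 = k -> (forall u : 'I_n, na g' aRK u = rk u) ->
    (forall u : 'I_n, na g' aBF u = bf u) -> i < n ->
    bxeval (upd env' 10 i) g' cnd = (i == v) && ~~ bf v.
  move=> h9' hr hbf hi.
  rewrite -[LHS]/((na g' aRK (Ordinal hi) == n - 1 - env' 9) && (na g' aBF (Ordinal hi) == 0)).
  rewrite hr hbf h9' -rv (inj_eq (rk_injective inv)) -val_eqE /= eqb0.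
  by case: eqP => // e; rewrite (_ : Ordinal hi = v) //; apply: val_inj.
rewrite /p_backward_step -/cnd.
case: (boolP (bf v)) => bv.
  rewrite run_never; last first.
    move=> i hi; rewrite selE ?bv ?andbF //; [exact: fx_rk hf | exact: fx_bf hf].
  split=> //; exists y; split=> // u bu le; apply: hmin => //; apply: late => //.
  by apply: contra bu => /eqP ->.
rewrite (@run_select R n inn inr 10 _ _ env g v) //; first last.
- move=> i hi; rewrite selE ?bv ?andbT // => u; rewrite frame_n //; [exact: (fx_rk hf u) | exact: (fx_bf hf u)].
- move=> i hi; rewrite selE ?bv ?andbT //; [exact: fx_rk hf | exact: fx_bf hf].
set env1 := upd env 10 v.
have e10 : env1 10 = v by [].
rewrite 2!run_PSeq; set g1 := run _ env1 (run _ env1 g).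
have n1 : na g1 = na g by [].
have r1 k' : k' \notin [:: rQ0; rQ1] -> ra g1 k' = ra g k'.
  by rewrite !inE negb_or /g1 => /andP[/negbTE k0 /negbTE k1]; rewrite /= k1 k0.
have q0 : ra g1 rQ0 0 = ua v false.
  by rewrite -hu /g1 /= updE /= e10.
have q1 : ra g1 rQ1 0 = ua v true.
  by rewrite -hu /g1 /= updE /= e10.
clearbody g1; rewrite run_PSeq; set g2 := run (PFor 11 IN _) env1 g1.
pose F (c : bool) (j : nat) : R :=
  if ext_pred (fun u => u \in L v) j then ra g rBB (4 * (n * v + j) + (2 * c + na g aVL j)) else 0%R.
have [n2 r2 [q2 q3]] : [/\ na g2 = na g, forall k', k' \notin [:: rQ0; rQ1] -> ra g2 k' = ra g k' &
   ra g2 rQ0 0 = (ua v false + \sum_(j < n) F false j)%R /\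
   ra g2 rQ1 0 = (ua v true + \sum_(j < n) F true j)%R].
  rewrite /g2 run_PFor; set G := (X in iteri _ X _).
  apply: (@iteri_inv _ (fun t z => [/\ na z = na g, forall k', k' \notin [:: rQ0; rQ1] -> ra z k' = ra g k' &
   ra z rQ0 0 = (ua v false + \sum_(j < t) F false j)%R /\
   ra z rQ1 0 = (ua v true + \sum_(j < t) F true j)%R])).
    by split=> //; rewrite !big_ord0 !addr0.
  move=> t z ht [z1 z2 [z3 z4]]; rewrite /G run_when.
  have -> : bxeval (upd env1 11 t) z (x_later_back (IV 10) (IV 11)) = ext_pred (fun u => u \in L v) t.
    rewrite -[LHS]/((0 < na z aS (n * env1 10 + Ordinal (ht : t < n))) &&
       (na z aRK (env1 10) + 1 <= na z aRK (Ordinal (ht : t < n)))).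
    by rewrite e10 z1 (fx_graph hf) !(fx_rk hf) b2n_gt0 addn1 ext_pred_ord in_Lset.
  rewrite !big_ord_recr /= {2 4}/F; case: (ext_pred _ t); last by rewrite !addr0.
  split=> //.
  - by move=> k'; rewrite !inE negb_or => /andP[/negbTE k0 /negbTE k1]; rewrite /= k1 k0 z2 // !inE k1 k0.
  - by rewrite !updE /= [ra z rBB]z2 // z1 e10 z3 z4 !updE /= !addrA.
clearbody g2.
have sumF c : (ua v c + \sum_(j < n) F c j)%R = local ua bb v c y.
  rewrite /local; congr (_ + _)%R; rewrite [RHS]big_mkcond; apply: eq_bigr => u _.
  by rewrite /F ext_predE hV -hb.
rewrite !sumF in q2 q3.
pose c := (local ua bb v true y <= local ua bb v false y)%R.
have -> : run (PIf (BR (ysc rQ1) (ysc rQ0)) (PN aVL (IV 10) 1) (PN aVL (IV 10) 0)) env1 g2 =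
   setn g2 aVL v c.
  rewrite -[LHS]/(if (ra g2 rQ1 0 <= ra g2 rQ0 0)%R then setn g2 aVL (env1 10) 1 else setn g2 aVL (env1 10) 0).
  by rewrite q2 q3 e10 -/c; case: c.
split.
- by case: hf => f1 f2 f3 f4 f5; split; rewrite /graph_is ?na_setn /= ?n2.
- by rewrite -hu; apply: funext => u; apply: funext => d; rewrite /uaf /= r2.
- by rewrite -hb; apply: funext => u; apply: funext => u'; apply: funext => d; apply: funext => d'; rewrite /bbf /= r2.
pose y' u := if u == v then c else y u.
(* Local costs of rank at least that of [v] only look at still later vertices, so the new value of
   [v] does not disturb them. *)
have loc u d : rk v <= rk u -> local ua bb u d y' = local ua bb u d y.
  move=> le; rewrite /local; congr (_ + _)%R; apply: eq_bigr => z zL.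
  by rewrite /y'; case: eqP => // e; move: zL; rewrite e vL'.
exists y'; split.
- by move=> u; rewrite na_setn /= updE val_eqE n2 /y'; case: eqP.
- by move=> u bu; rewrite /y'; case: eqP => [e|_]; [move: bv; rewrite -e bu | exact: hy].
- move=> u bu le; have le' : rk v <= rk u by rewrite rv; move: le; clear; lia.
  rewrite /local_min !loc // /y'; case: eqP => [->|/eqP uv]; last by apply: hmin => //; exact: late.
  by rewrite /c; case: leP.
Qed.

(** After the forward pass the terms of branched vertices are fixed by the bits, and all other terms
    are nonnegative losses, which vanish at [y]. *)
Lemma forward_backward (E : ('I_n -> bool) -> R) ua bb g g' :
  forward_inv S rk bf bi b E n g -> uaf g = ua -> bbf g = bb -> backward_inv ua bb n g' ->
  exists y : 'I_n -> bool, (forall v : 'I_n, na g' aVL v = y v) /\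
    forall x, bits_agree x -> (E y <= E x)%R.
Proof.
move=> [_ _ [K hK]] hu hb [_ _ _ [y [hV hy hmin]]]; rewrite hu hb in hK.
exists y; split=> // x hx; rewrite !hK // lerD2l; apply: ler_sum => v _.
rewrite /term (rk_lt inv); case: (boolP (bf v)) => bv; first by rewrite hy // hx.
rewrite hmin ?subnn // subrr subr_ge0 /local_min ge_min.
by case: (x v); rewrite lexx ?orbT.
Qed.

End Backward.

Lemma bits_value_support (b : nat -> bool) k m : (forall i, k <= i -> b i = false) -> k <= m ->
  bits_value b m = bits_value b k.
Proof.
move=> hb; elim: m => [|m IH]; first by rewrite leqn0 => /eqP ->.
rewrite leq_eqVlt => /orP[/eqP -> //|km].
by rewrite /bits_value big_ord_recr /= -/(bits_value b m) IH // hb // addn0.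
Qed.

(** * Completeness of the branching in maximum degree three *)

Section CubicSpec.
Variables (R : realType) (I : instance R).
Hypothesis valid : valid_instance I.
Hypothesis small : forall v, #|[set u | edge I v u]| <= 3.
Local Notation n := (Defs.order I).
Local Notation inn := (inn_of I).
Local Notation inr := (inr_of I).
Local Notation U := (mincover I).
Local Notation run := (run n inn inr).
Local Notation s := (edge I).

Lemma mincover_half : #|U|./2 <= n.
Proof.
apply: (@leq_trans #|U|); first by clear; lia.
by apply: leq_trans (max_card _) _; rewrite card_ord.
Qed.

Lemma cubic_spec : branch_spec I p_cubic (2 ^ #|U|./2).
Proof.
(* The elimination order is computed with counter 0 and carried over to the other leaves, because
   [p_elim] does not read the counter. *)
have [st0 _] := prelude_start I 0.
set h0 := run prelude env0 (counter_store R 0) in st0.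
have [_ _ h0S h0z [h0r _]] := st0.
have [S [NB [rk [bf [bi [es inv]]]]]] := @run_p_elim R I valid small h0 h0S
  (congr1 (fun f => f 0) (h0z aNB erefl)) (h0z aRK erefl) (h0z aBF erefl) (h0z aBI erefl).
split.
- by rewrite expn_gt0 /= leq_exp2l // mincover_half.
- move=> c h [_ hT _ _ _]; rewrite /p_cubic 2!run_PSeq frame_n //.
  have eT : na (run p_elim env0 h) aT 0 = #|U| by rewrite frame_n.
  rewrite run_p_bits_NN eT //; apply: leq_trans (max_card _) _; by rewrite card_ord.
case=> C hC wC.
(* Bit [j] records whether the solution contains the branched vertex of index [j], which is unique;
   the bits from [t / 2] on are zero, so the value is below the number of leaves. *)
pose b j := (j < #|U|./2) && [exists v, [&& bf v, bi v == j & v \in C]].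
have xC : bits_agree bf bi b (fun v => v \in C).
  move=> v bv; rewrite /b (leq_trans (ei_bi inv bv)) ?(NB_le inv) //=.
  apply/idP/existsP => [vC|[u /and3P[bu /eqP e uC]]]; first by exists v; rewrite bv eqxx.
  by rewrite -(ei_bi_inj inv bu bv e).
have bv : bits_value b n = bits_value b #|U|./2.
  apply: bits_value_support mincover_half => i le; by rewrite /b ltnNge le.
exists (bits_value b n); first by rewrite bv bits_value_lt.
move=> h [hc _ hS hz [hr ha]].
rewrite /p_cubic 5!run_PSeq; set h1 := run p_elim env0 h.
have [a1 a2] : agree aC h1 (run p_elim env0 h0) by apply: run_agree.
have c1 : na h1 aC 0 = bits_value b n by rewrite /h1 frame_n.
have bt1 : na h1 aBT = fun=> 0 by rewrite /h1 frame_n // hz.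
have vl1 : na h1 aVL = fun=> 0 by rewrite /h1 frame_n // hz.
have r1 k : ra h1 k = fun=> 0%R by rewrite /h1 frame_r.
clearbody h1; set h2 := run p_bits env0 h1.
have bt2 := @run_p_bits R n inn inr env0 h1 b c1 bt1; rewrite -/h2 in bt2.
have n2 k : k \notin wn p_bits -> na h2 k = na h1 k by move=> hk; rewrite /h2 [LHS]frame_n.
have r2 k : ra h2 k = fun=> 0%R by rewrite /h2 frame_r.
clearbody h2.
have hf2 : fixed S rk bf bi b h2.
  split=> //; rewrite /graph_is.
  - by move=> u v; rewrite n2 // a1 // (es_graph es).
  - by move=> v; rewrite n2 // a1 // (es_rk es).
  - by move=> v; rewrite n2 // a1 // (es_bf es).
  - by move=> v; rewrite n2 // a1 // (es_bi es).
have [n3 u3 b3] := @run_p_tables R I env0 h2 r2.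
set h3 := run p_tables env0 h2 in n3 u3 b3 *; clearbody h3.
pose E x := energy S rk (@uaf R I h3) (@bbf R I h3) x.
have f3 : forward_inv S rk bf bi b E 0 h3.
  split; first exact: fixed_na n3 hf2.
  - by move=> v; rewrite n3 n2 // vl1 ltn0 andbF.
  - by exists 0%R => x _; rewrite add0r /E /energy /term.
set h4 := run (PFor 9 IN p_forward_step) env0 h3.
have f4 : forward_inv S rk bf bi b E n h4.
  rewrite /h4 run_PFor; apply: (@iteri_inv _ (forward_inv S rk bf bi b E)) => // k g kn.
  exact: (run_p_forward_step inv).
clearbody h4; set h5 := run (PFor 9 IN p_backward_step) env0 h4.
have f5 : backward_inv S rk bf bi b (@uaf R I h4) (@bbf R I h4) n h5.
  rewrite /h5 run_PFor.
  apply: (@iteri_inv _ (backward_inv S rk bf bi b (@uaf R I h4) (@bbf R I h4))) => [|k g kn].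
    case: f4 => q1 q2 _; split=> //; exists (fun v => bf v && b (bi v)); split.
    - by move=> v; rewrite q2 (rk_lt inv) andbT.
    - by move=> v ->.
    - by move=> v _; rewrite subn0 leqNgt (rk_lt inv).
  exact: (run_p_backward_step inv).
clearbody h5.
have [y [yV yE]] := forward_backward inv f4 erefl erefl f5.
have cov : cover_of I (run (PFor 10 IN (PN aOUT (IV 10) (XRd aVL (IV 10)))) env0 h5) = [set v | y v].
  have [|_ o] := @run_map R n inn inr aOUT 10 IN (XRd aVL (IV 10)) env0 h5 (na h5 aVL).
    by move=> i g hi [g1 _] _; rewrite -[LHS]/(na g aVL i) g1.
  by apply/setP => v; rewrite !inE o /= ltn_ord yV; case: (y v).
have [|covers_y wy] := @energy_le_budget R I valid S NB rk bf bi inv (@uaf R I h3) (@bbf R I h3) u3 b3 y.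
  apply: le_trans (yE _ xC) _; rewrite /E energy_cover //.
by rewrite /solved cov; apply/andP; split=> //; apply/coversP.
Qed.

End CubicSpec.

(** * Numerical bounds and conclusion *)

Local Open Scope ring_scope.

(** Cubes are compared, as $1.443^3 = 3.0046\ldots$ exceeds 3. *)
Lemma leaves_le_expr (R : realType) k : ((leaves k)%:R <= (1443%:R / 1000%:R) ^+ k :> R).
Proof.
have b0 : (0 <= 1443%:R / 1000%:R :> R) by lra.
rewrite -(@ler_pXn2r _ 3) ?nnegrE ?exprn_ge0 //.
apply: (@le_trans _ _ (3 ^+ k)).
  by rewrite -!natrX ler_nat leaves_cube.
rewrite -exprM mulnC exprM; apply: lerXn2r; rewrite ?nnegrE ?exprn_ge0 //.
by rewrite !exprS expr0; lra.
Qed.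

(** Since $1.415^2 = 2.0022\ldots$ exceeds 2; for odd [t] the rounding of [t / 2] only helps. *)
Lemma half_pow_le_expr (R : realType) (b : R) t : (1415%:R / 1000%:R <= b) ->
  (2 ^ t./2)%:R <= b ^+ t.
Proof.
move=> hb; have b1 : 1 <= b by lra.
have b0 : 0 <= b by lra.
apply: (@le_trans _ _ (b ^+ (2 * t./2))).
  rewrite natrX exprM; apply: lerXn2r; rewrite ?nnegrE ?exprn_ge0 //.
  by rewrite expr2; nra.
by apply: ler_weXn2l => //; lia.
Qed.

Theorem mainTheorem5 (R : realType) :
  exists p : cmd,
    solves_WVCstar p (fun _ : instance R => True) (1443%:R / 1000%:R) /\
    solves_WVCstar p (fun I : instance R => max_degree_le (edge I) 3)
      (1415%:R / 1000%:R).
Proof.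
have [p hp] := assembly R body_ok; exists p; split; apply: hp; try lra.
(* The program takes the cubic route whenever it can, so the general bound must cover that route
   too, by $1.415 \le 1.443$. *)
- move=> I valid _; case e: (small_degree I).
    exists (2 ^ #|mincover I|./2)%N; last by apply: half_pow_le_expr; lra.
    by apply: body_searches; rewrite e; apply: cubic_spec => // v; apply: (forallP e).
  exists (leaves #|mincover I|); last exact: leaves_le_expr.
  by apply: body_searches; rewrite e; apply: general_spec.
- move=> I valid dI; exists (2 ^ #|mincover I|./2)%N; last exact: half_pow_le_expr.
  apply: body_searches; have -> : small_degree I by apply/forallP.
  exact: cubic_spec.
Qed.
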